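(* Every $\Delta$-complete $\Delta$-closed set $X\subseteq\mathbb P^n$ has Lascar rank strictly less than $\omega^m$.
   Context: $\Delta=\{\delta_1,\dots,\delta_m\}$ is a finite set of commuting derivations; $F$ is a model of $DCF_{0,m}$ and all points lie in a very saturated model $\mathcal U\supseteq F$ of $DCF_{0,m}$. $\Delta$-closed subsets of $\mathbb P^n$ are zero sets of sets of $\Delta$-homogeneous $\Delta$-polynomials (Kolchin topology). A $\Delta$-closed set $X\subseteq\mathbb P^n$ is $\Delta$-complete if for every quasi-projective $\Delta$-variety $Y$ the projection $X\times Y\to Y$ maps $\Delta$-closed subsets of $X\times Y$ to $\Delta$-closed subsets of $Y$. Lascar rank of a definable set is the maximal Lascar rank of a type of a point in it. *)

(* Defs.v *)
From HB Require Import structures.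
From mathcomp Require Import all_boot all_order all_algebra finmap.
From mathcomp Require Import monalg.

Set Implicit Arguments.
Unset Strict Implicit.
Unset Printing Implicit Defensive.

Import GRing.Theory.
Local Open Scope ring_scope.

(** * Differential fields *)

Record dfield (m : nat) := DField {
  dcar :> fieldType;
  der : 'I_m -> dcar -> dcar;
  dchar0 : [pchar dcar] =i pred0;
  derD : forall i, {morph der i : x y / x + y};
  derM : forall i x y, der i (x * y) = der i x * y + x * der i y;
  derC : forall i j x, der i (der j x) = der j (der i x) }.

Record dembed (m : nat) (K L : dfield m) := DEmbed {
  demb :> {rmorphism K -> L};
  demb_der : forall i x, demb (der i x) = der i (demb x) }.

(* [e] is the operator delta_1^(e_1) ... delta_m^(e_m). *)
Definition dop (m : nat) (K : dfield m) (e : {ffun 'I_m -> nat}) (x : K) : K :=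
  foldr (fun i y => iter (e i) (der i) y) x (enum 'I_m).

(* Delta-polynomials over R in the Delta-indeterminates (y_j)_(j : J): the
   polynomial ring over R in the algebraic indeterminates [(e, j)], which
   stand for the derivatives e(y_j). *)
Definition dpoly (R : nzRingType) (m : nat) (J : choiceType) :=
  {malg R[{cmonom ({ffun 'I_m -> nat} * J)%type}]}.

(* The value at [v] of a Delta-polynomial with coefficients mapped by [f]. *)
Definition deval (R : nzRingType) (m : nat) (J : choiceType) (K : dfield m)
    (f : R -> K) (v : J -> K) (p : dpoly R m J) : K :=
  mmap f (fun u : {cmonom ({ffun 'I_m -> nat} * J)%type} =>
    \prod_(k <- finsupp (cmonom_val u)) dop k.1 (v k.2) ^+ (u k)) p.

(* The models of DCF_(0,m), the model companion of the theory of fields of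
   characteristic 0 with m commuting derivations, are the existentially closed
   Delta-fields: by disjunctive normal forms it is enough to consider
   finite systems of equations and inequations. *)
Definition dclosed_field (m : nat) (K : dfield m) : Prop :=
  forall (L : dfield m) (h : dembed K L) (n : nat)
         (eqs neqs : seq (dpoly K m 'I_n)),
    (exists a : 'I_n -> L,
       (forall p, p \in eqs -> deval h a p = 0) /\
       (forall p, p \in neqs -> deval h a p <> 0)) ->
    exists a : 'I_n -> K,
       (forall p, p \in eqs -> deval idfun a p = 0) /\
       (forall p, p \in neqs -> deval idfun a p <> 0).

(** * First-order formulas, types and forking *)

(* An atomic formula in the language of Delta-rings is an equation between
   terms, that is, [p = 0] for a Delta-polynomial over the integers. *)
Inductive dformula (m : nat) : Type :=
| FEq0 of dpoly int m nat
| FNot of dformula m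
| FAnd of dformula m & dformula m
| FEx of nat & dformula m.

(* The variable number [k] has the value [e`_k], which is 0 past the end of [e]. *)
Fixpoint dholds (m : nat) (K : dfield m) (e : seq K) (phi : dformula m) : Prop :=
  match phi with
  | FEq0 p => deval (fun z : int => z%:~R) (fun k => e`_k) p = 0
  | FNot phi1 => ~ dholds e phi1
  | FAnd phi1 phi2 => dholds e phi1 /\ dholds e phi2
  | FEx k phi1 => exists x : K, dholds (set_nth 0 e k x) phi1
  end.

(* The cardinality of [A] is less than that of [kappa]. *)
Definition small (kappa T : Type) (A : T -> Prop) : Prop :=
  ~ exists g : kappa -> T, injective g /\ forall x, A (g x).

Definition params (T : eqType) (A : T -> Prop) (b : seq T) : Prop :=
  forall x, x \in b -> A x.

(* kappa-saturation; the formula [phi(x, b)] is encoded by the pair [(phi, b)]. *)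
Definition saturated (m : nat) (kappa : Type) (U : dfield m) : Prop :=
  forall (A : U -> Prop), small kappa A ->
  forall (n : nat) (Sigma : dformula m -> seq U -> Prop),
    (forall phi b, Sigma phi b -> params A b) ->
    (forall (l : nat) (phi : 'I_l -> dformula m) (b : 'I_l -> seq U),
       (forall i, Sigma (phi i) (b i)) ->
       exists a : n.-tuple U, forall i, dholds (a ++ b i) (phi i)) ->
    exists a : n.-tuple U, forall phi b, Sigma phi b -> dholds (a ++ b) phi.

(* tp(a / A) = tp(a' / A) *)
Definition same_type (m : nat) (U : dfield m) (A : U -> Prop) (a a' : seq U) : Prop :=
  size a = size a' /\
  forall (phi : dformula m) (b : seq U), params A b ->
    (dholds (a ++ b) phi <-> dholds (a' ++ b) phi).

(* [phi(x, c)], with [x] of length [n], divides over [A]. *)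
Definition divides (m : nat) (U : dfield m) (A : U -> Prop) (n : nat)
    (phi : dformula m) (c : seq U) : Prop :=
  exists (k : nat) (cs : nat -> seq U),
    (forall i, same_type A (cs i) c) /\
    forall s : seq nat, uniq s -> size s = k ->
      ~ exists x : n.-tuple U, forall i, i \in s -> dholds (x ++ cs i) phi.

(* tp(a / B) forks over [A]. *)
Definition forks (m : nat) (U : dfield m) (A B : U -> Prop) (n : nat)
    (a : n.-tuple U) : Prop :=
  exists (phi : dformula m) (b : seq U),
    [/\ params B b, dholds (a ++ b) phi &
    exists (l : nat) (psi : 'I_l -> dformula m) (c : 'I_l -> seq U),
      (forall i, divides A n (psi i) (c i)) /\
      forall x : n.-tuple U, dholds (x ++ b) phi ->
        exists i, dholds (x ++ c i) (psi i)].

(** * Ordinals *)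

(* [OSup f] is the least ordinal greater than all the [f i]; distinct trees may
   denote the same ordinal, so equality is [ole] in both directions. *)
Inductive Ord : Type := OSup (T : Type) (f : T -> Ord).

Fixpoint ole (a b : Ord) {struct a} : Prop :=
  match a, b with
  | OSup T f, OSup T' g => forall i, exists j, ole (f i) (g j)
  end.

Definition osucc (a : Ord) : Ord := OSup (fun _ : unit => a).

Definition olt (a b : Ord) : Prop := ole (osucc a) b.

Definition ozero : Ord := OSup (fun v : void => match v with end).

Fixpoint oadd (a b : Ord) {struct b} : Ord :=
  match a, b with
  | OSup T f, OSup T' g =>
      OSup (fun k : T + T' => match k with inl i => f i | inr j => oadd a (g j) end)
  end.

Fixpoint omuln (a : Ord) (k : nat) : Ord :=
  if k is k'.+1 then oadd (omuln a k') a else ozero.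

(* omega^r; omega^(r+1) is the supremum of the strictly increasing sequence
   omega^r * k. *)
Fixpoint omega_pow (r : nat) : Ord :=
  if r is r'.+1 then OSup (fun k : nat => omuln (omega_pow r') k) else osucc ozero.

(** * Lascar rank *)

(* RU(tp(a / A)) >= alpha: for each beta < alpha some forking extension of
   tp(a / A) to a small set has rank at least beta.  By saturation, types over
   small sets are given by realizations. *)
Fixpoint lascar_ge (m : nat) (kappa : Type) (U : dfield m) (n : nat) (alpha : Ord)
    (A : U -> Prop) (a : n.-tuple U) {struct alpha} : Prop :=
  match alpha with
  | OSup T f => forall i : T, exists (B : U -> Prop) (a' : n.-tuple U),
      [/\ (forall x, A x -> B x) /\ small kappa B, same_type A a a',
          forks A B a' & lascar_ge kappa (f i) B a']
  end.

Definition lascar_le (m : nat) (kappa : Type) (U : dfield m) (n : nat)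
    (alpha : Ord) (A : U -> Prop) (a : n.-tuple U) : Prop :=
  ~ lascar_ge kappa (osucc alpha) A a.

(** * Projective space and its Kolchin topology *)

(* A point of P^n(U) is given by its unique tuple of homogeneous coordinates
   whose first nonzero coordinate is 1. *)
Definition normalized (K : fieldType) (n : nat) (a : n.+1.-tuple K) : bool :=
  [exists i, (tnth a i == 1) && [forall j : 'I_n.+1, (j < i)%N ==> (tnth a j == 0)]].

Definition proj (K : fieldType) (n : nat) := {a : n.+1.-tuple K | normalized a}.

Definition coord (K : fieldType) (n : nat) (x : proj K n) : 'I_n.+1 -> K :=
  tnth (val x).

(* The identity p(t y) = t^d p(y) in Delta-indeterminates t and y, read as an
   identity of values in all Delta-field extensions. *)
Definition dhomogeneous (m : nat) (F : dfield m) (n : nat)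
    (p : dpoly F m 'I_n.+1) : Prop :=
  exists d : nat, forall (L : dfield m) (h : dembed F L) (t : L) (y : 'I_n.+1 -> L),
    deval h (fun j => t * y j) p = t ^+ d * deval h y p.

Definition pair_val (T : Type) (n k : nat) (y : 'I_n.+1 -> T) (z : 'I_k.+1 -> T)
    (j : 'I_n.+1 + 'I_k.+1) : T :=
  match j with inl i => y i | inr i => z i end.

Definition dbihomogeneous (m : nat) (F : dfield m) (n k : nat)
    (p : dpoly F m ('I_n.+1 + 'I_k.+1)%type) : Prop :=
  exists d e : nat, forall (L : dfield m) (h : dembed F L) (s t : L)
      (y : 'I_n.+1 -> L) (z : 'I_k.+1 -> L),
    deval h (pair_val (fun i => s * y i) (fun i => t * z i)) p =
    s ^+ d * t ^+ e * deval h (pair_val y z) p.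

Definition dclosed (m : nat) (F U : dfield m) (iota : dembed F U) (n : nat)
    (X : proj U n -> Prop) : Prop :=
  exists S : dpoly F m 'I_n.+1 -> Prop,
    (forall p, S p -> dhomogeneous p) /\
    forall x, X x <-> forall p, S p -> deval iota (coord x) p = 0.

Definition dclosed2 (m : nat) (F U : dfield m) (iota : dembed F U) (n k : nat)
    (Z : proj U n -> proj U k -> Prop) : Prop :=
  exists S : dpoly F m ('I_n.+1 + 'I_k.+1)%type -> Prop,
    (forall p, S p -> dbihomogeneous p) /\
    forall x y, Z x y <->
      forall p, S p -> deval iota (pair_val (coord x) (coord y)) p = 0.

(* A quasi-projective Delta-variety: a relatively open subset of a
   Delta-closed set. *)
Definition quasi_projective (m : nat) (F U : dfield m) (iota : dembed F U) (k : nat)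
    (Y : proj U k -> Prop) : Prop :=
  exists C D : proj U k -> Prop,
    [/\ dclosed iota C, dclosed iota D & forall y, Y y <-> C y /\ ~ D y].

Definition dcomplete (m : nat) (F U : dfield m) (iota : dembed F U) (n : nat)
    (X : proj U n -> Prop) : Prop :=
  forall (k : nat) (Y : proj U k -> Prop), quasi_projective iota Y ->
  forall Z : proj U n -> proj U k -> Prop, dclosed2 iota Z ->
  exists C : proj U k -> Prop, dclosed iota C /\
    forall y, (exists x, [/\ X x, Y y & Z x y]) <-> Y y /\ C y.

(** * Lascar rank of a subset of projective space *)

(* RU(X) = alpha: the least upper bound of the ranks over F of the points of X,
   which is the maximal rank whenever there is one. *)
Definition lascar_rank_set (m : nat) (kappa : Type) (F U : dfield m)
    (iota : dembed F U) (n : nat) (X : proj U n -> Prop) (alpha : Ord) : Prop :=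
  let bound b := forall x : proj U n, X x ->
    lascar_le kappa b (fun u => exists c, u = iota c) (val x) in
  bound alpha /\ forall beta, bound beta -> ole alpha beta.

(* Main.v *)
(* Idea. Write ' for one of the derivations.

   Equations. Choose k minimal such that k + 1 linear forms L_i over F have no
   common zero on X. By minimality (project from the point) the image of X under
   L contains every F-rational point of P^k. If k > 0, consider in X x P^1 the
   points for which L x = (c : 1 : 0 : ... : 0) and e^3 c'^2 + e c^4 = 1,
   e^2 c'' + 2 c^3 = 0, suitably homogenized in (1 : e). Solutions with e a constant generic over F
   exist in a differential extension, while nothing lies over e = 0; so the image
   in P^1 is not closed. Hence k = 0: a linear form l does not vanish on X. By
   completeness the image of X under (l : x_j) is closed and misses (0 : 1), which
   gives homogeneous equations p_j (l(x), x_j) = 0 with p_j (0, 1) <> 0.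

   Rank. Let z = (l(x), x). The derivatives of the components of z that are
   algebraic over A and lower derivatives are the leaders of z over A. If z has
   the same leaders over A and over B, then tp(z / B) does not fork over A; so the
   rank is at most the ordinal sum of omega^(dim) over slices that cover the
   complement of the set of leaders. The equations p_j provide leaders of bounded
   order in each component, so slices of dimension less than m suffice. *)

(* The image in P^1 is not closed because a Delta-polynomial evaluated at (1 : e), with e constant,
   is an ordinary polynomial in e: vanishing at a generic constant, it vanishes at e = 0. The
   quartic is the energy relation of the system c' = E w, w' = -2 E c^3, whose first integral is E =
   w^2 + c^4, with e = 1 / E. Solutions descend from the extension to F because F is existentially
   closed.

   The form l(x) is a component of z of its own and comes first in the ranking. Some x_j equals 1,
   so p_j (l(x), 1) = 0 is an equation for l(x) alone; every other component then satisfies an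
   equation over l(x). The orders of these equations do not depend on x, so one family of slices
   bounds the ranks of all points; separate bounds below omega^m could still have supremum omega^m.

   Dividing is tested on arbitrary sequences of conjugates. Nonforking is therefore proved by
   counting: only finitely many types over U have prescribed leaders and prescribed equations at
   generators of the set of leaders. *)
From HB Require Import structures.
From mathcomp Require Import all_boot all_order all_algebra finmap.
From mathcomp Require Import monalg.
From mathcomp Require Import boolp.
From mathcomp Require classical_sets.
From mathcomp Require Import ring.
From mathcomp Require ring_quotient generic_quotient fraction.
Require Import Defs.

Set Implicit Arguments.
Unset Strict Implicit.
Unset Printing Implicit Defensive.

Import GRing.Theory.
Local Open Scope ring_scope.

(** * Polynomial algebras *)

Notation MP R V := {malg R[{cmonom V}]}.

Section AlgEval.
Variables (R S : comNzRingType) (V : choiceType).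

Definition mev (w : V -> S) (u : {cmonom V}) : S :=
  \prod_(k <- finsupp (cmonom_val u)) w k ^+ u k.

Lemma mevEw (w : V -> S) (d : {fset V}) (u : {cmonom V}) :
  (finsupp (cmonom_val u) `<=` d)%fset -> mev w u = \prod_(k <- d) w k ^+ u k.
Proof.
move=> le; rewrite /mev (big_fset_incl _ le) //= => x xd.
by rewrite -cmE_eq0 => /eqP ->; rewrite expr0.
Qed.

Lemma mev_mmorphism w : mmorphism (mev w).
Proof.
split=> [x y|]; last by rewrite /mev mdom1 big_seq_fset0.
rewrite (@mevEw w (finsupp (cmonom_val x) `|` finsupp (cmonom_val y))%fset x) ?fsubsetUl //.
rewrite (@mevEw w (finsupp (cmonom_val x) `|` finsupp (cmonom_val y))%fset y) ?fsubsetUr //.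
rewrite -big_split /= /mev mdomD; apply: eq_bigr => k _.
by rewrite cmM exprD.
Qed.

HB.instance Definition _ w := isMultiplicative.Build _ _ (mev w) (mev_mmorphism w).

Lemma mevU w k : mev w (ucm k) = w k.
Proof. by rewrite /mev mdomU big_seq_fset1 cmUU expr1. Qed.

Lemma mev1 w : mev w mone = 1. Proof. by rewrite mmorph1. Qed.
Lemma mevUM w k u : mev w (mmul (ucm k) u) = w k * mev w u.
Proof. by rewrite mmorphM /= mevU. Qed.

Definition aeval (f : R -> S) (w : V -> S) : MP R V -> S := mmap f (mev w).

HB.instance Definition _ (f : {rmorphism R -> S}) w :=
  GRing.RMorphism.copy (aeval f w) (mmap f (mev w)).

Lemma aevalC (f : {rmorphism R -> S}) w c : aeval f w c%:MP = f c.
Proof. exact: mmapC. Qed.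

Definition malgX (k : V) : MP R V := << ucm k >>.

Lemma aevalX (f : {rmorphism R -> S}) w k : aeval f w (malgX k) = w k.
Proof. by rewrite /aeval mmapU /= rmorph1 mul1r mevU. Qed.

End AlgEval.
Arguments malgX {R V}.

Section Ind.
Variables (R : comNzRingType) (V : choiceType).

Lemma cmonom_ind (P : {cmonom V} -> Prop) :
  P mone -> (forall k u, P u -> P (mmul (ucm k) u)) -> forall u, P u.
Proof.
move=> P1 PM u; move: {2}(mdeg u) (erefl (mdeg u)) => n.
elim: n u => [|n IH] u Hu; first by rewrite (mdeg_eq0I Hu).
have [k uk] : exists k, u k != 0%N.
  apply/not_existsP => H; move: Hu; rewrite mdegE big1 // => k _.
  by apply/eqP/negP => /negP/H.
have E : u = mmul (ucm k) (divcm u (ucm k)).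
  apply/eqP/cmP => i; rewrite cmM divcmE cmU.
  by case: eqP => [<-|_]; rewrite ?subn0 // subnKC // lt0n.
rewrite E; apply: PM; apply: IH; apply/eqP.
by move: Hu; rewrite {1}E mdegM mdegU add1n => -[->].
Qed.

Lemma malg_ind (P : MP R V -> Prop) :
  (forall c, P c%:MP) -> (forall k, P (malgX k)) ->
  (forall p q, P p -> P q -> P (p + q)) ->
  (forall p q, P p -> P q -> P (p * q)) -> forall p, P p.
Proof.
move=> PC PX PD PM p; rewrite (monalgE p).
have P0 : P 0 by rewrite -malgC0E.
elim: (msupp p : seq _) => [|u s IH]; first by rewrite big_nil.
rewrite big_cons; apply: PD => //.
move: (mcoeff _ p) => c.
elim/cmonom_ind: u c => [|l u IHu] c; first exact: PC.
have -> : << c *g mmul (ucm l) u >> = << c *g u >> * malgX l :> MP R V.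
  by rewrite /malgX malgM_def fgmulUU mulr1 mulmC.
exact: PM.
Qed.

End Ind.

(** Membership in the subalgebra generated by the constants and the variables in [T]. For
    polynomials it says that only variables in [T] occur; being inductive, it needs no notion of
    support and makes sense behind the abstract interface below. *)
Inductive inpol (R A : comNzRingType) (V : Type) (C : R -> A) (X : V -> A)
    (T : V -> Prop) : A -> Prop :=
| pinC c : inpol C X T (C c)
| pinX k of T k : inpol C X T (X k)
| pinD p q of inpol C X T p & inpol C X T q : inpol C X T (p + q)
| pinM p q of inpol C X T p & inpol C X T q : inpol C X T (p * q).

Lemma malgXU (R : comNzRingType) (V : choiceType) j (c : R) (u : {cmonom V}) :
  malgX j * << c *g u >> = << c *g mmul (ucm j) u >> :> MP R V.
Proof. by rewrite /malgX malgM_def fgmulUU mul1r. Qed.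

Section Retract.
Variables (R k : comNzRingType) (V : choiceType) (rho : {additive R -> k}).

(** A coefficientwise map for [rho] merely additive. It serves for linear functionals from a field
    to a subfield, which are not ring morphisms, so that [aeval] does not apply. *)
Definition mret (p : MP R V) : MP k V :=
  locked (\sum_(u <- msupp p) << rho p@_u *g u >>).

Lemma mretE p u : (mret p)@_u = rho p@_u.
Proof.
rewrite /mret -lock raddf_sum /=.
under eq_bigr do rewrite mcoeffU.
case: (msuppP p u) => [|up].
  move=> up; rewrite (big_fsetD1 u up) /= eqxx mulr1n big1_seq ?addr0 // => v /andP[_].
  by rewrite in_fsetD1 => /andP[/negPf-> _]; rewrite mulr0n.
rewrite raddf0 big1_seq // => v /andP[_ vp].
by case: eqP => [E|_]; rewrite ?mulr0n //; move: up; rewrite -E vp.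
Qed.

Lemma mretD p q : mret (p + q) = mret p + mret q.
Proof. apply/malgP => u; rewrite (mretE (p + q)) (mcoeffD u (mret p)) (mcoeffD u p) raddfD.
exact: (congr2 _ (esym (mretE p u)) (esym (mretE q u))). Qed.

Lemma mev_malgX (u : {cmonom V}) : mev (S := MP R V) malgX u = << u >>.
Proof.
elim/cmonom_ind: u => [|j u IH].
  exact: (etrans (mev1 _) (esym (mpolyC1E _ _))).
apply: (etrans (mevUM _ _ _)); rewrite IH.
exact: malgXU.
Qed.

Lemma mcoeff_map (i : {rmorphism k -> R}) (q : MP k V) u :
  (aeval (S := MP R V) (malgC \o i) malgX q)@_u = i q@_u.
Proof.
rewrite /aeval mmapE raddf_sum /=.
under eq_bigr do rewrite mev_malgX mcoeffCM mcoeffU.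
case: (msuppP q u) => [|uq].
  move=> uq; rewrite (big_fsetD1 u uq) /= eqxx mulr1 big1_seq ?addr0 // => v /andP[_].
  by rewrite in_fsetD1 => /andP[/negPf-> _]; rewrite mulr0.
rewrite raddf0 big1_seq // => v /andP[_ vq].
by case: eqP => [E|_]; rewrite ?mulr0 //; move: uq; rewrite -E vq.
Qed.

Lemma mret_map (i : {rmorphism k -> R}) c (q : MP k V) :
  (forall a u, rho (u * i a) = rho u * a) ->
  mret (c%:MP * aeval (S := MP R V) (malgC \o i) malgX q) = (rho c)%:MP * q.
Proof.
by move=> rhoi; apply/malgP => u; rewrite mretE !mcoeffCM mcoeff_map rhoi.
Qed.

End Retract.

(** Any nonzero coefficient serves as [c]. It is named before [rho] is quantified, so that a
    functional can be chosen afterwards to be nonzero at [c]. *)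
Lemma mret_neq0 (R : comNzRingType) (V : choiceType) (p : MP R V) : p <> 0 ->
  exists c, c <> 0 /\ forall (k : comNzRingType) (rho : {additive R -> k}),
    rho c <> 0 -> mret rho p <> 0.
Proof.
move=> p0; have [u pu] : exists u, p@_u <> 0.
  apply: contrapT => H; apply: p0; apply/malgP => u; rewrite mcoeff0.
  by apply: contrapT => ne; apply: H; exists u.
by exists p@_u; split=> // k rho ru H; apply: ru; rewrite -mretE H mcoeff0.
Qed.

Lemma pin_msupp (R : comNzRingType) (V : choiceType) (T : V -> Prop) (p : MP R V) :
  inpol malgC malgX T p -> forall u, p@_u != 0 -> forall j, u j != 0%N -> T j.
Proof.
elim=> [c|k Tk|a b _ IH1 _ IH2|a b _ IH1 _ IH2] u.
- by rewrite mcoeffC; have [-> _ j|n] := eqVneq u mone; rewrite ?eqxx // cm1.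
- rewrite /malgX mcoeffU; have [<- _ j|n] := eqVneq (ucm k) u; last by rewrite eqxx.
  by rewrite cmU; have [<-|] := eqVneq k j.
- rewrite mcoeffD => H.
  have [E|n] := eqVneq (a@_u) 0; last exact: IH1.
  by apply: IH2; move: H; rewrite E add0r.
- move=> ab j uj.
  have : u \in msupp (a * b) by rewrite -mcoeff_neq0.
  move=> /msuppM_le [u1 [u2 [m1 m2 E]]]; move: uj; rewrite E cmM addn_eq0 negb_and.
  by case/orP; [apply: IH1 | apply: IH2]; rewrite mcoeff_neq0.
Qed.

Lemma pin_mon (R : comNzRingType) (V : choiceType) (T : V -> Prop) (c : R) (u : {cmonom V}) :
  (forall j, u j != 0%N -> T j) -> inpol malgC malgX T << c *g u >>.
Proof.
elim/cmonom_ind: u => [|k u IH] H; first exact: pinC.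
have -> : << c *g mmul (ucm k) u >> = malgX k * << c *g u >> :> MP R V.
  by rewrite malgXU.
apply: pinM; first by apply: pinX; apply: H; rewrite cmM cmUU.
by apply: IH => j uj; apply: H; rewrite cmM addn_eq0 negb_and uj orbT.
Qed.

Lemma mret_pin (R k : comNzRingType) (V : choiceType) (rho : {additive R -> k})
    (T : V -> Prop) (p : MP R V) :
  inpol malgC malgX T p -> inpol malgC malgX T (mret rho p).
Proof.
move=> /pin_msupp H; rewrite /mret -lock.
have [s -> sp] : exists2 s : seq {cmonom V}, (msupp p : seq _) = s & {in s, forall u, p@_u != 0}.
  by exists (msupp p : seq _) => // u; rewrite mcoeff_neq0.
elim: s sp => [|u s IH] sp.
  by rewrite big_nil -malgC0E; exact: pinC.
rewrite big_cons; apply: pinD.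
  by apply: pin_mon; apply: H; apply: sp; rewrite inE eqxx.
by apply: IH => v vs; apply: sp; rewrite inE vs orbT.
Qed.

(* The algebra of polynomials over R in the indeterminates V, accessed only
   through this interface: unification does not terminate in practice on
   nested instances of the monoid algebras of which it is made. *)
Record mp_theory := MPTheory {
  mp : comNzRingType -> choiceType -> comNzRingType;
  mpC : forall (R : comNzRingType) (V : choiceType), {rmorphism R -> mp R V};
  mpX : forall (R : comNzRingType) (V : choiceType), V -> mp R V;
  mpev : forall (R : comNzRingType) (V : choiceType) (S : comNzRingType), {rmorphism R -> S} -> (V -> S) -> {rmorphism mp R V -> S};
  mpevC : forall (R : comNzRingType) (V : choiceType) S f w c, @mpev R V S f w (mpC R V c) = f c;
  mpevX : forall (R : comNzRingType) (V : choiceType) S f w k, @mpev R V S f w (mpX R k) = w k;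
  mp_ind : forall (R : comNzRingType) (V : choiceType) (P : mp R V -> Prop),
    (forall c, P (mpC R V c)) -> (forall k, P (mpX R k)) ->
    (forall p q, P p -> P q -> P (p + q)) ->
    (forall p q, P p -> P q -> P (p * q)) -> forall p, P p;
  mpret : forall (R k : comNzRingType) (V : choiceType), {additive R -> k} -> mp R V -> mp k V;
  mpretD : forall (R k : comNzRingType) (V : choiceType) rho p q, @mpret R k V rho (p + q) = mpret rho p + mpret rho q;
  mpret_map : forall (R k : comNzRingType) (V : choiceType) (rho : {additive R -> k}) (i : {rmorphism k -> R}) c q,
    (forall a u, rho (u * i a) = rho u * a) ->
    mpret rho (mpC R V c * mpev (mpC R V \o i) (mpX R (V := V)) q) = mpC k V (rho c) * q;
  mpret_neq0 : forall (R : comNzRingType) (V : choiceType) (p : mp R V), p <> 0 -> exists c, c <> 0 /\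
    forall (k : comNzRingType) (rho : {additive R -> k}), rho c <> 0 -> mpret rho p <> 0;
  mpret_pin : forall (R k : comNzRingType) (V : choiceType) (rho : {additive R -> k}) (T : V -> Prop) p,
    inpol (mpC R V) (mpX R (V := V)) T p -> inpol (mpC k V) (mpX k (V := V)) T (mpret rho p);
  of_malg : forall (R : comNzRingType) (V : choiceType), MP R V -> mp R V;
  to_malg : forall (R : comNzRingType) (V : choiceType), mp R V -> MP R V;
  mpev_of : forall (R : comNzRingType) (V : choiceType) (S : comNzRingType) (f : {rmorphism R -> S}) w p,
    mpev f w (@of_malg R V p) = aeval f w p;
  aeval_to : forall (R : comNzRingType) (V : choiceType) (S : comNzRingType) (f : {rmorphism R -> S}) w p,
    aeval f w (@to_malg R V p) = mpev f w p
}.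

(** [Qed] makes the implementation opaque: from here on only the fields of the record are usable. *)
Definition malg_theory : mp_theory.
Proof.
unshelve refine (@MPTheory (fun R V => MP R V) (fun R V => malgC) (fun R V => malgX)
  (fun R V S f w => aeval f w) _ _ _ (fun R k V rho => mret rho) _ _ _ _ (fun R V => id) (fun R V => id) _ _).
- by move=> *; exact: aevalC.
- by move=> *; exact: aevalX.
- exact: malg_ind.
- exact: mretD.
- move=> R k V rho i c q; exact: mret_map.
- exact: mret_neq0.
- exact: mret_pin.
- by [].
- by [].
Qed.

Notation pol := (mp malg_theory).
Notation pC := (mpC malg_theory _ _).
Notation pX := (@mpX malg_theory _ _).
Notation pev := (@mpev malg_theory _ _ _).
Notation pin := (inpol pC pX).

Lemma pol_ext (R S : comNzRingType) (V : choiceType) (f g : {rmorphism pol R V -> S}) :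
  (forall c, f (pC c) = g (pC c)) -> (forall k, f (pX k) = g (pX k)) -> f =1 g.
Proof.
move=> HC HX; elim/(@mp_ind malg_theory) => // p q IH1 IH2; first by rewrite !rmorphD IH1 IH2.
by rewrite !rmorphM IH1 IH2.
Qed.

Section Pin.
Variables (R : comNzRingType) (V : choiceType).
Implicit Types (T : V -> Prop) (p q : pol R V).

Lemma pin_sub T T' p : (forall k, T k -> T' k) -> pin T p -> pin T' p.
Proof. by move=> H; elim => *; [exact: pinC | apply: pinX; exact: H | exact: pinD | exact: pinM]. Qed.

Lemma pin0 T : pin T (0 : pol R V).
Proof. by rewrite -(rmorph0 (mpC malg_theory R V)); exact: pinC. Qed.
Lemma pin1 T : pin T (1 : pol R V).
Proof. by rewrite -(rmorph1 (mpC malg_theory R V)); exact: pinC. Qed.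
Lemma pinN T p : pin T p -> pin T (- p).
Proof.
move=> H; rewrite -mulN1r; apply: pinM => //.
by rewrite -(rmorph1 (mpC malg_theory R V)) -rmorphN; exact: pinC.
Qed.
Lemma pinB T p q : pin T p -> pin T q -> pin T (p - q).
Proof. by move=> Hp Hq; apply: pinD => //; apply: pinN. Qed.
Lemma pinXn T p n : pin T p -> pin T (p ^+ n).
Proof. by move=> H; elim: n => [|n IH]; rewrite ?expr0 ?exprS; [exact: pin1 | exact: pinM]. Qed.
Lemma pin_sum T (I : Type) (s : seq I) (P : pred I) (F : I -> pol R V) :
  (forall i, P i -> pin T (F i)) -> pin T (\sum_(i <- s | P i) F i).
Proof. by move=> H; elim/big_rec: _ => [|i p Pi]; [exact: pin0 | apply: pinD; apply: H]. Qed.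

Lemma pin_seq p : exists s : seq V, pin (fun k => k \in s) p.
Proof.
elim/(@mp_ind malg_theory): p => [c|k|p q [s1 H1] [s2 H2]|p q [s1 H1] [s2 H2]].
- by exists [::]; exact: pinC.
- by exists [:: k]; apply: pinX; rewrite inE.
- exists (s1 ++ s2); apply: pinD.
    by apply: pin_sub H1 => k; rewrite mem_cat => ->.
  by apply: pin_sub H2 => k; rewrite mem_cat orbC => ->.
- exists (s1 ++ s2); apply: pinM.
    by apply: pin_sub H1 => k; rewrite mem_cat => ->.
  by apply: pin_sub H2 => k; rewrite mem_cat orbC => ->.
Qed.

Lemma pin_all p : pin (fun=> True) p.
Proof. by case: (pin_seq p) => s; exact: pin_sub. Qed.

Lemma pin_none p : pin (fun=> False) p -> exists c, p = pC c.
Proof.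
elim=> [c|//|_ _ _ [a ->] _ [b ->]|_ _ _ [a ->] _ [b ->]]; first by exists c.
  by exists (a + b); rewrite rmorphD.
by exists (a * b); rewrite rmorphM.
Qed.

(** [p] as a univariate polynomial in the variable [t]. Its coefficients stay in the same ring and
    merely avoid [t], which spares a change of the set of variables in inductions. *)
Definition tau (t : V) : {rmorphism pol R V -> {poly pol R V}} :=
  pev (polyC \o pC) (fun k => if k == t then 'X else (pX k)%:P).

Lemma tauC t c : tau t (pC c) = (pC c)%:P.
Proof. exact: mpevC. Qed.
Lemma tauX t k : tau t (pX k) = if k == t then 'X else (pX k)%:P.
Proof. exact: mpevX. Qed.

Lemma tauK t p : (tau t p).[pX t] = p.
Proof.
have H : horner_eval (pX t) \o tau t =1 (@idfun (pol R V)).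
  apply: pol_ext => [c|k] /=.
    by rewrite tauC /horner_eval hornerC.
  by rewrite tauX /horner_eval; case: eqP => [->|_]; rewrite ?hornerX ?hornerC.
exact: H.
Qed.

Lemma tau_id t p : pin (fun k => k <> t) p -> tau t p = p%:P.
Proof.
elim=> [c|k /eqP/negPf kt|a b _ IH1 _ IH2|a b _ IH1 _ IH2].
- exact: tauC.
- by rewrite tauX kt.
- by rewrite rmorphD IH1 IH2 /= polyCD.
- by rewrite rmorphM IH1 IH2 /= polyCM.
Qed.

Lemma tau_pin T t p i : pin T p -> pin (fun k => T k /\ k <> t) (tau t p)`_i.
Proof.
move=> H; elim: H i => [c|k Tk|a b _ IH1 _ IH2|a b _ IH1 _ IH2] i.
- by rewrite tauC coefC; case: eqP => _; [exact: pinC | exact: pin0].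
- rewrite tauX; case: eqP => [_|kt].
    by rewrite coefX; case: eqP => _; [exact: pin1|exact: pin0].
  by rewrite coefC; case: eqP => _; [apply: pinX|exact: pin0].
- by rewrite rmorphD coefD; apply: pinD.
- by rewrite rmorphM coefM; apply: pin_sum => j _; apply: pinM.
Qed.

Lemma tau_horner t (P : {poly pol R V}) :
  (forall i, pin (fun k => k <> t) P`_i) -> tau t P.[pX t] = P.
Proof.
move=> H; rewrite horner_coef rmorph_sum /=.
rewrite -[RHS]coefK poly_def; apply: eq_bigr => i _.
by rewrite rmorphM rmorphXn /= tauX eqxx tau_id // mul_polyC.
Qed.

Lemma pin_horner T t (P : {poly pol R V}) :
  (forall i, pin T P`_i) -> T t -> pin T P.[pX t].
Proof.
move=> H Tt; rewrite horner_coef; apply: pin_sum => i _.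
by apply: pinM => //; apply: pinXn; exact: pinX.
Qed.

End Pin.
Arguments tau {R V} t.

Section PevPin.
Variables (R S S' : comNzRingType) (V : choiceType).

Lemma pev_pin (f : {rmorphism R -> S}) w w' (T : V -> Prop) p :
  (forall k, T k -> w k = w' k) -> pin T p -> pev f w p = pev f w' p.
Proof.
move=> H; elim=> [c|k /H E|a b _ IH1 _ IH2|a b _ IH1 _ IH2].
- by rewrite !mpevC.
- by rewrite !mpevX.
- by rewrite !rmorphD IH1 IH2.
- by rewrite !rmorphM IH1 IH2.
Qed.

Lemma pev_tau (f : {rmorphism R -> S}) w t (p : pol R V) :
  pev f w p = (map_poly (pev f w) (tau t p)).[w t].
Proof.
by rewrite -{1}(tauK t p) -(horner_map (pev f w)) /= mpevX.
Qed.

End PevPin.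

(** * Differential rings and differential polynomials *)

Record dring (m : nat) := DRing {
  rcar :> comNzRingType;
  rder : 'I_m -> rcar -> rcar;
  rderD : forall i, {morph rder i : x y / x + y};
  rderM : forall i x y, rder i (x * y) = rder i x * y + x * rder i y;
  rderC : forall i j x, rder i (rder j x) = rder j (rder i x) }.

Arguments rder {m d} : rename.
Arguments rderD {m d} : rename.
Arguments rderM {m d} : rename.
Arguments rderC {m d} : rename.

Record dhom (m : nat) (R S : dring m) := DHom {
  dhomr :> {rmorphism R -> S};
  dhom_der : forall i x, dhomr (rder i x) = rder i (dhomr x) }.

Definition dring_of (m : nat) (K : dfield m) : dring m :=
  @DRing m K (@der m K) (@derD m K) (@derM m K) (@derC m K).

Definition dhom_of (m : nat) (K L : dfield m) (h : dembed K L) : dhom (dring_of K) (dring_of L) :=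
  @DHom m (dring_of K) (dring_of L) h (@demb_der m K L h).

Section DerTheory.
Variables (m : nat) (R : dring m).
Implicit Types (x y : R) (i : 'I_m).

Lemma rder0 i : rder i (0 : R) = 0.
Proof. by apply: (addIr (rder i (0 : R))); rewrite -rderD !add0r. Qed.
Lemma rderN i x : rder i (- x) = - rder i x.
Proof. by apply: (addIr (rder i x)); rewrite -rderD !addNr rder0. Qed.
Lemma rderB i x y : rder i (x - y) = rder i x - rder i y.
Proof. by rewrite rderD rderN. Qed.
Lemma rder1 i : rder i (1 : R) = 0.
Proof. by apply: (addIr (rder i (1 : R))); rewrite add0r -{3}(mulr1 1) rderM mulr1 mul1r. Qed.
Lemma rderMn i x n : rder i (x *+ n) = rder i x *+ n.
Proof. by elim: n => [|n IH]; rewrite ?rder0 // !mulrSr rderD IH. Qed.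
Lemma rder_nat i n : rder i (n%:R : R) = 0.
Proof. by rewrite rderMn rder1 mul0rn. Qed.
Lemma rder_int i z : rder i (z%:~R : R) = 0.
Proof. by case: z => n; rewrite ?NegzE ?mulrNz ?rderN ?rder_nat ?oppr0 // rder_nat. Qed.
Lemma rderXn i x n : rder i (x ^+ n) = x ^+ n.-1 * rder i x *+ n.
Proof.
elim: n => [|[|n] IH]; first by rewrite expr0 rder1 mulr0n.
  by rewrite expr1 expr0 mul1r mulr1n.
rewrite exprS rderM IH /= [in RHS]mulrSr addrC; congr (_ + _); last by rewrite mulrC.
by rewrite mulrnAr mulrA -exprS.
Qed.

Definition rdop (e : {ffun 'I_m -> nat}) x : R :=
  foldr (fun i y => iter (e i) (rder i) y) x (enum 'I_m).

Definition einc (e : {ffun 'I_m -> nat}) i : {ffun 'I_m -> nat} :=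
  [ffun k => e k + (k == i)]%N.

Lemma iter_rder i j n x : rder i (iter n (rder j) x) = iter n (rder j) (rder i x).
Proof. by elim: n => //= n IH; rewrite rderC IH. Qed.

Lemma rder_rdop i e x : rder i (rdop e x) = rdop (einc e i) x.
Proof.
rewrite /rdop.
have H (s : seq 'I_m) : i \notin s ->
    rder i (foldr (fun k y => iter (e k) (rder k) y) x s) =
    foldr (fun k y => iter (e k) (rder k) y) (rder i x) s /\
    foldr (fun k y => iter (einc e i k) (rder k) y) x s =
    foldr (fun k y => iter (e k) (rder k) y) x s.
  elim: s => //= j s IH; rewrite inE negb_or => /andP[ij /IH[IH1 IH2]].
  by rewrite iter_rder IH1 IH2 ffunE eq_sym (negPf ij) addn0.
elim: (enum 'I_m) (mem_enum 'I_m i) (enum_uniq 'I_m) => //= j s IH.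
rewrite inE => ijs /andP[js us]; have [E|ij] := eqVneq i j; last first.
  rewrite (negPf ij) /= in ijs; rewrite iter_rder (IH ijs us) ffunE.
  by rewrite eq_sym (negPf ij) addn0.
move: js; rewrite -E => js; case: (H s js) => H1 H2.
by rewrite iter_rder H2 ffunE eqxx addn1 iterSr.
Qed.

Definition e0 : {ffun 'I_m -> nat} := [ffun=> 0%N].

Lemma rdop0 x : rdop e0 x = x.
Proof. by rewrite /rdop; elim: (enum _) => //= i s ->; rewrite ffunE. Qed.

Lemma einc_neq0 e : e <> e0 -> exists i e', e = einc e' i.
Proof.
move=> ne; have [i ei] : exists i, e i <> 0%N.
  apply: contrapT => H; apply: ne; apply/ffunP => i; rewrite ffunE.
  by apply: contrapT => ei; apply: H; exists i.
exists i, [ffun k => e k - (k == i)]%N; apply/ffunP => k; rewrite !ffunE.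
by case: eqP => [->|_]; rewrite ?subn0 ?addn0 // subnK // lt0n; apply/eqP.
Qed.

Lemma e_ind (P : {ffun 'I_m -> nat} -> Prop) :
  P e0 -> (forall e i, P e -> P (einc e i)) -> forall e, P e.
Proof.
move=> P0 PS e; move: {2}(\sum_i e i)%N (erefl (\sum_i e i)%N) => n.
elim: n e => [|n IH] e He.
  have -> : e = e0; last by [].
  by apply/ffunP => i; rewrite ffunE; apply/eqP; move/eqP: He; rewrite sum_nat_eq0 => /forallP/(_ i).
case: (EM (e = e0)) => [->//|/einc_neq0[i [e' E]]]; rewrite E; apply: PS; apply: IH.
move: He; rewrite E; under eq_bigr do rewrite ffunE.
have E2 : (\sum_k (k == i) = 1)%N.
  by rewrite (bigD1 i) //= eqxx big1 // => k /negPf ->.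
by rewrite big_split /= E2 addn1 => -[].
Qed.

Lemma rdop_const e x : (forall i, rder i x = 0) -> e <> e0 -> rdop e x = 0.
Proof.
move=> cx /einc_neq0[i [e' ->]]; rewrite -rder_rdop.
elim/e_ind: e' i => [|e' j IH] i; first by rewrite rdop0.
by rewrite -rder_rdop IH rder0.
Qed.

End DerTheory.
Arguments e0 {m}.

Lemma dhom_rdop (m : nat) (R S : dring m) (h : dhom R S) e x : h (rdop e x) = rdop e (h x).
Proof.
elim/e_ind: e => [|e i IH]; first by rewrite !rdop0.
by rewrite -!rder_rdop dhom_der IH.
Qed.

(* The ring of dual numbers over A: a derivation of a ring R into A is the same
   as a lift of a morphism from R to A to dual numbers. *)
Definition dual (A : comNzRingType) := (A * A)%type.

Section Dual.
Variable A : comNzRingType.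

HB.instance Definition _ := GRing.Zmodule.on (dual A).

Definition dual1 : dual A := (1, 0).
Definition dualM (x y : dual A) : dual A := (x.1 * y.1, x.1 * y.2 + x.2 * y.1).

Fact dualMA : associative dualM.
Proof. by case=> a b [c d] [e f]; rewrite /dualM /=; congr (_, _); ring. Qed.
Fact dualMC : commutative dualM.
Proof. by case=> a b [c d]; rewrite /dualM /=; congr (_, _); ring. Qed.
Fact dual1M : left_id dual1 dualM.
Proof. by case=> a b; rewrite /dualM /=; congr (_, _); ring. Qed.
Fact dualMD : left_distributive dualM +%R.
Proof.
case=> a b [c d] [e f].
change (((a + c) * e, (a + c) * f + (b + d) * e) =
  (a * e + c * e, (a * f + b * e) + (c * f + d * e)) :> A * A).
by congr (_, _); ring.
Qed.
Fact dual1_neq0 : dual1 != 0.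
Proof. by apply/eqP => -[/eqP]; rewrite oner_eq0. Qed.

HB.instance Definition _ := GRing.Zmodule_isComNzRing.Build (dual A)
  dualMA dualMC dual1M dualMD dual1_neq0.

End Dual.

Section Pder.
Variables (m : nat) (R : dring m) (V : choiceType) (g : 'I_m -> V -> pol R V) (i : 'I_m).

Definition dualC (c : R) : dual (pol R V) := (pC c, pC (rder i c)).

Fact dualC_is_zmod : zmod_morphism dualC.
Proof. by move=> a b; rewrite /dualC rderB !rmorphB. Qed.
Fact dualC_is_monoid : monoid_morphism dualC.
Proof.
split=> [|a b]; first by rewrite /dualC rder1 rmorph0 rmorph1.
by rewrite /dualC rderM rmorphD !rmorphM /= addrC.
Qed.

HB.instance Definition _ := GRing.isZmodMorphism.Build R (dual (pol R V)) dualC dualC_is_zmod.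
HB.instance Definition _ := GRing.isMonoidMorphism.Build R (dual (pol R V)) dualC dualC_is_monoid.

Definition pdual : {rmorphism pol R V -> dual (pol R V)} :=
  pev dualC (fun k => (pX k, g i k)).

(** The derivation that extends the one of [R] and takes the value [g i k] at the variable [k]. The
    freedom in [g] is used twice: shifts give Delta-polynomials, a vector field gives the quartic
    equation. *)
Definition pder (p : pol R V) : pol R V := (pdual p).2.

Lemma pdual1 p : (pdual p).1 = p.
Proof.
elim/(@mp_ind malg_theory): p => [c|k|p q IH1 IH2|p q IH1 IH2].
- by rewrite /pdual mpevC.
- by rewrite /pdual mpevX.
- by rewrite rmorphD /= IH1 IH2.
- by rewrite rmorphM /= IH1 IH2.
Qed.

Lemma pderD p q : pder (p + q) = pder p + pder q.
Proof. by rewrite /pder rmorphD. Qed.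
Lemma pderM p q : pder (p * q) = pder p * q + p * pder q.
Proof. by rewrite /pder rmorphM /= !pdual1 addrC. Qed.
Lemma pderC c : pder (pC c) = pC (rder i c).
Proof. by rewrite /pder /pdual mpevC. Qed.
Lemma pderX k : pder (pX k) = g i k.
Proof. by rewrite /pder /pdual mpevX. Qed.

End Pder.

Section PolDring.
Variables (m : nat) (R : dring m) (V : choiceType) (g : 'I_m -> V -> pol R V).
Hypothesis gC : forall i j k, pder g i (g j k) = pder g j (g i k).

Lemma pder_comm i j p : pder g i (pder g j p) = pder g j (pder g i p).
Proof.
elim/(@mp_ind malg_theory): p => [c|k|p q IH1 IH2|p q IH1 IH2].
- by rewrite !pderC rderC.
- by rewrite !pderX gC.
- by rewrite !pderD IH1 IH2.
- by rewrite !pderM !pderD !pderM IH1 IH2; ring.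
Qed.

Definition pol_dring : dring m :=
  @DRing m (pol R V) (pder g) (pderD g) (pderM g) pder_comm.

End PolDring.

Definition dvar (m : nat) (J : choiceType) : choiceType := ({ffun 'I_m -> nat} * J)%type.

Definition shift (m : nat) (J : choiceType) (i : 'I_m) (k : dvar m J) : dvar m J :=
  (einc k.1 i, k.2).

Definition Xshift (m : nat) (R : dring m) (J : choiceType) (i : 'I_m) (k : dvar m J) :
  pol R (dvar m J) := pX (shift i k).

Lemma XshiftC (m : nat) (R : dring m) (J : choiceType) (i j : 'I_m) (k : dvar m J) :
  pder (@Xshift m R J) i (Xshift R j k) = pder (@Xshift m R J) j (Xshift R i k).
Proof.
rewrite !pderX; congr (pX (_, _)).
by apply/ffunP => l; rewrite !ffunE addnAC.
Qed.

Definition dpol (m : nat) (R : dring m) (J : choiceType) : dring m :=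
  pol_dring (@XshiftC m R J).

Definition dY (m : nat) (R : dring m) (J : choiceType) (j : J) : dpol R J :=
  pX ((e0, j) : dvar m J).

Section Dev.
Variables (m : nat) (R S : dring m) (J : choiceType).

Lemma rdopY e (j : J) : rdop e (dY R j) = pX ((e, j) : dvar m J).
Proof.
elim/e_ind: e => [|e i IH]; first by rewrite rdop0.
by rewrite -rder_rdop IH; apply: pderX.
Qed.

Definition dpC : dhom R (dpol R J) :=
  @DHom m R (dpol R J) (mpC malg_theory R (dvar m J)) (fun i x => esym (pderC (@Xshift m R J) i x)).

Variables (f : dhom R S) (v : J -> S).

Definition devr : {rmorphism pol R (dvar m J) -> S} :=
  pev f (fun k : dvar m J => rdop k.1 (v k.2)).

Lemma devr_der i (p : dpol R J) : devr (rder i p) = rder i (devr p).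
Proof.
rewrite -[X in devr X]/(pder (@Xshift m R J) i p).
elim/(@mp_ind malg_theory): p => [c|k|p q IH1 IH2|p q IH1 IH2].
- by rewrite pderC /devr !mpevC dhom_der.
- by rewrite pderX /devr !mpevX /= rder_rdop.
- by rewrite pderD !rmorphD rderD IH1 IH2.
- by rewrite pderM !(rmorphM, rmorphD) /= rderM IH1 IH2.
Qed.

Definition dev : dhom (dpol R J) S := @DHom m (dpol R J) S devr devr_der.

Lemma devC c : dev (pC c) = f c.
Proof. exact: mpevC. Qed.
Lemma devX k : dev (pX k) = rdop k.1 (v k.2).
Proof. exact: mpevX. Qed.
Lemma devY j : dev (dY R j) = v j.
Proof. by rewrite devX rdop0. Qed.

End Dev.
Arguments dpC {m} R J.

Lemma dhom_dev (m : nat) (R S S' : dring m) (J : choiceType) (f : dhom R S) (v : J -> S)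
    (h : dhom S S') (g : dhom R S') (p : dpol R J) :
  (forall c, h (f c) = g c) -> h (dev f v p) = dev g (fun j => h (v j)) p.
Proof.
move=> E; have H : h \o dev f v =1 dev g (fun j => h (v j)).
  apply: pol_ext => [c|k]; first by rewrite /= !devC.
  by rewrite /= !devX dhom_rdop.
exact: H.
Qed.

Lemma deval_dev (m : nat) (J : choiceType) (K : dfield m) (R : dring m)
    (f : dhom R (dring_of K)) (v : J -> K) (p : dpoly R m J) :
  deval f v p = dev f v (of_malg malg_theory p).
Proof. exact: esym (mpev_of _ _ _ _). Qed.

Lemma deval_to (m : nat) (J : choiceType) (K : dfield m) (R : dring m)
    (f : dhom R (dring_of K)) (v : J -> K) (p : dpol R J) :
  deval f v (to_malg p) = dev f v p.
Proof. exact: aeval_to. Qed.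

Definition int_dring (m : nat) : dring m :=
  @DRing m int (fun _ _ => 0) (fun _ _ _ => esym (addr0 0))
    (fun _ x y => esym (etrans (congr2 +%R (mul0r y) (mulr0 x)) (addr0 0))) (fun _ _ _ => erefl).

(** * Fraction fields of prime differential quotients *)

Section Idomain.
Variables (A : comNzRingType) (intA : forall x y : A, x * y = 0 -> (x == 0) || (y == 0)).

(** The alias keeps the proof [intA] as a parameter, so that the structure of integral domain can be
    attached to it. *)
Definition idom : Type := let _ := intA in A.

HB.instance Definition _ := GRing.ComNzRing.on idom.

Definition idom_unit : pred idom := fun x => `[< exists y : idom, y * x = 1 >].
Definition idom_inv (x : idom) : idom :=
  if pselect (exists y : idom, y * x = 1) is left H then sval (cid H) else x.

Fact idom_mulVx : {in idom_unit, left_inverse 1 idom_inv *%R}.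
Proof.
move=> x /asboolP H; rewrite /idom_inv.
by case: pselect => // H'; case: (cid H').
Qed.
Fact idom_unitP (x y : idom) : y * x = 1 -> idom_unit x.
Proof. by move=> H; apply/asboolP; exists y. Qed.
Fact idom_inv_out : {in [predC idom_unit], idom_inv =1 id}.
Proof.
move=> x /asboolP H; rewrite /idom_inv.
by case: pselect.
Qed.

HB.instance Definition _ :=
  GRing.ComNzRing_hasMulInverse.Build idom idom_mulVx idom_unitP idom_inv_out.
HB.instance Definition _ := GRing.ComUnitRing_isIntegral.Build idom intA.

End Idomain.

Section PrimeFraction.
Import ring_quotient generic_quotient fraction.
Local Open Scope quotient_scope.

Lemma frac_repr (D : idomainType) (z : {fraction D}) :
  exists n d : D, d != 0 /\ z = FracField.tofrac n / FracField.tofrac d.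
Proof.
elim/quotW: z => -[[n d] /= d0]; exists n, d; split=> //.
rewrite !piE /= /FracField.invf !numden_Ratio ?oner_neq0 //.
apply/eqP; rewrite piE /= /FracField.equivf /FracField.mulf !numden_Ratio ?mul1r ?mulr1 ?oner_neq0 //=.
by rewrite mulrC.
Qed.

Lemma prime_frac (R : comNzRingType) (P : R -> Prop) :
  P 0 -> ~ P 1 -> (forall x y, P x -> P y -> P (x + y)) ->
  (forall x y, P x -> P (y * x)) -> (forall x y, P (x * y) -> P x \/ P y) ->
  exists (L : fieldType) (phi : {rmorphism R -> L}),
    (forall x, phi x = 0 <-> P x) /\
    forall z, exists a b, phi b <> 0 /\ z = phi a / phi b.
Proof.
move=> P0 P1 PD PM Pp.
pose I : R -> bool := fun x => `[< P x >].
have I1 : idealr_closed I.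
  split; [exact/asboolP | exact/asboolP | move=> a u v /asboolP Pu /asboolP Pv].
  by apply/asboolP/PD => //; apply: PM.
have I2 : prime_idealr_closed I.
  move=> u v /asboolP/Pp[?|?]; apply/orP; [left|right]; exact/asboolP.
pose hI1 := isIdealr.Build R I I1.
pose hI2 := isPrimeIdealrClosed.Build R I I2.
pose J : prime_idealr R := HB.pack I hI1 hI2.
pose Q : comNzRingType := {ideal_quot J}.
have intQ (x y : Q) : x * y = 0 -> (x == 0) || (y == 0).
  exact: Quotient.rquot_IdomainAxiom.
pose D : idomainType := idom intQ.
pose piQ : {rmorphism R -> Q} := \pi_Q.
pose piD : {rmorphism R -> D} := piQ.
pose phi : {rmorphism R -> {fraction D}} := @FracField.tofrac D \o piD.
have kerD x : piD x = 0 <-> P x.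
  split=> [/eqP|Px].
    rewrite /piD /piQ /= -(rmorph0 piQ) /= -[_ == _]/(\pi_{ideal_quot J} x == \pi_{ideal_quot J} 0).
    by rewrite -Quotient.idealrBE subr0 => /asboolP.
  apply/eqP; rewrite -(rmorph0 piD) -[_ == _]/(\pi_{ideal_quot J} x == \pi_{ideal_quot J} 0).
  by rewrite -Quotient.idealrBE subr0; apply/asboolP.
have ker x : phi x = 0 <-> P x.
  rewrite -kerD /phi /=; split=> [/eqP|->]; last exact: tofrac0.
  by rewrite tofrac_eq0 => /eqP.
exists {fraction D}, phi; split=> // z.
have piK (d : D) : exists a, piD a = d by exists (repr (d : Q)); exact: reprK.
have [n [d [d0 ->]]] := frac_repr z.
move: d0; case: (piK n) (piK d) => a <- [b <-] d0; exists a, b; split=> //.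
by apply/eqP; rewrite tofrac_eq0.
Qed.

End PrimeFraction.

Section FracDer.
Variables (m : nat) (R : dring m) (L : fieldType) (phi : {rmorphism R -> L}).
Hypothesis phi_frac : forall z, exists a b, phi b <> 0 /\ z = phi a / phi b.
Hypothesis phi_der : forall i x, phi x = 0 -> phi (rder i x) = 0.

Definition fnum z : R := sval (cid (phi_frac z)).
Definition fden z : R := sval (cid (svalP (cid (phi_frac z)))).

Lemma fden0 z : phi (fden z) != 0.
Proof. by apply/eqP; case: (svalP (cid (svalP (cid (phi_frac z))))). Qed.
Lemma fnumden z : z = phi (fnum z) / phi (fden z).
Proof. by case: (svalP (cid (svalP (cid (phi_frac z))))). Qed.

Definition fder (i : 'I_m) (z : L) : L :=
  (phi (rder i (fnum z)) * phi (fden z) - phi (fnum z) * phi (rder i (fden z))) / phi (fden z) ^+ 2.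

(** The quotient rule does not depend on the representative: the cross difference of two equal
    fractions lies in the kernel, and so does its derivative by [phi_der]. *)
Lemma fder_frac i a b : phi b != 0 ->
  fder i (phi a / phi b) = (phi (rder i a) * phi b - phi a * phi (rder i b)) / phi b ^+ 2.
Proof.
move=> b0; set z := _ / _.
have E : phi (a * fden z - fnum z * b) = 0.
  rewrite rmorphB !rmorphM /=; apply/eqP; rewrite subr_eq0 -eqr_div ?fden0 //.
  by rewrite -fnumden.
have := phi_der i E; rewrite rderB !rderM !(rmorphB, rmorphD, rmorphM) /= => E'.
move: E; rewrite !(rmorphB, rmorphM) /= => /eqP; rewrite subr_eq0 => /eqP E.
rewrite /fder; have c0 := fden0 z.
move: (phi (fden z)) (phi (fnum z)) (phi (rder i (fden z))) (phi (rder i (fnum z))) c0 E E'.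
move: (phi a) (phi b) (phi (rder i a)) (phi (rder i b)) b0 => {z} x y x' y' y0 w z w' z' w0 E E'.
have Ex : x = z * y / w by rewrite -E mulfK.
have Ex' : x' = (z' * y + z * y' - x * w') / w.
  apply: (mulIf w0); rewrite divfK //; apply/eqP; rewrite -subr_eq0 -E'; apply/eqP; ring.
rewrite Ex' Ex; field; by rewrite w0 y0.
Qed.

Lemma fder_phi i a : fder i (phi a) = phi (rder i a).
Proof.
have := @fder_frac i a 1; rewrite rmorph1 divr1 => ->; rewrite ?oner_neq0 //.
by rewrite rder1 rmorph0 mulr0 subr0 mulr1 expr1n divr1.
Qed.

Lemma fderD i : {morph fder i : x y / x + y}.
Proof.
move=> x y; rewrite (fnumden x) (fnumden y).
move: (fden x) (fden y) (fden0 x) (fden0 y) (fnum x) (fnum y) => b d b0 d0 a c.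
have -> : phi a / phi b + phi c / phi d = phi (a * d + c * b) / phi (b * d).
  by rewrite rmorphD !rmorphM /= addf_div.
rewrite !fder_frac //; last by rewrite rmorphM mulf_neq0.
rewrite !(rderD, rderM) !(rmorphD, rmorphM) /=.
by field; rewrite b0 d0.
Qed.

Lemma fderM i x y : fder i (x * y) = fder i x * y + x * fder i y.
Proof.
rewrite (fnumden x) (fnumden y).
move: (fden x) (fden y) (fden0 x) (fden0 y) (fnum x) (fnum y) => b d b0 d0 a c.
have -> : phi a / phi b * (phi c / phi d) = phi (a * c) / phi (b * d).
  by rewrite !rmorphM /= mulf_div.
rewrite !fder_frac //; last by rewrite rmorphM mulf_neq0.
rewrite !(rderD, rderM) !(rmorphD, rmorphM) /=.
by field; rewrite b0 d0.
Qed.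

Lemma fderC i j x : fder i (fder j x) = fder j (fder i x).
Proof.
rewrite (fnumden x).
move: (fden x) (fden0 x) (fnum x) => b b0 a.
rewrite !fder_frac //.
rewrite -!(rmorphM phi, rmorphB phi, rmorphXn phi) !fder_frac ?rmorphXn ?expf_neq0 //.
rewrite !(rderB, rderM, rderXn) /= !(rmorphB, rmorphD, rmorphM, rmorphMn, rmorphXn) /=.
rewrite (rderC i j a) (rderC i j b).
by field.
Qed.

End FracDer.

Lemma prime_dfrac (m : nat) (R : dring m) (P : R -> Prop) :
  P 0 -> (forall n, ~ P n.+1%:R) -> (forall x y, P x -> P y -> P (x + y)) ->
  (forall x y, P x -> P (y * x)) -> (forall x y, P (x * y) -> P x \/ P y) ->
  (forall i x, P x -> P (rder i x)) ->
  exists (L : dfield m) (phi : dhom R (dring_of L)),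
    (forall x, phi x = 0 <-> P x) /\
    forall z, exists a b, phi b <> 0 /\ z = phi a / phi b :> L.
Proof.
move=> P0 Pn PD PM Pp Pd.
have [L [phi [ker fr]]] := prime_frac P0 (Pn 0%N) PD PM Pp.
have Pd' i x : phi x = 0 -> phi (rder i x) = 0 by rewrite !ker; exact: Pd.
have c0 : [pchar L] =i pred0.
  move=> p; rewrite !inE; apply/negP => /andP[pp /eqP].
  rewrite -(rmorph_nat phi) ker; case: p pp => // p _; exact: Pn.
pose K := DField c0 (fderD fr Pd') (fderM fr Pd') (fderC fr Pd').
pose psi : dhom R (dring_of K) := @DHom m R (dring_of K) phi (fun i x => esym (fder_phi fr Pd' i x)).
by exists K, psi.
Qed.

(** * Existence of prime differential ideals *)

Lemma zorn_above (T : Type) (P : (T -> Prop) -> Prop) (I0 : T -> Prop) :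
  P I0 ->
  (forall F : (T -> Prop) -> Prop, (exists X, F X) -> (forall X, F X -> P X) ->
    (forall X Y, F X -> F Y -> (forall x, X x -> Y x) \/ (forall x, Y x -> X x)) ->
    P (fun x => exists X, F X /\ X x)) ->
  exists M, [/\ P M, (forall x, I0 x -> M x) &
    forall N, P N -> (forall x, M x -> N x) -> forall x, N x -> M x].
Proof.
move=> PI0 Pch.
pose Q (X : classical_sets.set T) := (forall x, ~ X x) \/ (P X /\ forall x, I0 x -> X x).
have [|A [QA maxA]] := @classical_sets.Zorn_bigcup T Q.
  move=> F FQ Ftot.
  pose G (X : T -> Prop) := F X /\ exists x, X x.
  have [[X GX]|nG] := pselect (exists X, G X); last first.
    by left=> x [X FX Xx]; apply: nG; exists X; split=> //; exists x.
  have GP Y : G Y -> P Y /\ forall x, I0 x -> Y x.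
    by case=> /FQ[Y0 [y Yy]|//]; case: (Y0 y).
  have E : classical_sets.bigcup F id = (fun x => exists X, G X /\ X x).
    apply: funext => x; apply: propext; split=> [[Y FY Yx]|[Y [[FY _] Yx]]]; last by exists Y.
    by exists Y; split=> //; split=> //; exists x.
  right; rewrite E; split; last by move=> x I0x; exists X; split=> //; exact: (GP X GX).2.
  apply: Pch; [by exists X | by move=> Y /GP[] | move=> Y Z [FY _] [FZ _]].
  by case: (Ftot Y Z FY FZ); [left|right].
have [[x0 Ix0]|nI] := pselect (exists x, I0 x); last first.
  have [A0|] := pselect (forall x, ~ A x); last first.
    case: QA => // -[PA IA] _; exists A; split=> // N PN AN x Nx.
    apply: contrapT => nAx; apply: (maxA N); last by right; split=> // y Iy; case: nI; exists y.
    by split=> // NA; apply: nAx; exact: NA.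
  exists I0; split=> // N PN _ x Nx; exfalso; apply: (maxA N).
    by split=> [y /A0//|NA]; exact: (A0 _ (NA _ Nx)).
  by right; split=> // y Iy; case: nI; exists y.
have nA0 : ~ forall x, ~ A x.
  move=> A0; apply: (maxA I0); last by right.
  by split=> [y /A0//|IA]; exact: (A0 _ (IA _ Ix0)).
case: QA => // -[PA IA]; exists A; split=> // N PN AN x Nx.
apply: contrapT => nAx; apply: (maxA N); last by right; split=> // y /IA/AN.
by split=> // NA; apply: nAx; exact: NA.
Qed.

Section DIdeal.
Variables (m : nat) (R : dring m).
Hypothesis Rdiv : forall n, exists u : R, u * n.+1%:R = 1.

Record dideal (I : R -> Prop) : Prop := DIdeal {
  did0 : I 0;
  didD : forall x y, I x -> I y -> I (x + y);
  didM : forall x y, I x -> I (y * x);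
  did_der : forall i x, I x -> I (rder i x) }.

Lemma did_div I n x : dideal I -> I (x *+ n.+1) -> I x.
Proof.
move=> dI Ix; have [u Hu] := Rdiv n.
by rewrite -(mul1r x) -Hu -mulrA mulr_natl; exact: didM.
Qed.

Lemma did_subr I x y : dideal I -> I y -> I (x + y) -> I x.
Proof.
move=> dI Iy Ixy; rewrite -(addrK y x); apply: didD => //.
by rewrite -mulN1r; exact: didM.
Qed.

(** By induction on [j], [x ^ (n - j) * (x') ^ (2 j)] lies in [I]: differentiate, multiply by [x']
    and divide by the integer [n - j], which is invertible by [Rdiv]. The case [j = n] is the
    claim. *)
Lemma did_radical I i x n : dideal I -> I (x ^+ n) -> exists l, I (rder i x ^+ l).
Proof.
move=> dI Ix.
have H j : (j <= n)%N -> I (x ^+ (n - j) * rder i x ^+ (2 * j)).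
  elim: j => [|j IH] jn; first by rewrite subn0 muln0 expr0 mulr1.
  have := IH (ltnW jn); have [k Ek] : exists k, (n - j = k.+1)%N.
    by exists (n - j).-1; rewrite prednK // subn_gt0.
  have -> : (n - j.+1 = k)%N by rewrite subnS Ek.
  rewrite Ek => H; have := did_der dI i H.
  rewrite rderM !rderXn /= => H1.
  have H2 : I (x ^+ k * rder i x ^+ (2 * j.+1) *+ k.+1 +
    x ^+ k.+1 * rder i x ^+ (2 * j) * (rder i (rder i x)) *+ (2 * j)).
    have := didM dI (rder i x) H1; congr I.
    rewrite mulrDr mulrnAl mulrnAr -!mulrnAr mulnS.
    case: (2 * j)%N => [|r]; first by rewrite !mulr0n !mulr0 !addr0 !exprS !expr0; ring.
    by rewrite /= !exprS; ring.
  apply: (@did_div I k) => //; apply: did_subr H2 => //.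
  by rewrite -mulr_natl; apply: didM => //; rewrite mulrC; apply: didM.
by exists (2 * n)%N; have := H n (leqnn n); rewrite subnn expr0 mul1r.
Qed.

Lemma did_radical_ideal I : dideal I -> dideal (fun x => exists n, I (x ^+ n)).
Proof.
move=> dI; split.
- by exists 1%N; rewrite expr1; exact: did0.
- move=> x y [a Ia] [b Ib]; exists (a + b)%N; rewrite exprDn.
  elim/big_rec: _ => [|k z _ Iz]; first exact: did0.
  apply: didD => //; rewrite -mulr_natl; apply: didM => //.
  have [le|/ltnW le] := leqP b k.
    by apply: didM => //; rewrite -(subnK le) exprD; apply: didM.
  rewrite mulrC; apply: didM => //.
  have -> : (a + b - k = (b - k) + a)%N by rewrite -addnBA // addnC.
  by rewrite exprD; apply: didM.
- by move=> x y [a Ia]; exists a; rewrite exprMn; apply: didM.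
- by move=> i x [a Ia]; apply: (did_radical i dI Ia).
Qed.

(** If [x b] lies in [I] then so does [(x' b) ^ 2], because
    [x' b (x b)' = (x' b) ^ 2 + x' b' (x b)]; this is where [I] has to be radical. *)
Lemma did_colon I b : dideal I -> (forall x n, I (x ^+ n) -> I x) -> dideal (fun x => I (x * b)).
Proof.
move=> dI rI; split.
- by rewrite mul0r; exact: did0.
- by move=> x y Ix Iy; rewrite mulrDl; apply: didD.
- by move=> x y Ix; rewrite -mulrA; apply: didM.
- move=> i x Ix; apply: (rI _ 2).
  have := did_der dI i Ix; rewrite rderM => H.
  have := didM dI (rder i x * b) H; rewrite mulrDr => H'.
  have -> : (rder i x * b) ^+ 2 = rder i x * b * (rder i x * b) by rewrite expr2.
  apply: did_subr H' => //.
  have -> : rder i x * b * (x * rder i b) = (rder i x * rder i b) * (x * b) by ring.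
  exact: didM.
Qed.

(** Take [P] maximal among the differential ideals that contain [J] and miss [S]. It is radical by
    maximality, so its colon ideals are differential. If [x y] is in [P] and neither factor is,
    maximality yields [s] in [S] with [s y] in [P], then [t] in [S] with [t s] in [P], against [t s]
    in [S]. *)
Lemma dprime_exists (J S : R -> Prop) :
  dideal J -> S 1 -> (forall x y, S x -> S y -> S (x * y)) -> (forall x, J x -> ~ S x) ->
  exists P : R -> Prop, [/\ dideal P, (forall x y, P (x * y) -> P x \/ P y),
    (forall x, J x -> P x) & (forall x, P x -> ~ S x)].
Proof.
move=> dJ S1 SM JS.
have SX x n : S x -> S (x ^+ n).
  by move=> Sx; elim: n => [|n IH]; rewrite ?expr0 ?exprS //; apply: SM.
pose Q (I : R -> Prop) := dideal I /\ forall x, I x -> ~ S x.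
have [] := @zorn_above R Q J; first by [].
  move=> F [X0 FX0] FQ Ftot; split; last by move=> x [X [/FQ[_ H] /H]].
  split.
  - by exists X0; split=> //; apply: did0; case: (FQ X0 FX0).
  - move=> x y [X [FX Xx]] [Y [FY Yy]].
    case: (Ftot X Y FX FY) => H; [exists Y|exists X]; split=> //.
      by apply: didD; [case: (FQ Y FY)|apply: H|].
    by apply: didD; [case: (FQ X FX)| |apply: H].
  - by move=> x y [X [FX Xx]]; exists X; split=> //; apply: didM => //; case: (FQ X FX).
  - by move=> i x [X [FX Xx]]; exists X; split=> //; apply: did_der => //; case: (FQ X FX).
move=> P [[dP PS] JP maxP].
have rP x n : P (x ^+ n) -> P x.
  move=> Pxn; apply: (maxP (fun y => exists l, P (y ^+ l))); last by exists n.
    by split; [exact: did_radical_ideal | move=> y [l /PS H] /(SX _ l)].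
  by move=> y Py; exists 1%N; rewrite expr1.
have hit b : ~ P b -> forall a, P (a * b) -> ~ P a -> exists s, S s /\ P (s * b).
  move=> nb a Pab na; apply: contrapT => H; apply: na.
  apply: (maxP (fun x => P (x * b))) => //.
    by split; [exact: did_colon | move=> x Px Sx; apply: H; exists x].
  by move=> x Px; rewrite mulrC; exact: didM.
exists P; split=> // x y Pxy; apply: contrapT => /not_orP[nx ny].
have [s [Ss Psy]] := hit y ny x Pxy nx.
have Pys : P (y * s) by rewrite mulrC.
have ns : ~ P s by move=> /PS.
have [t [St Pts]] := hit s ns y Pys ny.
exact: (PS _ Pts (SM _ _ St Ss)).
Qed.

End DIdeal.

(** * Amalgamation *)

Section Functional.
Variables (k L : fieldType) (i : {rmorphism k -> L}) (c : L).
Hypothesis c0 : c <> 0.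

(** The kernel of [rho] is a [k]-subspace maximal among those that avoid [c]; by maximality it is a
    complement of the line through [c]. *)
Lemma linear_functional : exists rho : {additive L -> k},
  (forall a u, rho (u * i a) = rho u * a) /\ rho c = 1.
Proof.
pose Q (N : L -> Prop) := [/\ N 0, (forall x y, N x -> N y -> N (x + y)),
  (forall a x, N x -> N (x * i a)) & ~ N c].
have [] := @zorn_above L Q (fun x => x = 0).
- split=> // [x y -> ->|a x ->]; by rewrite ?addr0 ?mul0r.
- move=> F [X0 FX0] FQ Ftot; split.
  + by exists X0; split=> //; case: (FQ X0 FX0).
  + move=> x y [X [FX Xx]] [Y [FY Yy]].
    case: (Ftot X Y FX FY) => H; [exists Y|exists X]; split=> //.
      by case: (FQ Y FY) => _ HD _ _; apply: HD; first exact: H.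
    by case: (FQ X FX) => _ HD _ _; apply: HD; last exact: H.
  + by move=> a x [X [FX Xx]]; exists X; split=> //; case: (FQ X FX) => _ _ + _; apply.
  + by move=> [X [FX Xc]]; case: (FQ X FX).
move=> N [[N0 ND NM Nc] _ maxN].
have NN x : N x -> N (- x) by move=> Nx; have := NM (-1) x Nx; rewrite rmorphN1 mulrN1.
have NB x y : N x -> N y -> N (x - y) by move=> Nx Ny; apply: ND => //; exact: NN.
have dec u : exists a, N (u - c * i a).
  have [Nu|nNu] := pselect (N u); first by exists 0; rewrite rmorph0 mulr0 subr0.
  pose N' x := exists a, N (x - u * i a).
  have NN' x : N x -> N' x by move=> Nx; exists 0; rewrite rmorph0 mulr0 subr0.
  have [N'c|nN'c] := pselect (N' c).
    case: N'c => a Na; have a0 : i a != 0.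
      by apply/eqP => E; apply: Nc; move: Na; rewrite E mulr0 subr0.
    exists a^-1; have := NN _ (NM a^-1 _ Na); rewrite fmorphV mulrBl mulfK // opprB; exact.
  exfalso; apply: nNu; apply: (maxN N') => //; last by exists 1; rewrite rmorph1 mulr1 subrr.
  split=> //; first exact: NN'.
    move=> x y [a Na] [b Nb]; exists (a + b).
    by rewrite rmorphD mulrDr opprD addrACA; exact: ND.
  by move=> b x [a Na]; exists (a * b); rewrite rmorphM mulrA -mulrBl; apply: NM.
have uniq u a b : N (u - c * i a) -> N (u - c * i b) -> a = b.
  move=> Na Nb; apply: contrapT => /eqP; rewrite -subr_eq0 => ab0.
  apply: Nc; have := NM (a - b)^-1 _ (NB _ _ Nb Na).
  rewrite opprB addrC addrA subrK -mulrBr -rmorphB -mulrA -rmorphM divff //.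
  by rewrite rmorph1 mulr1.
pose rho u := sval (cid (dec u)).
have rhoP u : N (u - c * i (rho u)) by exact: svalP (cid (dec u)).
have rhoB : zmod_morphism rho.
  move=> x y; apply: (uniq (x - y)) => //.
  have -> : x - y - c * i (rho x - rho y) = (x - c * i (rho x)) - (y - c * i (rho y)).
    by rewrite rmorphB; ring.
  exact: NB.
pose rhoi := GRing.isZmodMorphism.Build L k rho rhoB.
pose rhoA : {additive L -> k} := HB.pack rho rhoi.
exists rhoA; split=> [a u|]; rewrite /rhoA /=.
  apply: (uniq (u * i a)) => //.
  by rewrite rmorphM mulrA -mulrBl; apply: NM.
by apply: (uniq c) => //; rewrite rmorph1 mulr1 subrr.
Qed.

End Functional.

Lemma pol_domain (K : fieldType) (V : choiceType) (p q : pol K V) :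
  p * q = 0 -> p = 0 \/ q = 0.
Proof.
have [s1 H1] := pin_seq p; have [s2 H2] := pin_seq q.
have {}H1 : pin (fun k => k \in s1 ++ s2) p by apply: pin_sub H1 => k; rewrite mem_cat => ->.
have {}H2 : pin (fun k => k \in s1 ++ s2) q by apply: pin_sub H2 => k; rewrite mem_cat orbC => ->.
elim: (s1 ++ s2) p q H1 H2 => [|t s IH] p q Hp Hq pq.
  have [[a Ea] [b Eb]] : (exists a, p = pC a) /\ exists b, q = pC b.
    by split; apply: pin_none; [move: Hp|move: Hq]; apply: pin_sub.
  move: pq; rewrite Ea Eb -rmorphM => /(congr1 (pev (@idfun K) (fun _ : V => 0))).
  rewrite mpevC rmorph0 /= => /eqP; rewrite mulf_eq0 => /orP[] /eqP ->; rewrite rmorph0; [left|right]; done.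
apply: contrapT => /not_orP[/eqP p0 /eqP q0].
have tp0 (r : pol K V) : r != 0 -> lead_coef (tau t r) != 0.
  by rewrite lead_coef_eq0; apply: contra_neq => E; rewrite -(tauK t r) E horner0.
have lc (r : pol K V) : pin (fun k => k \in t :: s) r -> pin (fun k => k \in s) (lead_coef (tau t r)).
  move=> Hr; apply: pin_sub (tau_pin t (size (tau t r)).-1 Hr) => k [].
  by rewrite inE => /orP[/eqP|].
have l0 : lead_coef (tau t p) * lead_coef (tau t q) != 0.
  by apply/eqP => /(IH _ _ (lc _ Hp) (lc _ Hq))[] /eqP; apply/negP; apply: tp0.
have := lead_coef_proper_mul l0; rewrite -rmorphM pq rmorph0 lead_coef0 => /esym/eqP.
by rewrite (negPf l0).
Qed.

Definition dhom_comp (m : nat) (R S T : dring m) (g : dhom S T) (f : dhom R S) : dhom R T :=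
  @DHom m R T (g \o f) (fun j x => etrans (congr1 g (dhom_der f j x)) (dhom_der g j (f x))).

Definition dembed_comp (m : nat) (K L M : dfield m) (h : dembed L M) (i : dembed K L) : dembed K M :=
  @DEmbed m K M (h \o i) (fun j x => etrans (congr1 h (demb_der i j x)) (demb_der h j (i x))).

Notation "K '{Y' J }" := (dpol (dring_of K) J) (at level 2, format "K '{Y'  J }").
Notation devE h := (dev (dhom_of h)).

Section Amalgam.
Variables (m : nat) (k U M : dfield m) (i : dembed k U) (i0 : dembed k M).
Variables (J : choiceType) (z0 : J -> M) (D : dvar m J -> Prop).
Hypothesis indep : forall p : k{Y J}, pin D p -> devE i0 z0 p = 0 -> p = 0.

Let W : dring m := U{Y J}.
Let bc : dhom k{Y J} W := dev (dhom_comp (dpC (dring_of U) J) (dhom_of i)) (@dY m (dring_of U) J).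

Lemma bcE : bc =1 pev (mpC malg_theory U (dvar m J) \o i) pX.
Proof.
by apply: pol_ext => [c|l]; rewrite ?mpevC ?mpevX ?devC ?devX // rdopY; case: l.
Qed.

Inductive bc_span (I : k{Y J} -> Prop) : W -> Prop :=
| bc_span0 : bc_span I 0
| bc_spanD x u q of bc_span I x & I q : bc_span I (x + pC u * bc q).

Lemma bc_span_add I x y : bc_span I x -> bc_span I y -> bc_span I (x + y).
Proof.
move=> Hx; elim=> [|{}y u q _ IH q0]; first by rewrite addr0.
by rewrite addrA; apply: bc_spanD.
Qed.

Lemma bc_span_gen (I : k{Y J} -> Prop) u q : I q -> bc_span I (pC u * bc q).
Proof. by move=> q0; rewrite -[_ * _]add0r; apply: bc_spanD => //; exact: bc_span0. Qed.

Lemma bc_span_mul I x y : (forall p q, I q -> I (p * q)) -> bc_span I x -> bc_span I (y * x).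
Proof.
move=> IM; elim/(@mp_ind malg_theory): y x => [c|l|p q IH1 IH2|p q IH1 IH2] x Hx.
- elim: Hx => [|{}x u q _ IH q0]; first by rewrite mulr0; exact: bc_span0.
  by rewrite mulrDr mulrA -rmorphM; apply: bc_span_add => //; exact: bc_span_gen.
- elim: Hx => [|{}x u q _ IH q0]; first by rewrite mulr0; exact: bc_span0.
  rewrite mulrDr; apply: bc_span_add => //.
  have -> : pX l * (pC u * bc q) = pC u * bc (pX l * q).
    by rewrite rmorphM mulrCA; congr (_ * (_ * _)); rewrite bcE mpevX.
  by apply: bc_span_gen; apply: IM.
- by rewrite mulrDl; apply: bc_span_add; [exact: IH1 | exact: IH2].
- by rewrite -mulrA; apply: IH1; exact: IH2.
Qed.

Lemma bc_span_all x : bc_span (fun=> True) x.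
Proof.
rewrite -[x]mulr1; apply: bc_span_mul => //.
by rewrite -[1]mulr1 -{1}(rmorph1 (mpC malg_theory U (dvar m J))) -(rmorph1 bc); exact: bc_span_gen.
Qed.

Let I0 q := devE i0 z0 q = 0.

Lemma bc_span_ideal : dideal (bc_span I0).
Proof.
split; [exact: bc_span0 | by move=> x y; exact: bc_span_add | |].
- by move=> x y; apply: bc_span_mul => p q; rewrite /I0 rmorphM => ->; rewrite mulr0.
- move=> j x; elim=> [|{}x u q _ IH q0]; first by rewrite rder0; exact: bc_span0.
  rewrite rderD rderM; apply: bc_span_add => //; apply: bc_span_add.
    have -> : rder j (pC u : W) = pC (rder j u) by exact: (pderC (@Xshift m _ _)).
    exact: bc_span_gen.
  by rewrite -dhom_der; apply: bc_span_gen; rewrite /I0 dhom_der q0 rder0.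
Qed.

(* A k-linear functional rho on U induces a functional on U{Y} with values in
   M that vanishes on the ideal generated by the relations of z0 over k. *)
Lemma bc_span_rho (rho : {additive U -> k}) x :
  (forall a u, rho (u * i a) = rho u * a) -> bc_span I0 x -> devE i0 z0 (mpret rho x) = 0.
Proof.
move=> rhoi; elim=> [|{}x u q _ IH q0].
  rewrite (_ : mpret rho 0 = 0) ?rmorph0 //.
  by apply: (addIr (mpret rho 0)); rewrite -mpretD !add0r.
by rewrite mpretD rmorphD IH add0r bcE mpret_map // rmorphM q0 mulr0.
Qed.

Lemma bc_rho_mul (rho : {additive U -> k}) (s : W) q :
  (forall a u, rho (u * i a) = rho u * a) -> mpret rho (s * bc q) = mpret rho s * q.
Proof.
move=> rhoi; elim: (bc_span_all s) => [|x u p _ IH _].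
  have r0 : mpret rho (0 : W) = 0 by apply: (addIr (mpret rho (0 : W))); rewrite -mpretD !add0r.
  by rewrite mul0r r0 mul0r.
by rewrite mulrDl -mulrA -rmorphM !mpretD IH mulrDl !bcE !mpret_map // mulrA.
Qed.

(** The ideal spanned by the relations of [z0] over [k] misses the set [S] of products [s q] that
    must stay nonzero: otherwise a [k]-linear functional on [U], nonzero at a coefficient of [s],
    would turn [s q] into a relation over [k], against [indep]. A prime differential ideal that
    contains the former and misses the latter gives [L]. *)
Lemma amalgam : exists (L : dfield m) (h : dembed U L) (z : J -> L),
  (forall q, devE i0 z0 q = 0 <-> devE (dembed_comp h i) z q = 0) /\
  (forall s : U{Y J}, pin D s -> devE h z s = 0 -> s = 0).
Proof.
pose S (x : W) := exists s q, [/\ x = s * bc q, pin D s, s <> 0 & devE i0 z0 q <> 0].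
have Wdiv n : exists u : W, u * n.+1%:R = 1.
  exists (pC (n.+1%:R^-1 : U)); rewrite -(rmorph_nat (mpC malg_theory U (dvar m J))) -rmorphM mulVf ?rmorph1 //.
  by have/pcharf0P -> := dchar0 U.
have S1 : S 1.
  exists 1, 1; rewrite !rmorph1 mulr1; split=> //; [exact: pin1 | |]; by apply/eqP; rewrite oner_neq0.
have SM x y : S x -> S y -> S (x * y).
  move=> [s [q [-> Ds s0 q0]]] [t [r [-> Dt t0 r0]]]; exists (s * t), (q * r); split.
  - by rewrite rmorphM mulrACA.
  - exact: pinM.
  - by move/pol_domain => [].
  - by rewrite rmorphM => /eqP; rewrite mulf_eq0 => /orP[]/eqP.
have disj x : bc_span I0 x -> ~ S x.
  move=> Ix [s [q [E Ds s0 q0]]]; rewrite {}E in Ix.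
  have [c [c0 Hc]] := mpret_neq0 s0.
  have [rho [rhoi rc]] := linear_functional i c0.
  apply: (Hc k rho); first by rewrite rc; apply/eqP; rewrite oner_neq0.
  apply: indep; first exact: mpret_pin.
  have := bc_span_rho rhoi Ix; rewrite bc_rho_mul // rmorphM => /eqP.
  by rewrite mulf_eq0 => /orP[]/eqP.
have [P [dP Pp JP PS]] := dprime_exists Wdiv bc_span_ideal S1 SM disj.
have P1 : ~ P 1 by move=> /PS.
have [|L [phi [ker fr]]] := prime_dfrac (did0 dP) _ (didD dP) (didM dP) Pp (did_der dP).
  by move=> n Pn; apply: P1; have [u <-] := Wdiv n; apply: didM.
pose h : dembed U L := @DEmbed m U L (phi \o mpC malg_theory U (dvar m J))
  (dhom_der (dhom_comp phi (dpC (dring_of U) J))).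
pose z j := phi (dY (dring_of U) j).
have E : devE h z =1 phi.
  apply: pol_ext => [c|l]; rewrite ?devC ?devX //.
  by rewrite /z -dhom_rdop rdopY; case: l.
exists L, h, z; split=> [q|s Ds].
  have -> : devE (dembed_comp h i) z q = phi (bc q).
    have H : devE (dembed_comp h i) z =1 phi \o bc; last exact: H.
    by apply: pol_ext => [c|l]; rewrite ?devC ?devX //= bcE ?mpevC ?mpevX // /z -dhom_rdop rdopY; case: l.
  rewrite ker; split=> [q0|Pq].
    by apply: JP; rewrite -[bc q]mul1r -(rmorph1 (mpC malg_theory U (dvar m J))); apply: bc_span_gen.
  apply: contrapT => q0; apply: (PS _ Pq); exists 1, q; rewrite mul1r; split=> //; first exact: pin1.
  by apply/eqP; rewrite oner_neq0.
rewrite E ker => Ps; apply: contrapT => s0; apply: (PS _ Ps).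
by exists s, 1; rewrite !rmorph1 mulr1; split=> //; apply/eqP; rewrite oner_neq0.
Qed.

End Amalgam.

(** * Algebraic dependence *)

Section Subfields.
Variable L : fieldType.
Implicit Types (M S : L -> Prop) (x y : L).

Record is_subf M : Prop := IsSubf {
  subf1 : M 1;
  subfB : forall x y, M x -> M y -> M (x - y);
  subfV : forall x y, M x -> M y -> M (x / y) }.

Lemma subf0 M : is_subf M -> M 0.
Proof. by move=> H; rewrite -(subrr 1); apply: subfB => //; exact: subf1. Qed.
Lemma subfN M x : is_subf M -> M x -> M (- x).
Proof. by move=> H Hx; rewrite -[- x]add0r; apply: subfB => //; exact: subf0. Qed.
Lemma subfD M x y : is_subf M -> M x -> M y -> M (x + y).
Proof. by move=> H Hx Hy; rewrite -[y]opprK; apply: subfB => //; exact: subfN. Qed.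
Lemma subfI M x : is_subf M -> M x -> M x^-1.
Proof. by move=> H Hx; rewrite -[x^-1]mul1r; apply: subfV => //; exact: subf1. Qed.
Lemma subfM M x y : is_subf M -> M x -> M y -> M (x * y).
Proof. by move=> H Hx Hy; rewrite -[y]invrK; apply: subfV => //; exact: subfI. Qed.
Lemma subfX M x n : is_subf M -> M x -> M (x ^+ n).
Proof.
by move=> H Hx; elim: n => [|n IH]; rewrite ?expr0 ?exprS; [exact: subf1 | exact: subfM].
Qed.
Lemma subf_sum M (I : Type) (s : seq I) (P : pred I) (F : I -> L) :
  is_subf M -> (forall i, P i -> M (F i)) -> M (\sum_(i <- s | P i) F i).
Proof. by move=> HM H; elim/big_rec: _ => [|i x Pi Hx]; [exact: subf0 | apply: subfD => //; exact: H]. Qed.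
Lemma subfMn M x n : is_subf M -> M x -> M (x *+ n).
Proof. by move=> H Hx; elim: n => [|n IH]; rewrite ?mulr0n ?mulrS; [exact: subf0 | exact: subfD]. Qed.

Definition sfgen S x : Prop := forall M, is_subf M -> (forall y, S y -> M y) -> M x.

Lemma sfgen_subf S : is_subf (sfgen S).
Proof.
split=> [M HM _|x y Hx Hy M HM HS|x y Hx Hy M HM HS]; first exact: subf1.
  by apply: subfB => //; [exact: Hx | exact: Hy].
by apply: subfV => //; [exact: Hx | exact: Hy].
Qed.
Lemma sfgen_gen S x : S x -> sfgen S x.
Proof. by move=> Sx M _; exact. Qed.
Lemma sfgen_min S M : is_subf M -> (forall y, S y -> M y) -> forall x, sfgen S x -> M x.
Proof. by move=> HM HS x; exact. Qed.
Lemma sfgen_sub S S' : (forall y, S y -> sfgen S' y) -> forall x, sfgen S x -> sfgen S' x.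
Proof. by move=> H; apply: sfgen_min => //; exact: sfgen_subf. Qed.

Definition algov M x : Prop :=
  exists p : {poly L}, [/\ p != 0, forall i, M p`_i & root p x].

Lemma algov_sub M M' x : (forall y, M y -> M' y) -> algov M x -> algov M' x.
Proof. by move=> H [p [p0 pM px]]; exists p; split=> // i; exact: H. Qed.

Lemma algov_id M x : is_subf M -> M x -> algov M x.
Proof.
move=> HM Mx; exists ('X - x%:P); split; [by rewrite polyXsubC_eq0 | | by rewrite root_XsubC].
move=> i; rewrite coefB coefX coefC; apply: subfB => //.
  by case: eqP => _; [exact: subf1 | exact: subf0].
by case: eqP => _ //; exact: subf0.
Qed.

Section SubType.
Variables (M : L -> Prop) (HM : is_subf M).

Definition sf_pred : {pred L} := let _ := HM in [pred x | `[< M x >]].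

Fact sf_divring : divring_closed sf_pred.
Proof.
split=> [|x y /asboolP Hx /asboolP Hy|x y /asboolP Hx /asboolP Hy]; apply/asboolP.
- exact: subf1.
- exact: subfB.
- exact: subfV.
Qed.

HB.instance Definition _ := GRing.isDivringClosed.Build L sf_pred sf_divring.

Inductive sf_type : predArgType := SF x of x \in sf_pred.
Definition sf_val (u : sf_type) := let: SF x _ := u in x.

HB.instance Definition _ := [isSub for sf_val].
HB.instance Definition _ := [Choice of sf_type by <:].
HB.instance Definition _ := [SubChoice_isSubComUnitRing of sf_type by <:].
HB.instance Definition _ := [SubComUnitRing_isSubIntegralDomain of sf_type by <:].
HB.instance Definition _ := [SubIntegralDomain_isSubField of sf_type by <:].

Lemma sf_surj x : M x -> exists a : sf_type, sf_val a = x.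
Proof. by move=> /asboolP Hx; exists (SF Hx). Qed.

Lemma sf_in (a : sf_type) : M (sf_val a).
Proof. by apply/asboolP; exact: (valP a). Qed.

End SubType.

(** Subfields are predicates because the bases vary constantly; made into an actual field, a
    subfield gets access to the theory of [algebraicOver]. *)
Lemma subf_field M : is_subf M -> exists (F : fieldType) (f : {rmorphism F -> L}),
  (forall a, M (f a)) /\ (forall x, M x -> exists a, f a = x).
Proof.
move=> HM; exists (sf_type HM), (val : {rmorphism sf_type HM -> L}).
by split; [exact: sf_in | exact: sf_surj].
Qed.

Lemma algov_algebraicOver M (F : fieldType) (f : {rmorphism F -> L}) x :
  (forall a, M (f a)) -> (forall x, M x -> exists a, f a = x) ->
  algov M x <-> algebraicOver f x.
Proof.
move=> Mf fM; split=> [[p [p0 pM px]]|[q q0 qx]]; last first.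
  exists (map_poly f q); split=> //; first by rewrite map_poly_eq0.
  by move=> i; rewrite coef_map; exact: Mf.
have {}fM i : exists a, f a = p`_i by exact: fM.
pose g i := sval (cid (fM i)).
have gE i : f (g i) = p`_i by exact: svalP (cid (fM i)).
have E : p = map_poly f (\poly_(i < size p) g i).
  apply/polyP => i; rewrite coef_map coef_poly; case: ltnP => le; first exact: esym (gE i).
  exact: (etrans (nth_default _ le) (esym (rmorph0 f))).
by move: p0 px; rewrite E map_poly_eq0; exists (\poly_(i < size p) g i).
Qed.

Lemma algov_subf M : is_subf M -> is_subf (algov M).
Proof.
move=> HM; have [F [f [Mf fM]]] := subf_field HM.
have E x := algov_algebraicOver x Mf fM.
split=> [|x y|x y]; rewrite !E.
- exact: algebraic1.
- exact: algebraic_sub.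
- exact: algebraic_div.
Qed.

Lemma algov_trans M x : is_subf M -> algov (algov M) x -> algov M x.
Proof.
move=> HM; have [F [f [Mf fM]]] := subf_field HM.
rewrite (algov_algebraicOver x Mf fM) => -[p [p0 pM px]].
apply/integral_algebraic; apply: (integral_root p0 px) => y /(nthP 0)[i _ <-].
by apply/integral_algebraic/(algov_algebraicOver _ Mf fM).
Qed.

(** In characteristic 0, an annihilating polynomial whose derivative vanishes at [x] can be replaced
    by this derivative, which is nonzero of smaller degree. *)
Lemma min_sep_poly M x : [pchar L] =i pred0 -> is_subf M -> algov M x ->
  exists p : {poly L}, [/\ forall i, M p`_i, root p x & p^`().[x] != 0].
Proof.
move=> c0 HM; suff H n : forall p : {poly L}, (size p <= n)%N -> p != 0 -> (forall i, M p`_i) -> root p x ->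
    exists p : {poly L}, [/\ forall i, M p`_i, root p x & p^`().[x] != 0].
  by case=> p [p0 pM px]; exact: (H (size p) p).
elim: n => [|n IH] p sp p0 pM px; first by move: p0; rewrite -size_poly_leq0 sp.
have [d0|] := eqVneq p^`().[x] 0; last by exists p.
have [s1|s1] := leqP (size p) 1.
  move: px p0; rewrite (size1_polyC s1) /root hornerC => /eqP ->.
  by rewrite eqxx.
apply: (IH p^`()); last by rewrite /root d0.
- by rewrite -ltnS (leq_trans (lt_size_deriv p0)).
- apply/eqP => /(congr1 (fun q : {poly L} => q`_(size p).-2)).
  rewrite coef_deriv coef0 => /eqP; have [k Ek] : exists k, size p = k.+2 by exists (size p).-2; case: (size p) s1 => [|[]].
  rewrite Ek /= -mulr_natl mulf_eq0 => /orP[/eqP E|/eqP E].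
    by move: E; have/pcharf0P/(_ k.+1) := c0; move=> /[swap] -> ; rewrite eqxx.
  by move: p0; rewrite -lead_coef_eq0 /lead_coef Ek /= E eqxx.
- by move=> i; rewrite coef_deriv; apply: subfMn.
Qed.

End Subfields.

Section Expr.
Variables (R : comNzRingType) (V : choiceType) (L : fieldType).
Variables (f : {rmorphism R -> L}) (w : V -> L) (T : V -> Prop).

Definition gens x : Prop := (exists r, x = f r) \/ (exists2 t, T t & x = w t).

Lemma pin_gens p : pin T p -> sfgen gens (pev f w p).
Proof.
elim=> [c|k Tk|a b _ IH1 _ IH2|a b _ IH1 _ IH2].
- by rewrite mpevC; apply: sfgen_gen; left; exists c.
- by rewrite mpevX; apply: sfgen_gen; right; exists k.
- by rewrite rmorphD; exact: (subfD (sfgen_subf _)).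
- by rewrite rmorphM; exact: (subfM (sfgen_subf _)).
Qed.

Lemma gens_frac x : sfgen gens x ->
  exists a b, [/\ pin T a, pin T b, pev f w b != 0 & x = pev f w a / pev f w b].
Proof.
apply: (sfgen_min (M := fun x => exists a b, [/\ pin T a, pin T b, pev f w b != 0 & x = pev f w a / pev f w b])).
  split.
  - by exists 1, 1; rewrite !rmorph1 divr1 oner_neq0; split=> //; exact: pin1.
  - move=> {}x y [a [b [Ta Tb b0 ->]]] [c [d [Tc Td d0 ->]]].
    exists (a * d - c * b), (b * d); split.
    + by apply: pinB; apply: pinM.
    + exact: pinM.
    + by rewrite rmorphM mulf_neq0.
    + by rewrite rmorphB !rmorphM /=; field; rewrite b0 d0.
  - move=> {}x y [a [b [Ta Tb b0 ->]]] [c [d [Tc Td d0 ->]]].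
    have [c0|c0] := eqVneq (pev f w c) 0.
      by exists 0, 1; rewrite c0 mul0r invr0 mulr0 rmorph1 rmorph0 mul0r oner_neq0; split=> //; [exact: pin0|exact: pin1].
    exists (a * d), (b * c); split; [exact: pinM | exact: pinM | by rewrite rmorphM mulf_neq0 |].
    by rewrite !rmorphM /=; field; rewrite b0 d0 c0.
move=> y [[r ->]|[t Tt ->]].
  by exists (pC r), 1; rewrite mpevC rmorph1 divr1 oner_neq0; split=> //; [exact: pinC|exact: pin1].
by exists (pX t), 1; rewrite mpevX rmorph1 divr1 oner_neq0; split=> //; [exact: pinX|exact: pin1].
Qed.

Lemma gens_poly (p : {poly L}) : (forall i, sfgen gens p`_i) ->
  exists (c : L) (P : {poly pol R V}),
    [/\ c != 0, forall i, pin T P`_i & map_poly (pev f w) P = c *: p].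
Proof.
suff H : (forall i, sfgen gens p`_i) ->
  exists (b : pol R V) (P : {poly pol R V}),
    [/\ pev f w b != 0, pin T b, forall i, pin T P`_i & map_poly (pev f w) P = pev f w b *: p].
  by move/H => [b [P [b0 _ TP E]]]; exists (pev f w b), P.
elim/poly_ind: p => [_|p c IH Hp].
  by exists 1, 0; rewrite rmorph1 oner_neq0 rmorph0 scaler0; split=> // [|i]; [exact: pin1|rewrite coef0; exact: pin0].
have [i|b [P [b0 Tb TP E]]] := IH.
  by have := Hp i.+1; rewrite coefD coefMX coefC /= addr0.
have := Hp 0%N; rewrite coefD coefMX coefC /= add0r => /gens_frac[a [d [Ta Td d0 Ec]]].
exists (b * d), (d *: P * 'X + (b * a)%:P); split.
- by rewrite rmorphM mulf_neq0.
- exact: pinM.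
- move=> i; rewrite coefD coefMX coefC coefZ; apply: pinD.
    by case: eqP => _; [exact: pin0 | apply: pinM].
  by case: eqP => _; [apply: pinM | exact: pin0].
- rewrite rmorphD !rmorphM /= map_polyZ map_polyX map_polyC E /= Ec rmorphM /=.
  rewrite -!mul_polyC !polyCM mulrDr !mulrA; congr (_ + _); first by ring.
  by rewrite !map_polyC /= -!polyCM; congr (_%:P); field.
Qed.

(** With denominators cleared, algebraicity depends only on which polynomials over [R] vanish at
    [w]; this is what carries it from one field to another. *)
Lemma algov_gens x : algov (sfgen gens) x <->
  exists P : {poly pol R V},
    [/\ forall i, pin T P`_i, map_poly (pev f w) P != 0 & root (map_poly (pev f w) P) x].
Proof.
split=> [[p [p0 /gens_poly[c [P [c0 TP E]]] px]]|[P [TP P0 Px]]].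
  by exists P; rewrite E scaler_eq0 negb_or c0 p0 rootZ.
by exists (map_poly (pev f w) P); split=> // i; rewrite coef_map; exact: pin_gens.
Qed.

End Expr.

(** * Leaders *)

Section Ranking.
Variables (m n : nat).
Local Notation V := (dvar m 'I_n).

Definition elt (e e' : {ffun 'I_m -> nat}) : Prop :=
  exists i : 'I_m, (e i < e' i)%N /\ forall k : 'I_m, (k < i)%N -> e k = e' k.

(** An elimination ranking: all derivatives of one component precede those of the next. Hence an
    equation for component [j] over the earlier components yields a leader in component [j]. A
    variable can have infinitely many predecessors, so induction rests on [vlt_min]. *)
Definition vlt (a b : V) : Prop := (a.2 < b.2)%N \/ (a.2 = b.2 /\ elt a.1 b.1).

Lemma elt_irr e : ~ elt e e.
Proof. by case=> i; rewrite ltnn => -[]. Qed.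

Lemma elt_trans e1 e2 e3 : elt e1 e2 -> elt e2 e3 -> elt e1 e3.
Proof.
move=> [i [Hi Ei]] [j [Hj Ej]]; case: (ltngtP i j) => [ij|ji|/val_inj ij].
- by exists i; split=> [|k ki]; [rewrite -Ej | rewrite Ei // Ej // (ltn_trans ki)].
- by exists j; split=> [|k kj]; [rewrite Ei | rewrite Ei ?Ej // (ltn_trans kj)].
- by subst j; exists i; split=> [|k ki]; [exact: ltn_trans Hi Hj | rewrite Ei // Ej].
Qed.

Lemma elt_total e e' : [\/ e = e', elt e e' | elt e' e].
Proof.
have [->|/eqP ne] := eqVneq e e'; first by constructor 1.
have exi : exists k, [exists i : 'I_m, (i == k :> nat) && (e i != e' i)].
  apply: contrapT => H; apply: ne; apply/ffunP => i; apply: contrapT => /eqP ei.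
  by apply: H; exists i; apply/existsP; exists i; rewrite eqxx.
case: (ex_minnP exi) => k /existsP[i /andP[/eqP ik ei]] kmin.
have low (j : 'I_m) : (j < i)%N -> e j = e' j.
  move=> ji; apply/eqP; apply: contraTT ji => ej; rewrite -leqNgt ik.
  by apply: kmin; apply/existsP; exists j; rewrite eqxx.
move: ei; rewrite neq_ltn => /orP[lt|lt]; [constructor 2|constructor 3]; exists i; split=> // j ji.
by rewrite low.
Qed.

Lemma elt_einc i e e' : elt e e' -> elt (einc e i) (einc e' i).
Proof.
move=> [j [Hj Ej]]; exists j; split=> [|k kj]; rewrite !ffunE; first by rewrite ltn_add2r.
by rewrite Ej.
Qed.

Lemma elt_einc1 i e : elt e (einc e i).
Proof.
exists i; split=> [|k ki]; rewrite ffunE; first by rewrite eqxx addn1.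
by rewrite eq_sym -val_eqE gtn_eqF // addn0.
Qed.

Lemma elt_min (P : {ffun 'I_m -> nat} -> Prop) : (exists e, P e) ->
  exists e, P e /\ forall e', P e' -> ~ elt e' e.
Proof.
move=> [x0 Px0].
have H l : (l <= m)%N -> exists e, P e /\ forall e' (i : 'I_m), P e' -> (i < l)%N ->
    (forall k : 'I_m, (k < i)%N -> e' k = e k) -> (e i <= e' i)%N.
  elim: l => [_|l IH lm]; first by exists x0.
  have [e1 [Pe1 He1]] := IH (ltnW lm).
  pose j := Ordinal lm.
  pose Q v := `[< exists e, [/\ P e, e j = v & forall k : 'I_m, (k < l)%N -> e k = e1 k] >].
  have exQ : exists v, Q v by exists (e1 j); apply/asboolP; exists e1.
  case: (ex_minnP exQ) => v /asboolP[e [Pe ev He]] vmin.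
  exists e; split=> // e' i Pe' il Ei.
  move: il; rewrite ltnS leq_eqVlt => /orP[/eqP E|il].
    have ij : i = j by exact: val_inj.
    rewrite ij ev; apply: vmin; apply/asboolP; exists e'; split=> // k kl.
    by rewrite Ei ?E // He.
  rewrite He //; apply: He1 => // k ki; rewrite Ei // He //.
  exact: ltn_trans ki il.
have [e [Pe He]] := H m (leqnn m).
exists e; split=> // e' Pe' [i [lt Ei]].
by have := He e' i Pe' (ltn_ord i) Ei; rewrite leqNgt lt.
Qed.

Lemma vlt_irr a : ~ vlt a a.
Proof. by case=> [|[_ /elt_irr]]; rewrite ?ltnn. Qed.

Lemma vlt_trans a b c : vlt a b -> vlt b c -> vlt a c.
Proof.
move=> [ab|[ab ab']] [bc|[bc bc']]; rewrite /vlt.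
- by left; exact: ltn_trans ab bc.
- by left; rewrite -bc.
- by left; rewrite ab.
- by right; split; [rewrite ab | exact: elt_trans ab' bc'].
Qed.

Lemma vlt_total a b : [\/ a = b, vlt a b | vlt b a].
Proof.
case: a b => e i [e' i']; rewrite /vlt /=.
case: (ltngtP i i') => [ij|ij|/val_inj ij]; [by constructor 2; left|by constructor 3; left|].
subst i'; case: (elt_total e e') => [->|H|H]; [by constructor 1|constructor 2|constructor 3]; by right.
Qed.

Lemma vlt_shift i a b : vlt a b -> vlt (shift i a) (shift i b).
Proof. by case=> [|[E H]]; [left|right; split=> //; exact: elt_einc]. Qed.

Lemma vlt_shift1 i a : vlt a (shift i a).
Proof. by right; split=> //; exact: elt_einc1. Qed.

Lemma vlt_min (P : V -> Prop) : (exists a, P a) -> exists a, P a /\ forall b, P b -> ~ vlt b a.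
Proof.
move=> [[e0 j0] P0].
pose Q v := `[< exists e (j : 'I_n), j = v :> nat /\ P (e, j) >].
have exQ : exists v, Q v by exists j0; apply/asboolP; exists e0, j0.
case: (ex_minnP exQ) => v /asboolP[e1 [j [jv P1]]] vmin.
have [|e [Pe He]] := @elt_min (fun e => P (e, j)); first by exists e1.
exists (e, j); split=> // -[e' j'] P' [/= lt|[/= E lt]].
  have : (v <= j')%N by apply: vmin; apply/asboolP; exists e', j'.
  by rewrite leqNgt -jv lt.
by rewrite E in P'; exact: He P' lt.
Qed.

Lemma vlt_ind (P : V -> Prop) : (forall a, (forall b, vlt b a -> P b) -> P a) -> forall a, P a.
Proof.
move=> H a; apply: contrapT => nPa.
have [|b [nPb Hb]] := @vlt_min (fun a => ~ P a); first by exists a.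
by apply: nPb; apply: H => c cb; apply: contrapT => nPc; exact: Hb nPc cb.
Qed.

Lemma vlt_max (s : seq V) : s != [::] ->
  exists2 a, a \in s & forall b, b \in s -> b = a \/ vlt b a.
Proof.
elim: s => // a s IH _; have [->|/IH[b bs Hb]] := eqVneq s [::].
  by exists a; rewrite ?inE // => b; rewrite inE => /eqP; left.
case: (vlt_total a b) => [E|ab|ba].
- exists b; first by rewrite inE bs orbT.
  by move=> c; rewrite inE => /orP[/eqP ->|/Hb //]; left.
- exists b; first by rewrite inE bs orbT.
  by move=> c; rewrite inE => /orP[/eqP ->|/Hb //]; right.
- exists a; first by rewrite inE eqxx.
  move=> c; rewrite inE => /orP[/eqP ->|/Hb[->|cb]]; [by left|by right|right].
  exact: vlt_trans cb ba.
Qed.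

End Ranking.

Lemma rder_horner (m : nat) (R : dring m) i (p : {poly R}) x :
  rder i p.[x] = \sum_(k < size p) rder i p`_k * x ^+ k + p^`().[x] * rder i x.
Proof.
have H (r : {poly R}) l : (size r <= l)%N ->
  rder i r.[x] = \sum_(k < l) rder i r`_k * x ^+ k + r^`().[x] * rder i x.
  elim/poly_ind: r l => [l _|r c IH l].
    rewrite horner0 deriv0 horner0 mul0r addr0 big1 => [|k _]; rewrite ?coef0 ?rder0 ?mul0r //.
  case: l => [|l] sl.
    have E : r * 'X + c%:P = 0 by apply/eqP; rewrite -size_poly_leq0.
    by rewrite E big_ord0 horner0 deriv0 horner0 mul0r addr0 rder0.
  have sr : (size r <= l)%N.
    move: sl; rewrite size_MXaddC; case: ifP => [/andP[/eqP -> _]|_]; by rewrite ?size_poly0.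
  rewrite hornerMXaddC rderD rderM (IH l) // big_ord_recl coefD coefMX coefC /= add0r expr0 mulr1.
  rewrite derivD derivM derivX derivC mulr1 addr0 !hornerD !hornerM hornerX.
  under [X in _ = _ + X + _]eq_bigr => k _ do
    rewrite coefD coefMX coefC /= addr0 exprSr mulrA.
  by rewrite -mulr_suml; ring.
exact: H.
Qed.

Section DerField.
Variables (m : nat) (L : dfield m).
Implicit Types (x y : L).

Lemma der0 i : der i (0 : L) = 0. Proof. exact: (@rder0 m (dring_of L)). Qed.
Lemma der1 i : der i (1 : L) = 0. Proof. exact: (@rder1 m (dring_of L)). Qed.
Lemma derB i x y : der i (x - y) = der i x - der i y. Proof. exact: (@rderB m (dring_of L)). Qed.
Lemma der_div i x y : y != 0 -> der i (x / y) = (der i x * y - x * der i y) / y ^+ 2.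
Proof.
move=> y0; have := derM i (x / y) y; rewrite divfK // => ->.
by field.
Qed.

End DerField.

Section DE.
Variables (m n : nat) (L : dfield m).
Local Notation V := (dvar m 'I_n).
Implicit Types (base : L -> Prop) (z : 'I_n -> L).

Definition zz z (t : V) : L := rdop (R := dring_of L) t.1 (z t.2).

Definition below base z (t : V) (x : L) : Prop := base x \/ exists2 u, vlt u t & x = zz z u.

(* The t with DE base z t are the leaders of the prime differential ideal of z
   over the base. *)
Definition DE base z t : Prop := algov (sfgen (below base z t)) (zz z t).

Lemma DE_sub base base' z t : (forall x, base x -> sfgen base' x) -> DE base z t -> DE base' z t.
Proof.
move=> H; apply: algov_sub; apply: sfgen_sub => y [/H|[u ut ->]].
  by apply: sfgen_sub => {}y by_; apply: sfgen_gen; left.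
by apply: sfgen_gen; right; exists u.
Qed.

(** Differentiating a separable equation [p] of the leader expresses [p'(x) der i x] by terms of
    lower rank: proper derivatives of leaders are rational, not just algebraic, over what precedes
    them. *)
Lemma DE_rational base z i t : (forall i x, base x -> base (der i x)) ->
  DE base z t -> sfgen (below base z (shift i t)) (zz z (shift i t)).
Proof.
move=> bder [] q [q0 qN qx].
set N := sfgen (below base z t); set N' := sfgen (below base z (shift i t)).
have sN' : is_subf N' by exact: sfgen_subf.
have zzS u : zz z (shift i u) = der i (zz z u).
  exact: esym (@rder_rdop m (dring_of L) i u.1 (z u.2)).
have NN' x : N x -> N' x /\ N' (der i x).
  apply: (sfgen_min (M := fun x => N' x /\ N' (der i x))).
    split=> [|{}x y [x1 x2] [y1 y2]|{}x y [x1 x2] [y1 y2]].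
    - by rewrite der1; split; [exact: subf1 | exact: subf0].
    - by rewrite derB; split; apply: (subfB sN').
    - split; first exact: (subfV sN').
      have [->|y0] := eqVneq y 0; first by rewrite invr0 mulr0 der0; exact: subf0.
      rewrite der_div //; apply: (subfV sN') => //; last exact: (subfX _ sN').
      by apply: (subfB sN') => //; apply: (subfM sN').
  move=> y [by_|[u ut ->]].
    by split; apply: sfgen_gen; left => //; exact: bder.
  rewrite -zzS; split; apply: sfgen_gen; right.
    by exists u => //; apply: vlt_trans ut _; exact: vlt_shift1.
  by exists (shift i u) => //; exact: vlt_shift.
have [p [pN /eqP px dp]] : exists p : {poly L}, [/\ forall i, N p`_i, root p (zz z t) & p^`().[zz z t] != 0].
  by apply: min_sep_poly (dchar0 L) (sfgen_subf _) _; exists q.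
have Nz : N' (zz z t) by apply: sfgen_gen; right; exists t => //; exact: vlt_shift1.
have := @rder_horner m (dring_of L) i p (zz z t); rewrite /rder /=; rewrite px der0 => /esym/eqP.
rewrite addrC addr_eq0 => /eqP E.
have -> : zz z (shift i t) = (- \sum_(k < size p) der i p`_k * zz z t ^+ k) / p^`().[zz z t].
  by rewrite -E zzS mulrC mulKf.
apply: (subfV sN').
  apply: (subfN sN'); apply: (subf_sum _ sN') => // k _; apply: (subfM sN') => //; last exact: (subfX _ sN').
  exact: (NN' _ (pN k)).2.
rewrite horner_coef; apply: (subf_sum _ sN') => // k _; apply: (subfM sN') => //; last exact: (subfX _ sN').
by rewrite coef_deriv; apply: (subfMn _ sN') => //; exact: (NN' _ (pN _)).1.
Qed.

Lemma DE_up base z i t : (forall i x, base x -> base (der i x)) ->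
  DE base z t -> DE base z (shift i t).
Proof. by move=> bd H; apply: algov_id; [exact: sfgen_subf | exact: DE_rational]. Qed.

(** The highest variable [t] of [s] is transcendental over what precedes it, so all coefficients of
    [g] in [t] vanish at [z]; descending, [g] is a combination of relations in [V0] alone, which
    [psi] kills. [psi] is the identity in proofs of independence and the evaluation at another point
    in [DE_equation]. *)
Lemma peel (R S : comNzRingType) (f : {rmorphism R -> L}) base z
    (psi : {rmorphism pol R V -> S}) (V0 : V -> Prop) (s : seq V) g :
  (forall r, base (f r)) ->
  (forall t, t \in s -> ~ DE base z t) ->
  (forall u t, V0 u -> t \in s -> vlt u t) ->
  (forall c, pin V0 c -> pev f (zz z) c = 0 -> psi c = 0) ->
  pin (fun u => V0 u \/ u \in s) g -> pev f (zz z) g = 0 -> psi g = 0.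
Proof.
move=> bf; move: {2}(size s) (leqnn (size s)) => N.
elim: N s g => [|N IH] s g sN nDE V0s Hpsi Hg g0.
  move: sN; rewrite leqn0 => /nilP E; apply: Hpsi => //.
  by apply: pin_sub Hg => u []//; rewrite E.
have [E|/vlt_max[t ts tmax]] := eqVneq s [::].
  by apply: Hpsi => //; apply: pin_sub Hg => u []//; rewrite E.
pose s' := filter (predC1 t) s.
have ss' u : u \in s' -> u \in s by rewrite mem_filter => /andP[].
have szs' : (size s' <= N)%N.
  rewrite -ltnS; apply: leq_trans sN; rewrite size_filter -(count_predC (pred1 t) s).
  by rewrite -[ltnLHS]add0n ltn_add2r -has_count has_pred1.
have tc i : pin (fun u => V0 u \/ u \in s') (tau t g)`_i.
  apply: pin_sub (tau_pin t i Hg) => u [[V0u|us] /eqP ut]; [by left|right].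
  by rewrite mem_filter /= ut us.
have low u : V0 u \/ u \in s' -> vlt u t.
  case=> [V0u|]; first exact: V0s.
  by rewrite mem_filter /= => /andP[/eqP ut /tmax[]].
have P0 : map_poly (pev f (zz z)) (tau t g) = 0.
  apply: contrapT => /eqP P0; apply: (nDE t ts); exists (map_poly (pev f (zz z)) (tau t g)).
  split=> //; last by rewrite /root -pev_tau g0.
  move=> i; rewrite coef_map.
  have := @pin_gens R _ (dcar L) f (zz z) _ _ (tc i).
  apply: sfgen_sub => y [[r ->]|[u /low ut ->]]; apply: sfgen_gen; [left|right].
    exact: bf.
  by exists u.
rewrite -(tauK t g) horner_coef rmorph_sum big1 // => i _.
rewrite rmorphM (IH s') ?mul0r //.
- by move=> u /ss'; exact: nDE.
- by move=> u v V0u /ss'; exact: V0s.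
- by have := congr1 (fun p : {poly L} => p`_i) P0; rewrite coef_map coef0.
Qed.

(** If [t] in [D] were a leader, every variable up to [t] would be algebraic over the members of [D]
    below [t], by induction on the ranking; this contradicts the independence of [D]. *)
Lemma not_DE_indep (R : comNzRingType) (f : {rmorphism R -> L}) base z (D : V -> Prop) :
  (forall x, base x <-> exists r, x = f r) ->
  (forall s : pol R V, pin D s -> pev f (zz z) s = 0 -> s = 0) ->
  (forall t, ~ D t -> DE base z t) -> forall t, D t -> ~ DE base z t.
Proof.
move=> bf Dind ED t Dt DEt.
pose T u := D u /\ vlt u t.
pose M := algov (sfgen (@gens R _ (dcar L) f (zz z) T)).
have sG : is_subf (sfgen (@gens R _ (dcar L) f (zz z) T)) by exact: sfgen_subf.
have sM : is_subf M by exact: algov_subf.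
have below_M u : (forall v, vlt v u -> M (zz z v)) -> forall y, sfgen (below base z u) y -> M y.
  move=> H; apply: sfgen_min => // y [/bf[r ->]|[v vu ->]]; last exact: H.
  by apply: algov_id => //; apply: sfgen_gen; left; exists r.
have lowM u : vlt u t -> M (zz z u).
  elim/vlt_ind: u => u IH ut.
  have [Du|nDu] := pselect (D u).
    by apply: algov_id => //; apply: sfgen_gen; right; exists u.
  apply: algov_trans => //; apply: algov_sub (ED u nDu); apply: below_M => v vu.
  by apply: IH => //; exact: vlt_trans vu ut.
have Mt : M (zz z t) by apply: algov_trans => //; apply: algov_sub DEt; exact: below_M.
move/algov_gens: Mt => [P [TP P0 Pz]].
have g0 : P.[pX t] = 0.
  apply: Dind.
    by apply: pin_horner => // i; apply: pin_sub (TP i) => u [].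
  by move: Pz; rewrite /root -(mpevX malg_theory f (zz z) t) horner_map => /eqP.
have := @tau_horner R V t P; rewrite g0 rmorph0 => E; move: P0.
rewrite -E ?rmorph0 ?eqxx // => i; apply: pin_sub (TP i) => u [_ ut] ut'.
by rewrite ut' in ut; exact: vlt_irr ut.
Qed.

End DE.

Lemma algov_transport (R : comNzRingType) (V : choiceType) (L1 L2 : fieldType)
    (f1 : {rmorphism R -> L1}) (f2 : {rmorphism R -> L2}) w1 w2 (T : V -> Prop) k :
  (forall p, pin (fun u => T u \/ u = k) p -> pev f1 w1 p = 0 <-> pev f2 w2 p = 0) ->
  algov (sfgen (gens f1 w1 T)) (w1 k) -> algov (sfgen (gens f2 w2 T)) (w2 k).
Proof.
move=> H /algov_gens[P [TP P0 Pw]]; apply/algov_gens; exists P; split=> //.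
  apply: contra_neq P0 => E; apply/polyP => i; rewrite coef_map coef0; apply/H.
    by apply: pin_sub (TP i) => u; left.
  by have := congr1 (fun p : {poly L2} => p`_i) E; rewrite coef_map coef0.
move: Pw; rewrite /root -(mpevX malg_theory f1 w1 k) -(mpevX malg_theory f2 w2 k) !horner_map.
move=> /eqP/H E; apply/eqP/E.
by apply: pin_horner; [move=> i; apply: pin_sub (TP i) => u; left | right].
Qed.

(** * Independent extensions *)

Lemma pin_list (R : comNzRingType) (V : choiceType) (D : V -> Prop) (p : pol R V) :
  pin D p -> exists s : seq V, (forall t, t \in s -> D t) /\ pin (fun k => k \in s) p.
Proof.
elim=> [c|k Dk|a b _ [s1 [D1 H1]] _ [s2 [D2 H2]]|a b _ [s1 [D1 H1]] _ [s2 [D2 H2]]].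
- by exists [::]; split=> //; exact: pinC.
- by exists [:: k]; split=> [t|]; [rewrite inE => /eqP -> | apply: pinX; rewrite inE].
- exists (s1 ++ s2); split=> [t|]; first by rewrite mem_cat => /orP[/D1|/D2].
  by apply: pinD; [apply: pin_sub H1 => k | apply: pin_sub H2 => k]; rewrite mem_cat => ->; rewrite ?orbT.
- exists (s1 ++ s2); split=> [t|]; first by rewrite mem_cat => /orP[/D1|/D2].
  by apply: pinM; [apply: pin_sub H1 => k | apply: pin_sub H2 => k]; rewrite mem_cat => ->; rewrite ?orbT.
Qed.

Lemma dev_ext (m : nat) (R S : dring m) (J : choiceType) (f : dhom R S) (v v' : J -> S) p :
  (forall j, v j = v' j) -> dev f v p = dev f v' p.
Proof. by move=> E; apply: pev_pin (pin_all p) => k _; rewrite E. Qed.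

Lemma frac_lift (m : nat) (R : dring m) (k M : dfield m) (phi : dhom R (dring_of k))
    (psi : dhom R (dring_of M)) :
  (forall z : k, exists a b, phi b <> 0 /\ z = phi a / phi b :> k) ->
  (forall x, phi x = 0 <-> psi x = 0) ->
  exists i : dembed k M, forall x, i (phi x) = psi x.
Proof.
move=> fr ker.
have N z : exists ab : R * R, phi ab.2 <> 0 /\ z = phi ab.1 / phi ab.2 :> k.
  by have [a [b H]] := fr z; exists (a, b).
pose g z := sval (cid (N z)).
have g0 z : phi (g z).2 != 0 by apply/eqP; case: (svalP (cid (N z))).
have gE z : z = phi (g z).1 / phi (g z).2 :> k by case: (svalP (cid (N z))).
have ne x : phi x != 0 -> psi x != 0 by apply: contra_neq => /ker.
have p0 z : psi (g z).2 != 0 by exact: ne (g0 z).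
pose i (z : k) : M := psi (g z).1 / psi (g z).2.
have iE a b : phi b != 0 -> i (phi a / phi b) = psi a / psi b.
  move=> b0; set z := _ / _; rewrite /i; apply/eqP; rewrite eqr_div ?ne //.
  rewrite -!rmorphM -subr_eq0 -rmorphB; apply/eqP/ker; rewrite rmorphB !rmorphM.
  by apply/eqP; rewrite subr_eq0 -eqr_div // -gE.
have iB : zmod_morphism i.
  move=> x y; rewrite (gE x) (gE y).
  have -> : phi (g x).1 / phi (g x).2 - phi (g y).1 / phi (g y).2 =
    phi ((g x).1 * (g y).2 - (g y).1 * (g x).2) / phi ((g x).2 * (g y).2) :> k.
    by rewrite rmorphB !rmorphM /=; field; rewrite !g0.
  rewrite !iE ?rmorphM ?mulf_neq0 // !rmorphB !rmorphM /=.
  by field; rewrite !p0.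
have iM : monoid_morphism i.
  split=> [|x y].
    by rewrite -(divr1 1) -(rmorph1 phi) iE ?rmorph1 ?oner_neq0 // divr1.
  rewrite (gE x) (gE y).
  have -> : phi (g x).1 / phi (g x).2 * (phi (g y).1 / phi (g y).2) =
    phi ((g x).1 * (g y).1) / phi ((g x).2 * (g y).2) :> k.
    by rewrite !rmorphM /=; field; rewrite !g0.
  rewrite !iE ?rmorphM ?mulf_neq0 //=.
  by field; rewrite !p0.
pose h1 := GRing.isZmodMorphism.Build k M i iB.
pose h2 := GRing.isMonoidMorphism.Build k M i iM.
pose i' : {rmorphism k -> M} := HB.pack i h1 h2.
have iphi x : i (phi x) = psi x.
  by rewrite -[phi x]divr1 -(rmorph1 phi) iE ?rmorph1 ?oner_neq0 // divr1.
have ider j x : i' (der j x) = der j (i' x).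
  have dphi y : der j (phi y) = phi (rder j y) by exact: esym (dhom_der phi j y).
  have dpsi y : der j (psi y) = psi (rder j y) by exact: esym (dhom_der psi j y).
  rewrite /i' /= (gE x) iE // !der_div // !dphi !dpsi.
  have -> a b c d : (phi a * phi b - phi c * phi d) / phi b ^+ 2 = phi (a * b - c * d) / phi (b ^+ 2) :> k.
    by rewrite rmorphXn rmorphB !rmorphM.
  rewrite iE; last by rewrite rmorphXn expf_neq0.
  by rewrite rmorphXn rmorphB !rmorphM.
by exists (DEmbed ider).
Qed.

Section Lists.
Variable m : nat.
Implicit Types (K L : dfield m).

Definition int_hom (R : dring m) : dhom (int_dring m) R :=
  @DHom m (int_dring m) R (intmul 1) (fun i z => esym (etrans (rder_int R i z) (esym (mulr0z 1)))).

Local Notation ZY := (dpol (int_dring m) nat).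

Definition ev L (e : seq L) : dhom ZY (dring_of L) := dev (int_hom (dring_of L)) (nth (0 : L) e).

(** Equality of quantifier-free types over the integers, for tuples in possibly different fields.
    Parameters are just further entries of the lists, and an entry past the end is 0. *)
Definition qfeq L1 L2 (e1 : seq L1) (e2 : seq L2) : Prop :=
  forall p, ev e1 p = 0 <-> ev e2 p = 0.

Lemma qfeq_sub L1 L2 (e1 : seq L1) (e2 : seq L2) (e1' : seq L1) (e2' : seq L2) (sigma : nat -> ZY) :
  (forall k, e1'`_k = ev e1 (sigma k)) -> (forall k, e2'`_k = ev e2 (sigma k)) ->
  qfeq e1 e2 -> qfeq e1' e2'.
Proof.
move=> H1 H2 H p.
have E L (e e' : seq L) : (forall k, e'`_k = ev e (sigma k)) -> ev e' p = ev e (dev (int_hom ZY) sigma p).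
  move=> He; rewrite (@dhom_dev m (int_dring m) ZY (dring_of L) nat (int_hom ZY) sigma (ev e) (int_hom _)); last first.
    by move=> c; rewrite /= rmorph_int.
  by apply: dev_ext => k; rewrite He.
by rewrite (E L1 e1) // (E L2 e2).
Qed.

(** Not the definable closure: this is a base closed under [der], as [DE_rational] requires, and the
    subfield it generates is the differential field generated by [A]. *)
Definition dcl L (A : L -> Prop) (x : L) : Prop := exists u e, A u /\ x = rdop (R := dring_of L) e u.

Lemma dcl_der L (A : L -> Prop) i x : dcl A x -> dcl A (der i x).
Proof. by move=> [u [e [Au ->]]]; exists u, (einc e i); split=> //; exact: (@rder_rdop m (dring_of L)). Qed.

Lemma dcl_sub L (A B : L -> Prop) x : (forall y, A y -> B y) -> dcl A x -> dcl B x.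
Proof. by move=> H [u [e [Au ->]]]; exists u, e; split=> //; exact: H. Qed.

Section DEList.
Variables (n : nat) (L : dfield m) (t : n.-tuple L) (e : seq L) (u : dvar m 'I_n).

Definition wl (k : dvar m nat) : L := rdop (R := dring_of L) k.1 (nth 0 (t ++ e) k.2).
Definition Tl (k : dvar m nat) : Prop := (exists2 j : 'I_n, j = k.2 :> nat & vlt ((k.1, j) : dvar m 'I_n) u) \/ (n <= k.2)%N.

Lemma wl_zz (v : dvar m 'I_n) : wl (v.1, v.2 : nat) = zz (tnth t) v.
Proof. by rewrite /wl /zz /= nth_cat size_tuple ltn_ord -tnth_nth. Qed.

(** A form of [DE] in which only polynomials over the integers in the entries of [t ++ e] and their
    derivatives appear, so that [qfeq] preserves it. *)
Lemma DE_list : DE (dcl (fun x => x \in e)) (tnth t) u <->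
  algov (sfgen (@gens int _ (dcar L) (intmul 1) wl Tl)) (wl (u.1, u.2 : nat)).
Proof.
rewrite wl_zz /DE; split; apply: algov_sub; apply: sfgen_sub => x.
  case=> [[y [f [ye ->]]]|[v vu ->]]; apply: sfgen_gen; right.
    have /(nthP 0)[i ie <-] := ye.
    exists (f, n + i)%N; first by right; exact: leq_addr.
    by rewrite /wl /= nth_cat size_tuple ltnNge leq_addr /= addnC addnK.
  exists (v.1, v.2 : nat); last by rewrite wl_zz.
  by left; exists v.2 => //; case: v vu.
case=> [[r ->]|[k Tk ->]].
  have S := @sfgen_subf L (below (dcl (fun x => x \in e)) (tnth t) u).
  case: r => l; rewrite ?NegzE ?mulrNz; [|apply: (subfN S)]; apply: (subfMn _ S); exact: (subf1 S).
case: Tk => [[j jk ju]|nk].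
  apply: sfgen_gen; right; exists (k.1, j) => //.
  by rewrite -wl_zz /= jk; case: (k).
have [lt|le] := ltnP (k.2 - n) (size e).
  apply: sfgen_gen; left; exists (nth 0 e (k.2 - n)), k.1; split; first exact: mem_nth.
  by rewrite /wl nth_cat size_tuple ltnNge nk.
rewrite /wl nth_cat size_tuple ltnNge nk /= nth_default //.
have -> : rdop (R := dring_of L) k.1 0 = 0.
  elim/e_ind: (k.1) => [|f i IH]; first by rewrite rdop0.
  by rewrite -rder_rdop IH rder0.
exact: subf0 (sfgen_subf _).
Qed.
End DEList.

Lemma DE_qfeq n L1 L2 (t1 : n.-tuple L1) (t2 : n.-tuple L2) (e1 : seq L1) (e2 : seq L2) u :
  qfeq (t1 ++ e1) (t2 ++ e2) ->
  DE (dcl (fun x => x \in e1)) (tnth t1) u -> DE (dcl (fun x => x \in e2)) (tnth t2) u.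
Proof.
move=> H /DE_list HH; apply/DE_list; move: HH.
apply: algov_transport => p _; exact: H.
Qed.

(** The type of [t0] over [e] is moved to [e'] and extended to [U] without new leaders. With [k] the
    differential field generated by [e], the non-leaders [D] of [t0] are independent over [k] by
    [peel]; [amalgam] keeps them independent over [U], and [not_DE_indep] then excludes them from
    the leaders over [U]. *)
Lemma independent_extension n (M U : dfield m) (e : seq M) (e' : seq U) (t0 : n.-tuple M) :
  qfeq e e' ->
  exists (L : dfield m) (h : dembed U L) (t : n.-tuple L),
    qfeq (t0 ++ e) (t ++ map h e') /\
    forall u, DE (dcl (fun x => x \in e)) (tnth t0) u <-> DE (fun x => exists y, x = h y) (tnth t) u.
Proof.
move=> qe.
have [||||||k [phi [ker fr]]] := @prime_dfrac m ZY (fun p => ev e p = 0).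
- exact: rmorph0.
- by move=> l; rewrite rmorph_nat => /eqP; have/pcharf0P -> := dchar0 M.
- by move=> x y x0 y0; rewrite rmorphD x0 y0 addr0.
- by move=> x y x0; rewrite rmorphM x0 mulr0.
- by move=> x y; rewrite rmorphM => /eqP; rewrite mulf_eq0 => /orP[]/eqP; [left|right].
- by move=> i x x0; rewrite dhom_der x0 rder0.
have [i0 i0E] := frac_lift fr ker.
have [i iE] : exists i : dembed k U, forall x, i (phi x) = ev e' x.
  by apply: frac_lift => // x; rewrite ker; exact: qe.
pose D u := ~ DE (dcl (fun x => x \in e)) (tnth t0) u.
pose base0 (x : M) := exists r, x = i0 r.
have base0_e x : base0 x -> sfgen (dcl (fun x => x \in e)) x.
  move=> [r ->]; have [a [b [_ ->]]] := fr r; rewrite fmorph_div !i0E.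
  have G (p : ZY) : sfgen (dcl (fun x => x \in e)) (ev e p).
    have := @pin_gens int _ (dcar M) (intmul 1) (fun k => rdop (R := dring_of M) k.1 (nth 0 e k.2)) _ _ (pin_all p).
    apply: sfgen_sub => y [[z ->]|[l _ ->]].
      have S := @sfgen_subf M (dcl (fun x => x \in e)).
      case: z => l; rewrite ?NegzE ?mulrNz; [|apply: (subfN S)]; apply: (subfMn _ S); exact: (subf1 S).
    have [lt|le] := ltnP l.2 (size e).
      by apply: sfgen_gen; exists (nth 0 e l.2), l.1; split=> //; exact: mem_nth.
    rewrite nth_default //.
    have -> : rdop (R := dring_of M) l.1 0 = 0.
      elim/e_ind: (l.1) => [|f j IH]; first by rewrite rdop0.
      by rewrite -rder_rdop IH rder0.
    exact: subf0 (sfgen_subf _).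
  exact: (subfV (sfgen_subf _)).
have ind (p : dpol (dring_of k) 'I_n) : pin D p -> dev (dhom_of i0) (tnth t0) p = 0 -> p = 0.
  move=> /pin_list[s [Ds sp]] p0.
  apply: (@peel m n M k _ i0 base0 (tnth t0) idfun (fun=> False) s p) => //.
  - by move=> r; exists r.
  - by move=> v /Ds Dv /(DE_sub base0_e).
  - move=> c /pin_none[a ->]; rewrite mpevC => /eqP; rewrite fmorph_eq0 => /eqP ->.
    by rewrite rmorph0.
  - by apply: pin_sub sp => v; right.
have [L [h [z [Hz Dz]]]] := amalgam i ind.
exists L, h, (mktuple z).
have tz : tnth (mktuple z) = z by apply: funext => j; rewrite tnth_mktuple.
have qf : qfeq (t0 ++ e) (mktuple z ++ map h e').
  pose kap j : k := phi (dY (int_dring m) j).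
  pose sg (j : nat) : dpol (dring_of k) 'I_n :=
    if insub j is Some l then dY _ l else pC (kap (j - n)%N).
  have E (N : dfield m) (g : dembed k N) (w : 'I_n -> N) (t : n.-tuple N) (f : seq N) p :
     (forall j, tnth t j = w j) -> (forall j, g (kap j) = f`_j) ->
     dev (dhom_of g) w (dev (int_hom _) sg p) = ev (t ++ f) p.
    move=> tw gf; rewrite (dhom_dev _ (g := int_hom (dring_of N))); last by move=> c; rewrite /= rmorph_int.
    apply: dev_ext => j.
    rewrite nth_cat size_tuple /sg; case: insubP => [l jn lj|].
      by rewrite jn devY -lj -tw -tnth_nth.
    by rewrite -leqNgt ltnNge => ->; rewrite /= devC -gf.
  move=> p; rewrite -(E M i0 (tnth t0)) // => [|j]; last first.
    by rewrite /kap i0E /ev devY.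
  rewrite Hz (E L _ _ (mktuple z) (map h e')) // => j; first by rewrite tz.
  rewrite /kap /= iE /ev devY.
  have [lt|le] := ltnP j (size e'); first by rewrite (nth_map 0).
  by rewrite !nth_default ?size_map ?rmorph0.
split=> // u; split.
  move/(DE_qfeq qf); apply: DE_sub => x [y [f [/mapP[y' _ ->] ->]]].
  apply: sfgen_gen; exists (rdop (R := dring_of U) f y').
  exact: esym (dhom_rdop (dhom_of h) f y').
move=> DEu; apply: contrapT => Du; move: DEu; rewrite tz.
apply: (@not_DE_indep m n L U h _ z D) => // v; rewrite /D => /contrapT.
move/(DE_qfeq qf); rewrite tz; apply: DE_sub => x [y [f [/mapP[y' _ ->] ->]]].
apply: sfgen_gen; exists (rdop (R := dring_of U) f y').
exact: esym (dhom_rdop (dhom_of h) f y').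
Qed.

End Lists.

(** * Quantifier elimination *)

Section Saturated.
Variables (m : nat) (kappa : Type) (U : dfield m).
Hypothesis hU : dclosed_field U.
Hypothesis hsat : saturated kappa U.
Hypothesis hfin : forall s : seq U, small kappa (fun x => x \in s).

Local Notation ZY := (dpol (int_dring m) nat).

Definition id_hom (R : dring m) : dhom R R := @DHom m R R idfun (fun _ _ => erefl).

Lemma ev_holds (e : seq U) p : dholds e (FEq0 p) <-> ev e (of_malg malg_theory p) = 0.
Proof.
by rewrite -(@deval_dev m nat U (int_dring m) (int_hom (dring_of U))).
Qed.

Lemma ev_holds_to (e : seq U) (p : ZY) : dholds e (FEq0 (to_malg p)) <-> ev e p = 0.
Proof.
by rewrite -(@deval_to m nat U (int_dring m) (int_hom (dring_of U))).
Qed.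

(** Passes between the two encodings of parameters: entries of a list after the first [n], and
    coefficients in [U]. *)
Definition subl n (e : seq U) : dhom ZY (dpol (dring_of U) 'I_n) :=
  dev (int_hom _) (fun j => if insub j is Some l then dY (dring_of U) l
    else mpC malg_theory (dring_of U) (dvar m 'I_n) e`_(j - n)).

Lemma sublE n (e : seq U) (L : dfield m) (h : dhom (dring_of U) (dring_of L)) (t : n.-tuple L) p :
  dev h (tnth t) (subl n e p) = ev (t ++ map h e) p.
Proof.
rewrite /subl (dhom_dev _ (g := int_hom (dring_of L))); last by move=> c; rewrite /= rmorph_int.
apply: dev_ext => j; rewrite nth_cat size_tuple; case: insubP => [l jn lj|].
  by rewrite jn devY -lj -tnth_nth.
rewrite -leqNgt ltnNge => ->; rewrite /= devC.
have [lt|le] := ltnP (j - n) (size e); first by rewrite (nth_map 0).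
by rewrite !nth_default ?size_map ?rmorph0.
Qed.

(** Each finite part of the quantifier-free type of [t] over [e] is solvable in [U] because [U] is
    existentially closed; saturation solves all of it at once. *)
Lemma realize n (L : dfield m) (h : dembed U L) (t : n.-tuple L) (e : seq U) :
  exists t' : n.-tuple U, qfeq (t' ++ e) (t ++ map h e).
Proof.
pose Sigma phi b := b = e /\ exists p : ZY,
  (phi = FEq0 (to_malg p) /\ ev (t ++ map h e) p = 0) \/
  (phi = FNot (FEq0 (to_malg p)) /\ ev (t ++ map h e) p <> 0).
have [] := @hsat _ (@hfin e) n Sigma.
- by move=> phi b [-> _] x.
- move=> l phi b Sig.
  have Sp i : exists p : ZY, (phi i = FEq0 (to_malg p) /\ ev (t ++ map h e) p = 0) \/
    (phi i = FNot (FEq0 (to_malg p)) /\ ev (t ++ map h e) p <> 0) by case: (Sig i).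
  pose p i := sval (cid (Sp i)).
  have pP i : (phi i = FEq0 (to_malg (p i)) /\ ev (t ++ map h e) (p i) = 0) \/
    (phi i = FNot (FEq0 (to_malg (p i))) /\ ev (t ++ map h e) (p i) <> 0) by exact: svalP (cid (Sp i)).
  pose Z i := `[< ev (t ++ map h e) (p i) = 0 >].
  pose eqs : seq (dpoly U m 'I_n) := [seq to_malg (subl n e (p i)) | i <- enum 'I_l & Z i].
  pose neqs : seq (dpoly U m 'I_n) := [seq to_malg (subl n e (p i)) | i <- enum 'I_l & ~~ Z i].
  have D (K : dfield m) (g : dhom (dring_of U) (dring_of K)) (a : n.-tuple K) q :
      deval g (tnth a) (to_malg (subl n e q)) = ev (a ++ map g e) q.
    rewrite (@deval_to m 'I_n K (dring_of U) g); exact: sublE.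
  have [|a [Ha1 Ha2]] := @hU L h n eqs neqs.
    exists (tnth t); split=> q /mapP[i]; rewrite mem_filter => /andP[Zi _] ->.
      by rewrite (D L (dhom_of h)); move/asboolP: Zi.
    by rewrite (D L (dhom_of h)); move/asboolP: Zi.
  have ta : tnth (mktuple a) = a by apply: funext => j; rewrite tnth_mktuple.
  exists (mktuple a) => i; have [-> _] := Sig i.
  have E : ev (mktuple a ++ e) (p i) = deval idfun a (to_malg (subl n e (p i))).
    by rewrite -{2}ta (D U (id_hom _)) map_id.
  case: (pP i) => -[-> H].
    apply/ev_holds_to; rewrite E; apply: Ha1; apply/mapP; exists i => //.
    by rewrite mem_filter mem_enum andbT; apply/asboolP.
  move=> /ev_holds_to; rewrite E; apply: Ha2; apply/mapP; exists i => //.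
  by rewrite mem_filter mem_enum andbT; apply/asboolP.
move=> t' Ht'; exists t' => p; split=> H.
  apply: contrapT => H'; apply: (Ht' (FNot (FEq0 (to_malg p))) e); last exact/ev_holds_to.
  by split=> //; exists p; right.
by apply/ev_holds_to; apply: Ht'; split=> //; exists p; left.
Qed.

Lemma qfeq_sym (L1 L2 : dfield m) (e : seq L1) (e' : seq L2) : qfeq e e' -> qfeq e' e.
Proof. by move=> H p; split=> /H. Qed.

Lemma qfeq_trans (L1 L2 L3 : dfield m) (e1 : seq L1) (e2 : seq L2) (e3 : seq L3) :
  qfeq e1 e2 -> qfeq e2 e3 -> qfeq e1 e3.
Proof. by move=> H H' p; rewrite H. Qed.

Lemma qfeq_ext (e e' : seq U) x : qfeq e e' -> exists x', qfeq (x :: e) (x' :: e').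
Proof.
move=> H; have [L [h [t [Ht _]]]] := independent_extension [tuple x] H.
have [t' Ht'] := realize h t e'.
case/tupleP: t' Ht' => x' t'; rewrite (tuple0 t') => Ht'.
by exists x'; apply: qfeq_trans Ht (qfeq_sym Ht').
Qed.

(** Back and forth: [qfeq_ext] matches the witness of an existential quantifier on the other
    side. *)
Lemma qfeq_holds (phi : dformula m) (e e' : seq U) : qfeq e e' -> dholds e phi <-> dholds e' phi.
Proof.
have dir k psi (e1 e2 : seq U) : (forall e e' : seq U, qfeq e e' -> dholds e psi <-> dholds e' psi) ->
    qfeq e1 e2 -> dholds e1 (FEx k psi) -> dholds e2 (FEx k psi).
  move=> IH H [x Hx]; have [x' Hx'] := qfeq_ext x H.
  have Hq : qfeq (set_nth 0 e1 k x) (set_nth 0 e2 k x').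
    apply: (qfeq_sub (sigma := fun j => if j == k then dY _ 0%N else dY _ j.+1)) Hx' => j;
      by rewrite nth_set_nth /=; case: eqP => _; rewrite /ev devY.
  by exists x'; apply/(IH _ _ Hq).
elim: phi e e' => [p|phi IH|phi1 IH1 phi2 IH2|k phi IH] e e' H.
- by rewrite !ev_holds.
- by rewrite /= (IH e e').
- by rewrite /= (IH1 e e') // (IH2 e e').
- by split; apply: dir => //; exact: qfeq_sym.
Qed.

End Saturated.

(** * A pigeonhole principle for prime differential ideals *)

Definition inf_set (A : nat -> Prop) : Prop := forall N, exists2 j, (N <= j)%N & A j.

Lemma inf_split (A B C : nat -> Prop) : inf_set A -> (forall j, A j -> B j \/ C j) ->
  inf_set (fun j => A j /\ B j) \/ inf_set (fun j => A j /\ C j).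
Proof.
move=> iA ABC; apply: contrapT => /not_orP[/existsNP[N1 H1] /existsNP[N2 H2]].
have [j Nj Aj] := iA (maxn N1 N2).
case: (ABC j Aj) => Hj; [apply: H1|apply: H2]; exists j => //.
  exact: leq_trans (leq_maxl _ _) Nj.
exact: leq_trans (leq_maxr _ _) Nj.
Qed.

Section PseudoDiv.
Variables (W : comNzRingType) (Rp : W -> Prop).
Hypotheses (Rp1 : Rp 1) (RpB : forall x y, Rp x -> Rp y -> Rp (x - y))
  (RpM : forall x y, Rp x -> Rp y -> Rp (x * y)).

Lemma Rp0 : Rp 0. Proof. by rewrite -(subrr 1); apply: RpB. Qed.
Lemma RpD x y : Rp x -> Rp y -> Rp (x + y).
Proof. by move=> Hx Hy; rewrite -[y]opprK -[- y]sub0r; apply/RpB/RpB => //; exact: Rp0. Qed.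
Lemma RpX x k : Rp x -> Rp (x ^+ k).
Proof. by move=> Hx; elim: k => [|k IH]; rewrite ?expr0 ?exprS //; apply: RpM. Qed.

Definition polyRp (p : {poly W}) := forall i, Rp p`_i.

(** The bound on the size of [q] is recorded because the induction in [pigeonhole] passes from [f]
    to the quotient. *)
Lemma pseudo_div (f g : {poly W}) : polyRp f -> polyRp g -> g != 0 ->
  exists e q r, [/\ lead_coef g ^+ e *: f = q * g + r, (size r < size g)%N,
    polyRp q /\ polyRp r & q = 0 \/ (size q + size g <= (size f).+1)%N].
Proof.
move=> + Rg g0; move: {2}(size f) (leqnn (size f)) => N.
have sg : (0 < size g)%N by rewrite size_poly_gt0.
elim: N f => [|N IH] f sf Rf.
  exists 0%N, 0, f; rewrite expr0 scale1r mul0r add0r; split=> //; last by left.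
    exact: leq_ltn_trans sf sg.
  by split=> // i; rewrite coef0; exact: Rp0.
have [lt|le] := ltnP (size f) (size g).
  exists 0%N, 0, f; rewrite expr0 scale1r mul0r add0r; split=> //; last by left.
  by split=> // i; rewrite coef0; exact: Rp0.
pose k := (size f - size g)%N.
pose f' := lead_coef g *: f - (lead_coef f *: 'X^k) * g.
have cf i : f'`_i = lead_coef g * f`_i - lead_coef f * (if (i < k)%N then 0 else g`_(i - k)).
  by rewrite /f' coefB coefZ -scalerAl coefZ coefXnM.
have Rf' : polyRp f'.
  move=> i; rewrite cf; apply: RpB; first by apply: RpM; [exact: Rg|exact: Rf].
  by apply: RpM; [exact: Rf | case: ifP => _; [exact: Rp0|exact: Rg]].
have sf'' : (size f' <= (size f).-1)%N.
  apply/leq_sizeP => i sfi; rewrite cf.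
  have ki : (i < k)%N = false.
    apply/negbTE; rewrite -leqNgt; apply: leq_trans sfi; rewrite /k.
    by rewrite -subn1 leq_sub2l.
  rewrite ki; move: sfi; rewrite leq_eqVlt => /orP[/eqP E|lt].
    rewrite -E /k /lead_coef mulrC.
    suff -> : ((size f).-1 - (size f - size g) = (size g).-1)%N by rewrite subrr.
    by move: sg le; case: (size g) => // a _; case: (size f) => // b; rewrite ltnS /= subSS => ab; rewrite subKn.
  have fi : (size f <= i)%N by rewrite -(ltn_predK (leq_trans sg le)).
  rewrite !nth_default ?mulr0 ?subr0 //.
  by rewrite leq_subRL ?(leq_trans _ fi) ?leq_subr // /k addnC subnKC.
have sf' : (size f' <= N)%N by apply: leq_trans sf'' _; rewrite -ltnS prednK // (leq_trans sg le).
have [e [q [r [E sr [Rq Rr] sq]]]] := IH f' sf' Rf'.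
exists e.+1, (q + lead_coef g ^+ e *: (lead_coef f *: 'X^k)), r; split=> //.
- have gen (l : W) (F Q G S H : {poly W}) : l ^+ e *: (l *: F - H * G) = Q * G + S ->
      l ^+ e.+1 *: F = (Q + l ^+ e *: H) * G + S.
    by move=> E'; rewrite mulrDl addrAC -E' scalerBr -scalerAl scalerA -exprSr subrK.
  exact: gen E.
- split=> // i; rewrite coefD coefZ coefZ coefXn; apply: RpD; first exact: Rq.
  apply: RpM; first by apply: RpX; exact: Rg.
  apply: RpM; first exact: Rf.
  by case: eqP => _; [exact: Rp1 | exact: Rp0].
- right; have sk : (k.+1 + size g = (size f).+1)%N by rewrite /k addSn subnK.
  rewrite -sk leq_add2r; apply: leq_trans (size_polyD _ _) _; rewrite geq_max; apply/andP; split.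
    case: sq => [->|sq]; first by rewrite size_poly0.
    rewrite -(leq_add2r (size g)) sk; apply: leq_trans sq _.
    by rewrite ltnS (leq_trans sf'') // leq_pred.
  apply: leq_trans (size_scale_leq _ _) _; apply: leq_trans (size_scale_leq _ _) _.
  by rewrite size_polyXn.
Qed.

End PseudoDiv.

Section Pigeonhole.
Variables (W : comNzRingType) (Rp : W -> Prop).
Hypotheses (Rp1 : Rp 1) (RpB : forall x y, Rp x -> Rp y -> Rp (x - y))
  (RpM : forall x y, Rp x -> Rp y -> Rp (x * y)).
Variables (L : nat -> fieldType) (phi : forall j, {rmorphism W -> L j}) (X : W).

Definition zer j (g : {poly W}) : Prop := forall i, phi j g`_i = 0.
Definition rt j (g : {poly W}) : Prop := phi j g.[X] = 0.
Local Notation polyRp := (polyRp Rp).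

Lemma zer_rt j g : zer j g -> rt j g.
Proof.
move=> H; rewrite /rt horner_coef rmorph_sum big1 // => i _.
by rewrite rmorphM H mul0r.
Qed.

(** A minimal polynomial of [phi j X] over the image of [Rp], up to a nonzero factor; being zero is
    always meant after applying [phi j]. *)
Definition minimal j g : Prop := [/\ polyRp g, ~ zer j g, rt j g &
  forall r, polyRp r -> (size r < size g)%N -> rt j r -> zer j r].

Lemma minimal_exists j f : polyRp f -> ~ zer j f -> rt j f ->
  exists g, minimal j g /\ (size g <= size f)%N.
Proof.
move: {2}(size f) (leqnn (size f)) => N; elim: N f => [|N IH] f sf Rf zf rf.
  by case: zf => i; move: sf; rewrite leqn0 size_poly_eq0 => /eqP ->; rewrite coef0 rmorph0.
have [mf|nmf] := pselect (minimal j f); first by exists f.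
have [r [Rr sr rr zr]] : exists r, [/\ polyRp r, (size r < size f)%N, rt j r & ~ zer j r].
  apply: contrapT => H; apply: nmf; split=> // r Rr sr rr.
  by apply: contrapT => zr; apply: H; exists r.
have [|g [mg sg]] := IH r _ Rr zr rr; first by rewrite -ltnS (leq_trans sr).
by exists g; split=> //; apply: leq_trans sg _; exact: ltnW.
Qed.

Lemma minimal_lead j g : minimal j g -> phi j (lead_coef g) <> 0.
Proof.
move=> [Rg zg rg mg] l0.
pose r := \poly_(i < (size g).-1) g`_i.
have g0 : (0 < size g)%N.
  by rewrite size_poly_gt0; apply: contra_notN zg => /eqP -> i; rewrite coef0 rmorph0.
have E : g = r + (lead_coef g)%:P * 'X ^+ (size g).-1.
  apply/polyP => i; rewrite coefD coef_poly coefCM coefXn.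
  case: ltngtP => [lt|lt|->]; rewrite ?mulr0 ?addr0 ?add0r ?mulr1 //.
  by rewrite nth_default // -(prednK g0).
apply: zg => i; rewrite E coefD coefCM rmorphD rmorphM l0 mul0r addr0; move: i; apply: mg.
- by move=> i; rewrite coef_poly; case: ifP => _ //; exact: Rp0.
- by apply: leq_ltn_trans (size_poly _ _) _; rewrite prednK.
- by have := rg; rewrite /rt {1}E hornerD hornerM hornerC rmorphD rmorphM l0 mul0r addr0.
Qed.

Lemma minimal_size j g : minimal j g -> (1 < size g)%N.
Proof.
move=> mg; have l0 := minimal_lead mg; case: mg => _ zg rg _.
rewrite ltnNge; apply/negP => sg; apply: l0; move: rg.
by rewrite /rt (size1_polyC sg) hornerC lead_coefC.
Qed.

Lemma minimal_div j g f : minimal j g -> polyRp f -> exists c q r,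
  [/\ c *: f = q * g + r, polyRp q /\ polyRp r, (size r < size g)%N, Rp c /\ phi j c <> 0 &
   q = 0 \/ (size q + size g <= (size f).+1)%N].
Proof.
move=> mg Rf; have l0 := minimal_lead mg; have [Rg zg rg mmg] := mg.
have g0 : g != 0 by rewrite -size_poly_gt0 ltnW // (minimal_size mg).
have [e [q [r [E sr Rqr sq]]]] := pseudo_div Rp1 RpB RpM Rf Rg g0.
exists (lead_coef g ^+ e), q, r; split=> //; split; first by apply: RpX => //; exact: Rg.
by rewrite rmorphXn => /eqP; rewrite expf_eq0 => /andP[_ /eqP].
Qed.

Lemma zer_scale j c f : phi j c <> 0 -> zer j (c *: f) -> zer j f.
Proof.
move=> c0 H i; have := H i; rewrite coefZ rmorphM => /eqP; rewrite mulf_eq0 => /orP[/eqP|/eqP] //.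
Qed.

Lemma zer_mulD j q g r : zer j q -> zer j r -> zer j (q * g + r).
Proof.
move=> zq zr i; rewrite coefD rmorphD zr addr0 coefM rmorph_sum big1 // => k _.
by rewrite rmorphM zq mul0r.
Qed.

Variable A : nat -> Prop.
Hypothesis agree : forall j j' c, A j -> A j' -> Rp c -> phi j c = 0 -> phi j' c = 0.

Lemma zer_agree j j' g : A j -> A j' -> polyRp g -> zer j g -> zer j' g.
Proof. by move=> Aj Aj' Rg H i; apply: (agree Aj Aj'). Qed.

(** A smaller equation [gj] at [j] would divide [g] there up to a factor, by pseudo-division. The
    remainder vanishes at [j], hence at [j0] because the kernels agree on [Rp]; at [j0] either [gj]
    or the quotient would then have [X] as a root, against the minimality of [g]. *)
Lemma minimal_same j0 j g : A j0 -> A j -> minimal j0 g -> rt j g -> minimal j g.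
Proof.
move=> A0 Aj mg rg; have [Rg zg rg0 mmg] := mg; split=> //.
  by move=> /(zer_agree Aj A0 Rg).
move=> r Rr sr rr; apply: contrapT => zr.
have [gj [mgj sgj]] := minimal_exists Rr zr rr.
have [c [q [r' [E [Rq Rr'] sr' [Rc c0] sq]]]] := minimal_div mgj Rg.
have [Rgj zgj rgj mmgj] := mgj.
have zr' : zer j r'.
  apply: mmgj => //; have := congr1 (fun p : {poly W} => phi j p.[X]) E.
  by rewrite hornerZ hornerD hornerM rmorphM !rmorphD rmorphM rgj rg !mulr0 add0r => /esym.
have zr0 : zer j0 r' by exact: zer_agree zr'.
have c00 : phi j0 c <> 0 by move/(agree A0 Aj Rc).
have szg : (size gj < size g)%N by exact: leq_ltn_trans sr.
have : phi j0 q.[X] * phi j0 gj.[X] = 0.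
  have := congr1 (fun p : {poly W} => phi j0 p.[X]) E.
  rewrite hornerZ hornerD hornerM rmorphM !rmorphD rmorphM rg0 mulr0.
  have E0 : phi j0 r'.[X] = 0 by exact: zer_rt.
  by rewrite E0 addr0 => <-.
move/eqP; rewrite mulf_eq0 => /orP[/eqP qr|/eqP gr]; last first.
  by apply: zgj; apply: (zer_agree A0 Aj) => //; exact: mmg.
have zq : zer j0 q.
  apply: mmg => //; case: sq => [->|sq]; first by rewrite size_poly0 (leq_ltn_trans _ szg).
  have := minimal_size mgj; move: sq; case: (size gj) => [|[|a]] // sq _.
  by rewrite -ltnS; apply: leq_trans sq; rewrite !addnS !ltnS leq_addr.
by apply: zg; apply: (zer_scale c00); rewrite E; apply: zer_mulD.
Qed.

(** Pseudo-divide [f] by a minimal [g] at some [j0]: at every [j], [X] is a root of [g] or of the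
    quotient, so one of the two happens infinitely often. In the first case [g] is minimal at all
    these [j], and the kernels on polynomials in [X] coincide; in the second the quotient has
    smaller degree. *)
Lemma pigeonhole f : inf_set A -> polyRp f -> (forall j, A j -> ~ zer j f /\ rt j f) ->
  exists B : nat -> Prop, [/\ inf_set B, forall j, B j -> A j &
    forall j j' p, B j -> B j' -> polyRp p -> rt j p -> rt j' p].
Proof.
have H N : forall (B : nat -> Prop) (f : {poly W}), (size f <= N)%N -> inf_set B -> (forall j, B j -> A j) -> polyRp f ->
    (forall j, B j -> ~ zer j f /\ rt j f) ->
  exists B' : nat -> Prop, [/\ inf_set B', forall j, B' j -> A j &
    forall j j' p, B' j -> B' j' -> polyRp p -> rt j p -> rt j' p].
  elim: N => [|N IH] B {}f sf iB BA Rf Bf.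
    have [j _ Bj] := iB 0%N; case: (Bf j Bj) => zf _; case: zf => i.
    by move: sf; rewrite leqn0 size_poly_eq0 => /eqP ->; rewrite coef0 rmorph0.
  have [j0 _ B0] := iB 0%N.
  have [zf0 rf0] := Bf j0 B0.
  have [g [mg sg]] := minimal_exists Rf zf0 rf0.
  have [c [q [r [E [Rq Rr] sr [Rc c0] sq]]]] := minimal_div mg Rf.
  have [Rg zg rg mmg] := mg.
  have zr : zer j0 r.
    apply: mmg => //; have := congr1 (fun p : {poly W} => phi j0 p.[X]) E.
    by rewrite hornerZ hornerD hornerM rmorphM !rmorphD rmorphM rg rf0 !mulr0 add0r => /esym.
  have zrj j : B j -> zer j r by move=> Bj; apply: zer_agree zr => //; exact: BA.
  have qg j : B j -> rt j g \/ rt j q.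
    move=> Bj; have := congr1 (fun p : {poly W} => phi j p.[X]) E.
    rewrite hornerZ hornerD hornerM rmorphM !rmorphD rmorphM (Bf j Bj).2 mulr0.
    rewrite (_ : phi j r.[X] = 0) ?addr0; last by apply: zer_rt; exact: zrj.
    by move/esym/eqP; rewrite mulf_eq0 => /orP[]/eqP; [right|left].
  have [iC|iC] := inf_split iB qg.
    exists (fun j => B j /\ rt j g); split=> // [j [/BA]//|j j' p [Bj rj] [Bj' rj'] Rp_ rp].
    have mj := minimal_same (BA _ B0) (BA _ Bj) mg rj.
    have [d [s [t [Et [Rs Rt] st [Rd d0] _]]]] := minimal_div mj Rp_.
    have zt : zer j t.
      case: mj => _ _ _; apply=> //; have := congr1 (fun p : {poly W} => phi j p.[X]) Et.
      by rewrite hornerZ hornerD hornerM rmorphM !rmorphD rmorphM rj rp !mulr0 add0r => /esym.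
    have := congr1 (fun p : {poly W} => phi j' p.[X]) Et.
    rewrite hornerZ hornerD hornerM rmorphM !rmorphD rmorphM rj' mulr0 add0r.
    rewrite (_ : phi j' t.[X] = 0); last by apply: zer_rt; apply: zer_agree zt => //; exact: BA.
    move/eqP; rewrite mulf_eq0 => /orP[/eqP d1|/eqP//].
    by case: d0; apply: agree d1 => //; exact: BA.
  apply: (IH (fun j => B j /\ rt j q) q) => // [|j [/BA]//|j [Bj rj]].
    case: sq => [->|sq]; first by rewrite size_poly0.
    have := minimal_size mg; move: sq sf; case: (size g) => [|[|a]] // sq sf _.
    by rewrite -ltnS; apply: leq_trans sf; rewrite -ltnS; apply: leq_trans sq; rewrite !addnS !ltnS leq_addr.
  split=> // zq; apply: (Bf j Bj).1.
  apply: (zer_scale (c := c)); first by move=> c1; apply: c0; apply: agree c1 => //; exact: BA.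
  by rewrite E; apply: zer_mulD => //; exact: zrj.
by move=> iA Rf; apply: (H (size f)).
Qed.

End Pigeonhole.

Lemma pin_der (m : nat) (R : dring m) (J : choiceType) (T : dvar m J -> Prop) i (p : dpol R J) :
  pin T p -> pin (fun u => T u \/ exists2 v, T v & u = shift i v) (rder i p).
Proof.
elim=> [c|k Tk|a b Ha IH1 Hb IH2|a b Ha IH1 Hb IH2].
- by rewrite [rder _ _](pderC (@Xshift m R J)); exact: pinC.
- by rewrite [rder _ _](pderX (@Xshift m R J)); apply: pinX; right; exists k.
- by rewrite rderD; exact: pinD.
- by rewrite rderM; apply: pinD; apply: pinM => //;
    [apply: pin_sub Hb => k ? | apply: pin_sub Ha => k ?]; left.
Qed.

(** * Points of extensions of [U] with the same leaders *)

Section Points.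
Variables (m n : nat) (U : dfield m).
Variables (L : nat -> dfield m) (h : forall j, dembed U (L j)) (z : forall j, 'I_n -> L j).
Local Notation V := (dvar m 'I_n).
Local Notation W := (dpol (dring_of U) 'I_n).

Definition pt j : dhom W (dring_of (L j)) := dev (dhom_of (h j)) (z j).

Definition agree (B : nat -> Prop) (T : V -> Prop) : Prop :=
  forall j j' p, B j -> B j' -> pin T p -> pt j p = 0 -> pt j' p = 0.

Variable E : V -> Prop.
Hypothesis EDE : forall j t, E t <-> DE (fun x => exists y, x = h j y) (z j) t.

Lemma pt_tau j t p : pt j p = (map_poly (pt j) (tau t p)).[zz (z j) t].
Proof. exact: (@pev_tau _ _ _ (h j)). Qed.

Lemma ptX j t : pt j (pX t) = zz (z j) t.
Proof. exact: devX. Qed.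

Lemma tau_below T t (p : W) : (forall u : V, T u -> u = t \/ vlt u t) -> pin T p ->
  forall k, pin (fun u => vlt u t) (tau t p)`_k.
Proof. by move=> Ht Hp k; apply: pin_sub (tau_pin t k Hp) => u [/Ht[]]. Qed.

Definition le_var (t u : V) : Prop := u = t \/ vlt u t.

Lemma agree_transcendental B t : ~ E t -> agree B (fun u => vlt u t) -> agree B (le_var t).
Proof.
move=> nE AB j j' p Bj Bj' Hp p0.
have low := tau_below (t := t) (fun u H => H) Hp.
suff z0 k : pt j (tau t p)`_k = 0.
  rewrite (pt_tau j' t) horner_coef big1 // => k _.
  by rewrite coef_map /= (AB _ _ _ Bj Bj' (low k) (z0 k)) mul0r.
apply: contrapT => zk; apply: nE; apply/(EDE j).
apply/(@algov_gens U V (L j) (h j) (zz (z j)) (fun u => vlt u t)); exists (tau t p); split=> //.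
  by apply/eqP => /(congr1 (fun q : {poly L j} => q`_k)); rewrite coef_map coef0.
by rewrite /root; apply/eqP; rewrite -[RHS]p0 (pt_tau j t).
Qed.

Lemma agree_rational B i u : E u -> agree B (fun v => vlt v (shift i u)) -> agree B (le_var (shift i u)).
Proof.
move=> Eu AB j j' p Bj Bj' Hp p0; set t := shift i u in AB Hp *.
have ut : vlt u t by exact: vlt_shift1.
have [q [qN qz dq]] : exists q : {poly L j}, [/\ forall k,
    sfgen (@gens U V (L j) (h j) (zz (z j)) (fun v => vlt v u)) q`_k, root q (zz (z j) u) & q^`().[zz (z j) u] != 0].
  by apply: min_sep_poly (dchar0 _) (sfgen_subf _) _; apply/(EDE j).
have [c [P [c0 TP EP]]] := gens_poly qN.
pose g : W := P.[pX u].
have Hg : pin (fun v => vlt v t) g.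
  apply: pin_horner => // k; apply: pin_sub (TP k) => v vu; exact: vlt_trans vu ut.
have gj : pt j g = 0.
  rewrite /g -horner_map /= ptX (_ : map_poly (pt j) P = c *: q) ?hornerZ ?(eqP qz) ?mulr0 //.
have gj' := AB _ _ _ Bj Bj' Hg gj.
pose S : W := P^`().[pX u].
pose T : W := \sum_(k < size P) rder i (P`_k : W) * pX u ^+ k.
have HS : pin (fun v => vlt v t) S.
  apply: pin_horner => // k; rewrite coef_deriv -mulr_natl; apply: pinM.
    by rewrite -(rmorph_nat (mpC malg_theory U V)); exact: pinC.
  by apply: pin_sub (TP _) => v vu; exact: vlt_trans vu ut.
have HT : pin (fun v => vlt v t) T.
  apply: pin_sum => k _; apply: pinM; last by apply: pinXn; exact: pinX.
  have := @pin_der m (dring_of U) _ _ i _ (TP k); apply: pin_sub => v [vu|[v' v'u ->]]; first exact: vlt_trans vu ut.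
  exact: vlt_shift.
have Sj : pt j S <> 0.
  apply/eqP; rewrite /S -horner_map /= ptX -deriv_map (_ : map_poly (pt j) P = c *: q) //.
  by rewrite derivZ hornerZ mulf_neq0.
have Sj' : pt j' S <> 0 by move/(AB _ _ _ Bj' Bj HS).
have dg : rder i g = T + S * pX t.
  rewrite /g rder_horner; congr (_ + _ * _); exact: (pderX (@Xshift m (dring_of U) _)).
have zt l : pt l g = 0 -> pt l T + pt l S * zz (z l) t = 0.
  by move=> gl; rewrite -ptX -rmorphM -rmorphD -dg dhom_der gl rder0.
have low := tau_below (t := t) (fun u H => H) Hp.
pose d := size (tau t p).
pose Q : W := \sum_(k < d) (tau t p)`_k * (- T) ^+ k * S ^+ (d - k).
have HQ : pin (fun v => vlt v t) Q.
  by apply: pin_sum => k _; apply: pinM; [apply: pinM; [exact: low|apply: pinXn; exact: pinN]|exact: pinXn].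
have QE l : pt l g = 0 -> pt l Q = pt l S ^+ d * pt l p.
  move/zt => /eqP; rewrite addrC addr_eq0 => /eqP zl.
  rewrite -[in RHS](tauK t p) horner_coef !rmorph_sum mulr_sumr; apply: eq_bigr => k _.
  rewrite !rmorphM !rmorphXn rmorphN ptX -zl exprMn.
  have -> : pt l S ^+ d = pt l S ^+ k * pt l S ^+ (d - k) by rewrite -exprD subnKC // ltnW.
  have R4 (F : fieldType) (a b c' d' : F) : a * (b * c') * d' = b * d' * (a * c') by ring.
  exact: R4.
have : pt j' Q = 0 by apply: (AB _ _ _ Bj Bj' HQ); rewrite QE // p0 mulr0.
rewrite QE // => /eqP; rewrite mulf_eq0 expf_eq0 => /orP[/andP[_ /eqP]|/eqP] //.
Qed.

Lemma agree_sub B C T : (forall j, C j -> B j) -> agree B T -> agree C T.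
Proof. by move=> CB AB j j' p Cj Cj'; apply: AB; exact: CB. Qed.

Lemma agree_lt B t : (forall u, vlt u t -> agree B (le_var u)) -> agree B (fun u => vlt u t).
Proof.
move=> H j j' p Bj Bj' /pin_list[s [st sp]] p0.
have [E0|/vlt_max[a as_ amax]] := eqVneq s [::].
  have [c Ec] : exists c, p = pC c by apply: pin_none; apply: pin_sub sp => k; rewrite E0.
  move: p0; rewrite Ec /pt !devC => /eqP; rewrite fmorph_eq0 => /eqP ->; exact: rmorph0.
apply: (H a (st a as_) j j' p) => //; apply: pin_sub sp => k ks.
exact: amax.
Qed.

Lemma agree_all B : (forall u, agree B (le_var u)) -> agree B (fun=> True).
Proof.
move=> H j j' p Bj Bj' /pin_list[s [_ sp]] p0.
have [E0|/vlt_max[a as_ amax]] := eqVneq s [::].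
  have [c Ec] : exists c, p = pC c by apply: pin_none; apply: pin_sub sp => k; rewrite E0.
  move: p0; rewrite Ec /pt !devC => /eqP; rewrite fmorph_eq0 => /eqP ->; exact: rmorph0.
apply: (H a j j' p) => //; apply: pin_sub sp => k ks; exact: amax.
Qed.

(* Only finitely many prime differential ideals of U{Y} have the same leading
   terms E and contain given equations for the minimal elements G of E: the
   ideal is determined step by step, and the only choices, at the elements of
   G, are between finitely many factors. *)
Lemma point_pigeonhole (G : seq V) (f : V -> {poly W}) :
  (forall t, E t -> t \in G \/ exists i u, E u /\ t = shift i u) ->
  (forall t k, t \in G -> pin (fun u => vlt u t) (f t)`_k) ->
  (forall j t, t \in G -> map_poly (pt j) (f t) <> 0 /\ pt j (f t).[pX t] = 0) ->
  exists B, inf_set B /\ agree B (fun=> True).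
Proof.
move=> EG Gf fG.
suff H N : forall B (s : seq V), (size s <= N)%N -> inf_set B -> {subset s <= G} ->
    (forall t C, t \in G -> t \notin s -> (forall j, C j -> B j) ->
      agree C (fun u => vlt u t) -> agree C (le_var t)) ->
    exists B', inf_set B' /\ agree B' (fun=> True).
  by apply: (H (size G) (fun=> True) G) => // [N'|t C ->//]; exists N'.
elim: N => [|N IH] B s sN iB sG Bs.
  exists B; split=> //; apply: agree_all; elim/vlt_ind => t /agree_lt At.
  have [Et|nEt] := pselect (E t); last exact: agree_transcendental.
  case: (EG t Et) => [tG|[i [u [Eu Etu]]]].
    by apply: Bs => //; move: sN; rewrite leqn0 => /nilP ->.
  by rewrite Etu in At *; exact: agree_rational.
have [all_|nall] := pselect (forall u, agree B (le_var u)).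
  by exists B; split=> //; exact: agree_all.
have [|t [nt tmin]] := @vlt_min m n (fun u => ~ agree B (le_var u)).
  by apply: contrapT => H; apply: nall => u; apply: contrapT => nu; apply: H; exists u.
have At : agree B (fun u => vlt u t).
  by apply: agree_lt => u ut; apply: contrapT => nu; exact: tmin nu ut.
have Et : E t by apply: contrapT => nEt; apply: nt; exact: agree_transcendental.
have [tG|[i [u [Eu Etu]]]] := EG t Et; last first.
  by case: nt; rewrite Etu in At *; exact: agree_rational.
have ts : t \in s by apply: contrapT => /negP ts; apply: nt; exact: Bs.
have R1 : pin (fun u => vlt u t) (1 : W) by exact: pin1.
have agr j j' c : B j -> B j' -> pin (fun u => vlt u t) c -> pt j c = 0 -> pt j' c = 0.
  by move=> Bj Bj' Hc; exact: At.
have [||B' [iB' B'B AB']] := @pigeonhole W (fun p => pin (fun u => vlt u t) p) R1 (@pinB _ _ _)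
  (@pinM _ _ _ _ _ _) (fun j => dcar (L j)) pt (pX t) B agr (f t) iB.
- by move=> k; exact: Gf.
- move=> j Bj; have [f0 ft] := fG j t tG; split=> // zf; apply: f0.
  by apply/polyP => k; rewrite coef_map coef0; exact: zf.
pose s' := filter (predC1 t) s.
apply: (IH B' s') => //.
- rewrite -ltnS; apply: leq_trans sN; rewrite size_filter -(count_predC (pred1 t) s).
  by rewrite -[ltnLHS]add0n ltn_add2r -has_count has_pred1.
- by move=> u; rewrite mem_filter => /andP[_ /sG].
- move=> u C uG us CB Au.
  have [ut|ut] := eqVneq u t.
    apply: agree_sub CB _ => j j' p Bj Bj' Hp; rewrite ut in Hp.
    rewrite -(tauK t p); apply: AB' => // k; exact: tau_below Hp k.
  apply: Bs => // [|j /CB/B'B//].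
  by apply: contra us => us; rewrite mem_filter /= ut us.
Qed.

End Points.

(** * Ordinals and slices *)

Section Ordinals.
Implicit Types a b c : Ord.

Lemma ole_refl a : ole a a.
Proof. by elim: a => T f IH i; exists i; exact: IH. Qed.

Lemma ole_trans a b c : ole a b -> ole b c -> ole a c.
Proof.
elim: a b c => T f IH [T' g] [T'' h] ab bc i.
have [j fg] := ab i; have [k gh] := bc j; exists k; exact: IH fg gh.
Qed.

Lemma ole_elem T (f : T -> Ord) i : ole (f i) (OSup f).
Proof.
move E : (f i) => a; elim: a T f i E => T' g IH T f i E k.
by exists i; rewrite E; apply: IH.
Qed.

Lemma olt_elem T (f : T -> Ord) i : olt (f i) (OSup f).
Proof. by move=> _; exists i; exact: ole_refl. Qed.

Lemma olt_ole_trans a b c : olt a b -> ole b c -> olt a c.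
Proof. exact: ole_trans. Qed.

Lemma ole_olt_trans a b c : ole a b -> olt b c -> olt a c.
Proof. by move=> ab; apply: ole_trans => _; exists tt. Qed.

Lemma ole_sup T (f : T -> Ord) b : (forall i, olt (f i) b) -> ole (OSup f) b.
Proof. by case: b => T' g H i; exact: H i tt. Qed.

Lemma olt_irr a : ~ olt a a.
Proof.
elim: a => T f IH /(_ tt)[j H]; apply: (IH j).
exact: olt_ole_trans (olt_elem f j) H.
Qed.

Lemma ole_total a b : ole a b \/ olt b a.
Proof.
elim: a b => T f IH [T' g]; apply: contrapT => /not_orP[nab nba].
apply: nab => i; apply: contrapT => H; apply: nba => _; exists i.
have K j : olt (g j) (f i).
  by case: (IH i (g j)) => // fg; case: H; exists j.
case: (f i) K => T'' h K j; have [k Hk] := K j tt.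
by exists k.
Qed.

Lemma ord_min (P : Ord -> Prop) : (exists a, P a) -> exists a, P a /\ forall b, P b -> ole a b.
Proof.
case=> a Pa; suff H c d : ole d c -> P d -> exists a, P a /\ forall b, P b -> ole a b.
  exact: H (ole_refl a) Pa.
elim: c d => T f IH d dc Pd.
have [[b [Pb bd]]|nb] := pselect (exists b, P b /\ olt b d).
  have := olt_ole_trans bd dc => /(_ tt)[i Hi]; exact: IH Hi Pb.
exists d; split=> // b Pb; case: (ole_total d b) => // bd; case: nb; by exists b.
Qed.

Lemma oadd_monoR a b b' : ole b b' -> ole (oadd a b) (oadd a b').
Proof.
case: a => T f; elim: b b' => T' g IH [T'' h] H [i|j].
  by exists (inl i); exact: ole_refl.
by have [k gh] := H j; exists (inr k); apply: IH.
Qed.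

Lemma oadd_strictR a b b' : olt b b' -> olt (oadd a b) (oadd a b').
Proof.
case: a b' => T f [T' g] /(_ tt)[j H] _; exists (inr j).
exact: (@oadd_monoR (OSup f)).
Qed.

Lemma oadd_le a b : ole a (oadd a b).
Proof. by case: a b => T f [T' g] i; exists (inl i); exact: ole_refl. Qed.

Lemma omuln_mono a k l : (k <= l)%N -> ole (omuln a k) (omuln a l).
Proof.
move=> /subnK <-; elim: (l - k)%N => [|d IH]; first exact: ole_refl.
by apply: ole_trans IH _; rewrite addSn; exact: oadd_le.
Qed.

(* The ordinal with Cantor normal form omega^(d-1) c(d-1) + ... + c(0) *)
Fixpoint osum (d : nat) (c : nat -> nat) : Ord :=
  if d is d'.+1 then oadd (omuln (omega_pow d') (c d')) (osum d' c) else ozero.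

Lemma osum_lt d (c : nat -> nat) : olt (osum d c) (omega_pow d).
Proof.
elim: d => [|d IH]; first by move=> _; exists tt; exact: ole_refl.
apply: olt_ole_trans (oadd_strictR _ IH) _.
exact: (@ole_elem _ (fun k => omuln (omega_pow d) k) (c d).+1).
Qed.

Lemma osum_dec D d (c c' : nat -> nat) : (d < D)%N -> (c' d < c d)%N -> (forall e, (d < e < D)%N -> c' e = c e) ->
  olt (osum D c') (osum D c).
Proof.
elim: D => // D IH; rewrite ltnS leq_eqVlt => /orP[/eqP -> cd _|dD cd ce] /=.
  apply: olt_ole_trans (oadd_strictR _ (osum_lt D c')) _.
  by apply: ole_trans (oadd_le _ _); exact: (omuln_mono _ cd).
rewrite (ce D) ?dD ?ltnSn //; apply: oadd_strictR; apply: IH => // e /andP[de eD].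
by apply: ce; rewrite de ltnS ltnW.
Qed.

End Ordinals.

Section Slices.
Variables (m n : nat).
Local Notation V := (dvar m 'I_n).

(* The coset (j, s) consists of the (e, j) with e i = v whenever s i = Some v. *)
Definition slice : eqType := ('I_n * {ffun 'I_m -> option nat})%type.
Definition in_slice (u : V) (x : slice) : Prop := u.2 = x.1 /\ forall i v, x.2 i = Some v -> u.1 i = v.
Definition sdim (x : slice) : nat := #|[pred i | x.2 i == None]|.
Definition scount (S : seq slice) (d : nat) : nat := count (fun x => sdim x == d) S.
Definition sord (S : seq slice) : Ord := osum m.+1 (scount S).
Definition covers (S : seq slice) (E : V -> Prop) : Prop :=
  forall u, ~ E u -> exists2 x, x \in S & in_slice u x.
Definition vle (u v : V) : Prop := u.2 = v.2 /\ forall i, (u.1 i <= v.1 i)%N.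

Lemma sdim_le x : (sdim x <= m)%N.
Proof. by rewrite -[leqRHS](card_ord m) max_card. Qed.

Definition refine (x : slice) (i : 'I_m) (v : nat) : slice :=
  (x.1, [ffun k => if k == i then Some v else x.2 k]).

Lemma sdim_refine (x : slice) i v : x.2 i = None -> (sdim (refine x i v) < sdim x)%N.
Proof.
move=> xi; rewrite /sdim (cardD1 i [pred i | x.2 i == None]) inE xi eqxx add1n ltnS.
apply/subset_leq_card/fintype.subsetP => k; rewrite !inE ffunE.
by have [->|ne] := eqVneq k i.
Qed.

Lemma covers_drop (S : seq slice) (E E' : V -> Prop) x : covers S E ->
  (forall u v, E' u -> vle u v -> E' v) -> (forall u, E u -> E' u) -> E' x -> ~ E x ->
  exists S', covers S' E' /\ olt (sord S') (sord S).
Proof.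
move=> cS upE' EE' E'x nEx; have [s sS xs] := cS x nEx.
pose new := [seq refine s i v | i <- [seq i <- enum 'I_m | s.2 i == None], v <- iota 0 (x.1 i)].
have dnew y : y \in new -> (sdim y < sdim s)%N.
  case/allpairsPdep => i [v [+ _ ->]]; rewrite mem_filter => /andP[/eqP si _].
  exact: sdim_refine.
exists (rem s S ++ new); split.
  move=> u nE'u; have nEu : ~ E u by move=> /EE'.
  have [y yS uy] := cS u nEu.
  have [E1|ne] := eqVneq y s; last first.
    exists y => //; rewrite mem_cat; apply/orP; left.
    move: yS; rewrite (perm_mem (perm_to_rem sS)) inE (negPf ne); exact.
  rewrite E1 in uy.
  have [i ui] : exists i, (u.1 i < x.1 i)%N.
    apply: contrapT => H; apply: nE'u; apply: upE' E'x _; split; first by rewrite xs.1 uy.1.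
    by move=> i; rewrite leqNgt; apply/negP => ui; apply: H; exists i.
  have si : s.2 i = None.
    case Es : (s.2 i) => [v|//]; move: ui; by rewrite (xs.2 i v Es) (uy.2 i v Es) ltnn.
  exists (refine s i (u.1 i)).
    rewrite mem_cat; apply/orP; right; apply/allpairsPdep; exists i, (u.1 i); split=> //.
      by rewrite mem_filter si eqxx mem_enum.
    by rewrite mem_iota.
  split; first exact: uy.1.
  move=> k v; rewrite ffunE; case: eqP => [->[]//|_ sk]; exact: uy.2 k v sk.
have cnt e : (sdim s <= e)%N -> scount S e = ((e == sdim s) + scount (rem s S ++ new) e)%N.
  move=> le; rewrite /scount count_cat (permP (perm_to_rem sS)) /= eq_sym.
  suff -> : count (fun y => sdim y == e) new = 0%N by rewrite addn0.
  apply/eqP; rewrite -leqn0 leqNgt -has_count; apply/hasP => -[y /dnew ys /eqP Ey].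
  by move: le; rewrite -Ey leqNgt ys.
apply: (@osum_dec _ (sdim s)).
- by rewrite ltnS sdim_le.
- by rewrite (cnt (sdim s)) // eqxx add1n.
- move=> e /andP[de _]; rewrite (cnt e (ltnW de)).
  by rewrite gtn_eqF.
Qed.

Definition up (G : seq V) (v : V) : Prop := exists2 g, g \in G & vle g v.

Lemma vle_trans u v w : vle u v -> vle v w -> vle u w.
Proof.
move=> [E1 H1] [E2 H2]; split; first by rewrite E1.
by move=> i; apply: leq_trans (H1 i) (H2 i).
Qed.

Lemma vle_refl u : vle u u. Proof. by split. Qed.

Lemma dickson (E : V -> Prop) : (forall u v, E u -> vle u v -> E v) ->
  exists G : seq V, (forall g, g \in G -> E g) /\ forall u, E u -> up G u.
Proof.
move=> upE.
suff H a G0 S : ole (sord S) a -> (forall g, g \in G0 -> E g) -> covers S (up G0) ->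
    exists G : seq V, (forall g, g \in G -> E g) /\ forall u, E u -> up G u.
  apply: (H (sord [seq (j, [ffun=> None]) | j <- enum 'I_n]) [::] [seq (j, [ffun=> None]) | j <- enum 'I_n]) => //.
    exact: ole_refl.
  move=> u _; exists (u.2, [ffun=> None]); first by apply/mapP; exists u.2; rewrite ?mem_enum.
  by split=> // i v; rewrite ffunE.
elim: a G0 S => T f IH G0 S So G0E cS.
have [done_|] := pselect (forall u, E u -> up G0 u); first by exists G0.
move/existsNP => [x /not_implyP[Ex nx]].
have [||||S' [cS' lt]] := @covers_drop S (up G0) (up (x :: G0)) x cS.
- by move=> u v [g gG gu] uv; exists g => //; exact: vle_trans gu uv.
- by move=> u [g gG gu]; exists g => //; rewrite inE gG orbT.
- by exists x; [rewrite inE eqxx | exact: vle_refl].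
- exact: nx.
have := olt_ole_trans lt So => /(_ tt)[i Hi].
apply: (IH i (x :: G0) S' Hi) => // g; rewrite inE => /orP[/eqP ->//|]; exact: G0E.
Qed.

Lemma shift_up (E : V -> Prop) : (forall u i, E u -> E (shift i u)) -> forall u v, E u -> vle u v -> E v.
Proof.
move=> sE u v Eu [uv H].
have K (f : {ffun 'I_m -> nat}) : E ([ffun i => u.1 i + f i]%N, u.2).
  elim/e_ind: f => [|f i IH].
    suff -> : ([ffun i => u.1 i + (e0 : {ffun 'I_m -> nat}) i]%N, u.2) = u by [].
    by case: (u) => e j; congr (_, _); apply/ffunP => i; rewrite !ffunE addn0.
  have := sE _ i IH; congr E; congr (_, _).
  by apply/ffunP => k; rewrite !ffunE addnA.
have := K [ffun i => v.1 i - u.1 i]%N; congr E.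
case: v uv H => e j /= -> H; congr (_, _); apply/ffunP => i; rewrite !ffunE.
exact: subnKC.
Qed.

Lemma up_shift (G : seq V) t : up G t -> t \in G \/ exists i u, up G u /\ t = shift i u.
Proof.
move=> [g gG [gt H]]; have [<-|ne] := eqVneq g t; [by left|right].
have [i gi] : exists i, (g.1 i < t.1 i)%N.
  apply: contrapT => K; move/eqP: ne; apply.
  case: g t gt H K {gG} => e j [e' j'] /= -> H K; congr (_, _); apply/ffunP => i.
  by apply/eqP; rewrite eqn_leq H /= leqNgt; apply/negP => ei; apply: K; exists i.
exists i, ([ffun k => t.1 k - (k == i)]%N, t.2); split.
  exists g => //; split=> // k; rewrite /= ffunE; case: eqP => [->|_]; last by rewrite subn0.
  by rewrite -ltnS subn1 prednK // (leq_ltn_trans _ gi).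
case: t gt H gi ne => e j /= _ _ gi _; congr (_, _); apply/ffunP => k; rewrite !ffunE.
by case: eqP => [->|_]; rewrite ?subn0 ?addn0 // subnK // (leq_ltn_trans _ gi).
Qed.

End Slices.

(** * Forking *)

Section FiniteCharacter.
Variables (m n : nat) (L : dfield m) (z : 'I_n -> L) (A : L -> Prop).
Local Notation D s := (dcl (fun x => x \in (s : seq L))).

Lemma params_cat (s1 s2 : seq L) : params A s1 -> params A s2 -> params A (s1 ++ s2).
Proof. by move=> H1 H2 x; rewrite mem_cat => /orP[/H1|/H2]. Qed.

Lemma below_finite t x : sfgen (below (dcl A) z t) x ->
  exists s, params A s /\ sfgen (below (D s) z t) x.
Proof.
have mono (s s' : seq L) y : {subset s <= s'} -> sfgen (below (D s) z t) y -> sfgen (below (D s') z t) y.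
  move=> ss; apply: sfgen_sub => {}y [H|H]; apply: sfgen_gen; [left|by right].
  by apply: dcl_sub H => v; exact: ss.
have S s : is_subf (sfgen (below (D s) z t)) by exact: sfgen_subf.
apply: (sfgen_min (M := fun x => exists s, params A s /\ sfgen (below (D s) z t) x)).
  split.
  - by exists [::]; split=> //; exact: (subf1 (S _)).
  - move=> {}x y [s [As Hx]] [s' [As' Hy]]; exists (s ++ s'); split; first exact: params_cat.
    apply: (subfB (S _)); [apply: mono Hx | apply: mono Hy] => v; by rewrite mem_cat => ->; rewrite ?orbT.
  - move=> {}x y [s [As Hx]] [s' [As' Hy]]; exists (s ++ s'); split; first exact: params_cat.
    apply: (subfV (S _)); [apply: mono Hx | apply: mono Hy] => v; by rewrite mem_cat => ->; rewrite ?orbT.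
move=> y [[u [e [Au ->]]]|H]; last first.
  by exists [::]; split=> //; apply: sfgen_gen; right.
exists [:: u]; split; first by move=> v; rewrite inE => /eqP ->.
by apply: sfgen_gen; left; exists u, e; rewrite inE.
Qed.

Lemma DE_mono (B C : L -> Prop) t : (forall x, B x -> C x) -> DE (dcl B) z t -> DE (dcl C) z t.
Proof. by move=> BC; apply: DE_sub => x Hx; apply: sfgen_gen; apply: dcl_sub Hx. Qed.

Lemma DE_finite t : DE (dcl A) z t -> exists s, params A s /\ DE (D s) z t.
Proof.
move=> [p [p0 pA pz]].
suff [s [As Hs]] : exists s, params A s /\ forall i, sfgen (below (D s) z t) p`_i.
  by exists s; split=> //; exists p.
suff [s [As Hs]] : exists s, params A s /\ forall i, (i < size p)%N -> sfgen (below (D s) z t) p`_i.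
  exists s; split=> // i; have [/Hs//|le] := ltnP i (size p).
  by rewrite nth_default //; exact: (subf0 (sfgen_subf _)).
elim: (size p) => [|k [s [As Hs]]]; first by exists [::].
have [s' [As' Hs']] := below_finite (pA k).
exists (s ++ s'); split; first exact: params_cat.
have mono (s1 s2 : seq L) y : {subset s1 <= s2} -> sfgen (below (D s1) z t) y -> sfgen (below (D s2) z t) y.
  move=> ss; apply: sfgen_sub => {}y [H|H]; apply: sfgen_gen; [left|by right].
  by apply: dcl_sub H => v; exact: ss.
move=> i; rewrite ltnS leq_eqVlt => /orP[/eqP ->|ik].
  by apply: mono Hs' => v vs; rewrite mem_cat vs orbT.
by apply: mono (Hs i ik) => v vs; rewrite mem_cat vs.
Qed.

Lemma DE_finite_seq (G : seq (dvar m 'I_n)) : (forall t, t \in G -> DE (dcl A) z t) ->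
  exists s, params A s /\ forall t, t \in G -> DE (D s) z t.
Proof.
elim: G => [|g G IH] H; first by exists [::].
have [|s [As Hs]] := IH; first by move=> t tG; apply: H; rewrite inE tG orbT.
have [s' [As' Hs']] := DE_finite (H g (mem_head _ _)).
exists (s ++ s'); split; first exact: params_cat.
move=> t; rewrite inE => /orP[/eqP ->|/Hs tG].
  by apply: DE_mono Hs' => v; rewrite mem_cat orbC => ->.
by apply: DE_mono tG => v; rewrite mem_cat => ->.
Qed.

Lemma DE_vle (B : L -> Prop) u v : DE (dcl B) z u -> vle u v -> DE (dcl B) z v.
Proof. by apply: shift_up => {}u i; apply: DE_up => j x; exact: dcl_der. Qed.

End FiniteCharacter.

Section Picks.
Variable m : nat.
Implicit Types L : dfield m.

Lemma qfeq_pick L1 L2 (e1 e1' : seq L1) (e2 e2' : seq L2) (rho : nat -> nat) :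
  (forall k, e1'`_k = e1`_(rho k)) -> (forall k, e2'`_k = e2`_(rho k)) ->
  qfeq e1 e2 -> qfeq e1' e2'.
Proof.
move=> H1 H2; apply: (qfeq_sub (sigma := fun k => dY (int_dring m) (rho k))) => k.
  by rewrite H1 /ev devY.
by rewrite H2 /ev devY.
Qed.

Lemma nth_tcat L n (t : n.-tuple L) (e : seq L) k :
  nth 0 (t ++ e) k = if (k < n)%N then nth 0 t k else nth 0 e (k - n).
Proof. by rewrite nth_cat size_tuple. Qed.

Lemma qfeq_sublist n L1 L2 (t1 : n.-tuple L1) (t2 : n.-tuple L2) (h : dembed L1 L2) (e f : seq L1) :
  {subset f <= e} -> qfeq (t1 ++ e) (t2 ++ map h e) -> qfeq (t1 ++ f) (t2 ++ map h f).
Proof.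
move=> fe; pose rho k := if (k < n)%N then k else if (k - n < size f)%N then (n + index (nth 0%R f (k - n)) e)%N else (n + size e)%N.
apply: (qfeq_pick (rho := rho)) => k; rewrite !nth_tcat /rho; case: ltnP => kn; rewrite ?kn //.
  have [lt|le] := ltnP (k - n) (size f).
    by rewrite ltnNge leq_addr /= addKn nth_index // fe // mem_nth.
  by rewrite ltnNge leq_addr /= addKn !nth_default.
have [lt|le] := ltnP (k - n) (size f).
  have fi : nth 0 f (k - n) \in e by apply: fe; exact: mem_nth.
  by rewrite ltnNge leq_addr /= addKn !(nth_map 0) ?index_mem // nth_index.
by rewrite ltnNge leq_addr /= addKn !nth_default ?size_map.
Qed.

Lemma qfeq_subtuple n N L1 L2 (t1 : N.-tuple L1) (t2 : N.-tuple L2) (g : 'I_n -> 'I_N) (e1 : seq L1) (e2 : seq L2) :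
  qfeq (t1 ++ e1) (t2 ++ e2) ->
  qfeq ([tuple tnth t1 (g i) | i < n] ++ e1) ([tuple tnth t2 (g i) | i < n] ++ e2).
Proof.
pose rho k := if insub k is Some i then g i : nat else (N + (k - n))%N.
have H L (t : N.-tuple L) (e : seq L) k :
    nth 0 ([tuple tnth t (g i) | i < n] ++ e) k = nth 0 (t ++ e) (rho k).
  rewrite !nth_tcat /rho; case: insubP => [i kn ik|]; last first.
    by rewrite -leqNgt ltnNge => ->; rewrite /= ltnNge leq_addr /= addKn.
  by rewrite kn ltn_ord -ik -tnth_nth tnth_mktuple -tnth_nth.
by apply: (qfeq_pick (rho := rho)) => k; apply: H.
Qed.

Lemma qfeq_takel n L1 L2 (t1 : n.-tuple L1) (t2 : n.-tuple L2) (c1 e1 : seq L1) (c2 e2 : seq L2) :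
  size c1 = size c2 -> qfeq (t1 ++ (c1 ++ e1)) (t2 ++ (c2 ++ e2)) -> qfeq (t1 ++ c1) (t2 ++ c2).
Proof.
move=> sc; pose rho k := if (k < n + size c1)%N then k else (n + size c1 + size e1 + size e2 + k)%N.
have H L (t : n.-tuple L) (c e : seq L) k : size c = size c1 -> (size e <= size e1 + size e2)%N ->
    nth 0 (t ++ c) k = nth 0 (t ++ (c ++ e)) (rho k).
  move=> s1 s2; rewrite /rho; have [lt|le] := ltnP.
    rewrite !nth_tcat nth_cat; case: ltnP => // nk; rewrite ifT //.
    by rewrite s1 ltn_subLR.
  rewrite !nth_default ?size_cat ?size_tuple ?s1 // -?addnA ?leq_add2l.
  by rewrite (leq_trans s2) // addnA leq_addr.
by apply: (qfeq_pick (rho := rho)) => k; apply: H; rewrite ?sc // ?leq_addr ?leq_addl.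
Qed.

Lemma qfeq_taker n L1 L2 (t1 : n.-tuple L1) (t2 : n.-tuple L2) (c1 e1 : seq L1) (c2 e2 : seq L2) :
  size c1 = size c2 -> qfeq (t1 ++ (c1 ++ e1)) (t2 ++ (c2 ++ e2)) -> qfeq (t1 ++ e1) (t2 ++ e2).
Proof.
move=> sc; pose rho k := if (k < n)%N then k else (k + size c1)%N.
have H L (t : n.-tuple L) (c e : seq L) k : size c = size c1 ->
    nth 0 (t ++ e) k = nth 0 (t ++ (c ++ e)) (rho k).
  move=> s1; rewrite /rho !nth_tcat; case: ltnP => nk; first by rewrite nk.
  rewrite ltnNge (leq_trans nk) ?leq_addr //= nth_cat s1.
  by rewrite -addnBAC // ltnNge leq_addl /= addnK.
by apply: (qfeq_pick (rho := rho)) => k; apply: H; rewrite ?sc.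
Qed.

End Picks.

Lemma inf_pick (B : nat -> Prop) k : inf_set B -> exists s : seq nat, [/\ uniq s, size s = k & forall j, j \in s -> B j].
Proof.
move=> iB; elim: k => [|k [s [us ss sB]]]; first by exists [::].
have [j Hj Bj] := iB (\max_(i <- s) i).+1.
exists (j :: s); split=> /=; last by move=> i; rewrite inE => /orP[/eqP ->//|/sB].
  rewrite us andbT; apply/negP => js; move: Hj; rewrite ltnNge => /negP; apply.
  exact: (@leq_bigmax_seq _ s predT id).
by rewrite ss.
Qed.

Section Nonforking.
Variables (m : nat) (kappa : Type) (U : dfield m).
Hypothesis hU : dclosed_field U.
Hypothesis hsat : saturated kappa U.
Hypothesis hfin : forall s : seq U, small kappa (fun x => x \in s).

Local Notation D s := (dcl (fun x => x \in (s : seq _))).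
Local Notation rg h := (fun x => exists y, x = h y).

Lemma same_type_qfeq (A : U -> Prop) (c c' e : seq U) :
  same_type A c c' -> params A e -> qfeq (c ++ e) (c' ++ e).
Proof.
move=> [_ H] Ae p; have := H (FEq0 (to_malg p)) e Ae.
by rewrite !ev_holds_to.
Qed.

Lemma DE_map N (L : dfield m) (h : dembed U L) (z : 'I_N -> L) (e : seq U) t :
  DE (D (map h e)) z t -> DE (rg h) z t.
Proof.
apply: DE_sub => x [y [f [/mapP[y' _ ->] ->]]].
apply: sfgen_gen; exists (rdop (R := dring_of U) f y').
exact: esym (dhom_rdop (dhom_of h) f y').
Qed.

Lemma subl_pin N (e : seq U) t c : pin (@Tl m N t) c -> pin (fun u => vlt u t) (subl N e c).
Proof.
elim=> [k|[ex i] Tk|a b _ IH1 _ IH2|a b _ IH1 _ IH2].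
- rewrite /subl devC; elim/int_rec: k => [|k IH|k IH]; first by rewrite rmorph0; exact: pin0.
    by rewrite /= intS rmorphD rmorph1; apply: pinD => //; exact: pin1.
  by rewrite /= intS opprD rmorphD rmorphN1; apply: pinD => //; apply: pinN; exact: pin1.
- rewrite /subl devX /=; case: insubP => [l iN li|].
    rewrite rdopY; apply: pinX; case: Tk => [[j /= ji jt]|/=]; last by rewrite leqNgt iN.
    by have -> : l = j by apply: val_inj; rewrite /= li ji.
  move=> _; suff : pin (fun u => vlt u t) (dpC (dring_of U) 'I_N (rdop (R := dring_of U) ex e`_(i - N))).
    by rewrite dhom_rdop.
  exact: pinC.
- by rewrite rmorphD; exact: pinD.
- by rewrite rmorphM; exact: pinM.
Qed.

(* A formula of tp(g z / B) that forks over A is refuted by realizing it, with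
   the same leaders over U, for infinitely many conjugates of a parameter of the
   dividing formula: by the pigeonhole principle infinitely many of these
   realizations have the same type over U. *)
Lemma nonforking n N (g : 'I_n -> 'I_N) (z : N.-tuple U) (A B : U -> Prop) :
  (forall x, A x -> B x) ->
  (forall t, DE (dcl B) (tnth z) t -> DE (dcl A) (tnth z) t) ->
  ~ forks A B [tuple tnth z (g i) | i < n].
Proof.
move=> AB EBA [phi [b [Bb phib [l [psi [c [divs cover]]]]]]].
pose E t := DE (dcl A) (tnth z) t.
have [G [GE EG]] := @dickson m N E (fun u v => @DE_vle m N U (tnth z) A u v).
have [al [Aal Gal]] := DE_finite_seq GE.
have Eal (w : N.-tuple U) : (forall t, t \in G -> DE (D al) (tnth w) t) -> forall t, E t -> DE (D al) (tnth w) t.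
  by move=> H t /EG[v /H]; exact: DE_vle.
have Eb t : DE (D (al ++ b)) (tnth z) t <-> E t.
  split=> [H|/(Eal z Gal)]; last by apply: DE_mono => x; rewrite mem_cat => ->.
  by apply: EBA; apply: DE_mono H => x; rewrite mem_cat => /orP[/Aal/AB|/Bb].
(* a realization z1 of tp(z / al b) independent from the c i over al b *)
have [L [h [t [qt Et]]]] := @independent_extension m N U U (al ++ b) (al ++ b) z (fun p => iff_refl _).
pose beta := al ++ b ++ flatten [seq c i | i <- enum 'I_l].
have [z1 qz1] := realize hU hsat hfin h t beta.
have sub_b : {subset b <= beta} by move=> x xb; rewrite !mem_cat xb orbT.
have sub_al : {subset al <= beta} by move=> x xb; rewrite !mem_cat xb.
have qb : qfeq (z1 ++ b) (z ++ b).
  apply: qfeq_trans (qfeq_sublist sub_b qz1) _; apply: qfeq_sym.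
  apply: (qfeq_taker (c1 := al) (c2 := map h al)); rewrite ?size_map //.
  by rewrite -map_cat.
have phi1 : dholds ([tuple tnth z1 (g i) | i < n] ++ b) phi.
  by apply/(qfeq_holds hU hsat hfin _ (qfeq_subtuple g qb)).
have [i0 psi1] := cover _ phi1.
have qal : qfeq (z ++ al) (z1 ++ al).
  apply: qfeq_trans (qfeq_sym (qfeq_sublist sub_al qz1)).
  by apply: (qfeq_takel (e1 := b) (e2 := map h b)); rewrite ?size_map // -map_cat.
pose c0 := c i0.
have sub_c0 : {subset c0 ++ al <= beta}.
  move=> x; rewrite !mem_cat => /orP[xc|->//]; apply/orP; right; apply/orP; right.
  by apply/flattenP; exists (c i0) => //; apply/mapP; exists i0; rewrite ?mem_enum.
have Gz1 u : u \in G -> DE (D al) (tnth z1) u by move/Gal; exact: DE_qfeq qal.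
have Ec u : DE (D (c0 ++ al)) (tnth z1) u <-> E u.
  split=> [/(DE_qfeq (qfeq_sublist sub_c0 qz1))/DE_map/Et/Eb //|/(Eal z1 Gz1)].
  by apply: DE_mono => x; rewrite mem_cat orbC => ->.
have [kk [cs [cst cinc]]] := divs i0.
(* for each conjugate cs j of c0, an independent realization of the transported type *)
have ext j : exists P : {L : dfield m & (dembed U L * N.-tuple L)%type},
    let h := (projT2 P).1 in let t := (projT2 P).2 in
    qfeq (z1 ++ (c0 ++ al)) (t ++ map h (cs j ++ al)) /\ forall u, DE (rg h) (tnth t) u <-> E u.
  have qc : qfeq (c0 ++ al) (cs j ++ al).
    by apply: qfeq_sym; apply: same_type_qfeq (cst j) Aal.
  have [Lj [hj [tj [q e]]]] := independent_extension z1 qc.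
  exists (existT _ Lj (hj, tj)); split=> //= u; rewrite -Ec; exact: iff_sym (e u).
pose P j := sval (cid (ext j)).
pose Lj j := projT1 (P j).
pose hj j : dembed U (Lj j) := (projT2 (P j)).1.
pose tj j : N.-tuple (Lj j) := (projT2 (P j)).2.
have qj j : qfeq (z1 ++ (c0 ++ al)) (tj j ++ map (hj j) (cs j ++ al)) by case: (svalP (cid (ext j))).
have Ej j u : E u <-> DE (rg (hj j)) (tnth (tj j)) u by case: (svalP (cid (ext j))) => _ H; exact: iff_sym (H u).
have sc j : size c0 = size (map (hj j) (cs j)) by rewrite size_map; case: (cst j).
have qjal j : qfeq (z1 ++ al) (tj j ++ map (hj j) al).
  by apply: (qfeq_taker (sc j)); rewrite -map_cat.
have qjc j : qfeq (z1 ++ c0) (tj j ++ map (hj j) (cs j)).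
  by apply: (qfeq_takel (sc j) (e1 := al) (e2 := map (hj j) al)); rewrite -map_cat.
have exf u : exists f : {poly dpol (dring_of U) 'I_N}, u \in G ->
    (forall k, pin (fun v => vlt v u) f`_k) /\
    forall j, map_poly (pt hj (fun j => tnth (tj j)) j) f <> 0 /\ pt hj (fun j => tnth (tj j)) j f.[pX u] = 0.
  have [uG|] := boolP (u \in G); last by exists 0.
  have /DE_list/algov_gens[Q [TQ Q0 Qz]] := Gz1 u uG.
  exists (map_poly (subl N al) Q) => _; split=> [k|j]; first by rewrite coef_map; exact: subl_pin (TQ k).
  have pts q : pt hj (fun j => tnth (tj j)) j (subl N al q) = ev (tj j ++ map (hj j) al) q.
    exact: (sublE al (dhom_of (hj j)) (tj j) q).
  split.
    move/polyP => H; move/eqP: Q0; apply; apply/polyP => k; rewrite coef_map coef0.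
    apply/(qjal j); rewrite -pts; have := H k.
    by rewrite !coef_map coef0.
  have -> : (map_poly (subl N al) Q).[pX u] = subl N al Q.[pX (u.1, u.2 : nat)].
    rewrite -horner_map /=; congr (_.[_]); rewrite /subl devX /= valK rdopY.
    by case: (u).
  rewrite pts; apply/(qjal j).
  by move: Qz; rewrite /root -(mpevX malg_theory (intmul 1 : {rmorphism int -> U}) (wl z1 al) (u.1, u.2 : nat)) horner_map => /eqP.
pose f u := sval (cid (exf u)).
have fP u := svalP (cid (exf u)).
have [B' [iB' agB]] : exists B, inf_set B /\ agree hj (fun j => tnth (tj j)) B (fun=> True).
  apply: (@point_pigeonhole m N U Lj hj (fun j => tnth (tj j)) E Ej G f).
  - move=> u /EG/up_shift[?|[i [v [[w wG wv] ->]]]]; [by left|right].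
    by exists i, v; split=> //; apply: DE_vle wv; exact: GE.
  - by move=> u k uG; exact: (fP u uG).1.
  - by move=> j u uG; exact: (fP u uG).2.
have [s [us ss sB]] := inf_pick kk iB'.
have [j1 _ Bj1] := iB' 0%N.
have [z2 qz2] := realize hU hsat hfin (hj j1) (tj j1) (flatten [seq cs j | j <- s]).
apply: (cinc s us ss); exists [tuple tnth z2 (g i) | i < n] => j js.
suff Hq : qfeq (z1 ++ c0) (z2 ++ cs j).
  by apply/(qfeq_holds hU hsat hfin _ (qfeq_subtuple g Hq)).
apply: qfeq_trans (qjc j) _; apply: qfeq_sym.
have sj : {subset cs j <= flatten [seq cs j | j <- s]}.
  by move=> x xj; apply/flattenP; exists (cs j) => //; exact: map_f.
apply: qfeq_trans (qfeq_sublist sj qz2) _ => p.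
have pts i q : pt hj (fun j => tnth (tj j)) i (subl N (cs j) q) = ev (tj i ++ map (hj i) (cs j)) q.
  exact: (sublE (cs j) (dhom_of (hj i)) (tj i) q).
by rewrite -!pts; split; apply: agB (pin_all _) => //; exact: sB.
Qed.

End Nonforking.

(** * The rank bound *)

Section Rank.
Variables (m : nat) (kappa : Type) (F U : dfield m) (iota : dembed F U).
Hypothesis hU : dclosed_field U.
Hypothesis hsat : saturated kappa U.
Hypothesis hfin : forall s : seq U, small kappa (fun x => x \in s).
Variables (n : nat) (l : 'I_n.+1 -> F).

Definition lform (a : n.+1.-tuple U) : U := \sum_j iota (l j) * tnth a j.
Definition ext_tuple (a : n.+1.-tuple U) : n.+2.-tuple U := [tuple of lform a :: a].

Lemma ext_tupleK (a : n.+1.-tuple U) : a = [tuple tnth (ext_tuple a) (lift ord0 i) | i < n.+1].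
Proof. by apply: eq_from_tnth => i; rewrite tnth_mktuple /ext_tuple tnthS. Qed.

Lemma DE_ext_tuple (A : U -> Prop) (a a' : n.+1.-tuple U) t : (forall c, A (iota c)) ->
  same_type A a a' -> DE (dcl A) (tnth (ext_tuple a)) t -> DE (dcl A) (tnth (ext_tuple a')) t.
Proof.
move=> FA st /DE_finite[al [Aal H]].
apply: (DE_mono Aal); move: H; apply: DE_qfeq.
pose ls := [seq iota (l j) | j <- enum 'I_n.+1].
have Als : params A ls by move=> x /mapP[j _ ->]; exact: FA.
have := same_type_qfeq st (params_cat Als Aal).
pose sg (k : nat) : dpol (int_dring m) nat :=
  if k is k'.+1 then (if (k' < n.+1)%N then dY _ k' else dY _ (k' + n.+1)%N)
  else \sum_(j < n.+1) dY _ (n.+1 + j)%N * dY _ (j : nat).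
have E (b : n.+1.-tuple U) k : nth 0 (ext_tuple b ++ al) k = ev (b ++ ls ++ al) (sg k).
  have sl : size ls = n.+1 by rewrite size_map size_enum_ord.
  case: k => [|k].
    rewrite /= rmorph_sum; apply: eq_bigr => j _; rewrite rmorphM /ev !devY.
    have -> : nth 0 (b ++ ls ++ al) j = tnth b j by rewrite nth_tcat ltn_ord -tnth_nth.
    rewrite nth_tcat ltnNge leq_addr /= addKn nth_cat sl ltn_ord; congr (_ * _).
    by rewrite (nth_map j) ?size_enum_ord // nth_ord_enum.
  have -> : nth 0 (ext_tuple b ++ al) k.+1 = nth 0 (b ++ al) k by [].
  rewrite /sg nth_tcat; case: ltnP => kn; rewrite /ev devY nth_tcat ?kn //.
  by rewrite ltnNge leq_addl /= addnK nth_cat sl ltnNge kn.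
by apply: (qfeq_sub (sigma := sg)) => k; exact: E.
Qed.

(* A forking extension enlarges the set of leaders, so that the slices covering
   its complement can be replaced by slices of smaller ordinal. *)
Lemma lascar_ge_sord (alpha : Ord) (A : U -> Prop) (a : n.+1.-tuple U) S :
  (forall c, A (iota c)) -> covers S (DE (dcl A) (tnth (ext_tuple a))) ->
  lascar_ge kappa alpha A a -> ole alpha (sord S).
Proof.
elim: alpha A a S => T f IH A a S FA cS ge; apply: ole_sup => i.
have [B [a' [[AB _] st fk ge']]] := ge i.
have cS' : covers S (DE (dcl A) (tnth (ext_tuple a'))).
  by move=> t nt; apply: cS => H; apply: nt; exact: DE_ext_tuple H.
have [t Bt nAt] : exists2 t, DE (dcl B) (tnth (ext_tuple a')) t & ~ DE (dcl A) (tnth (ext_tuple a')) t.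
  apply: contrapT => H; move: fk; rewrite {1}(ext_tupleK a').
  apply: (nonforking hU hsat hfin AB) => t Bt; apply: contrapT => nAt.
  by apply: H; exists t.
have [||S' [cS'' lt]] := covers_drop cS' _ _ Bt nAt.
- by move=> u v; apply: DE_vle.
- by move=> u; apply: DE_mono.
have FB c : B (iota c) by exact: AB.
exact: ole_olt_trans (IH i B a' S' FB cS'' ge') lt.
Qed.
End Rank.

Definition pairv (T : Type) (x y : T) (b : 'I_2) : T := if b == ord0 then x else y.

Section Bounded.
Variables (m : nat) (F U : dfield m) (iota : dembed F U).
Local Notation FY J := (dpol (dring_of F) J).

Lemma DE_equation (N : nat) (z z' : 'I_N -> U) (A : U -> Prop) (j : 'I_N) (G : FY 'I_N) (s : seq (dvar m 'I_N)) :
  (forall c, A (iota c)) -> (forall u, u \in s -> u.2 = j) ->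
  pin (fun u : dvar m 'I_N => (u.2 < j)%N \/ u \in s) G ->
  (forall i : 'I_N, (i < j)%N -> z i = z' i) ->
  dev (dhom_of iota) z G = 0 -> dev (dhom_of iota) z' G <> 0 ->
  exists2 u, u \in s & DE (dcl A) z u.
Proof.
move=> FA sj GT zz' G0 G1; apply: contrapT => H; apply: G1.
apply: (@peel m N U F _ iota (dcl A) z (pev iota (zz z')) (fun u => (u.2 < j)%N) s G) => //.
- by move=> r; exists (iota r), e0; rewrite rdop0.
- by move=> t ts Dt; apply: H; exists t.
- by move=> u t uj ts; left; rewrite (sj t ts).
- move=> c Tc; rewrite (@pev_pin _ _ _ iota (zz z) (zz z') _ c _ Tc) // => u uj.
  by rewrite /zz zz'.
Qed.

Definition vbound (s : seq (dvar m 'I_2)) : nat := \max_(u <- s) \max_(i < m) u.1 i.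

Lemma vboundP (s : seq (dvar m 'I_2)) (u : dvar m 'I_2) (i : 'I_m) : u \in s -> (u.1 i <= vbound s)%N.
Proof.
move=> us; apply: leq_trans (@leq_bigmax_seq _ s predT (fun u : dvar m 'I_2 => \max_(i < m) u.1 i)%N u us isT).
exact: (@leq_bigmax _ (fun i => u.1 i) i).
Qed.

Lemma DE_bounded (n : nat) (p : 'I_n.+1 -> FY 'I_2) :
  exists K : nat, forall (lam : U) (a : n.+1.-tuple U) (A : U -> Prop),
    (forall c, A (iota c)) ->
    (forall j, dev (dhom_of iota) (pairv lam (tnth a j)) (p j) = 0) ->
    (exists i, tnth a i = 1) ->
    (forall j, dev (dhom_of iota) (pairv 0 1) (p j) <> 0) ->
    (forall j, exists v, dev (dhom_of iota) (pairv lam v) (p j) <> 0) ->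
    forall i : 'I_n.+2, exists u : dvar m 'I_n.+2,
      [/\ u.2 = i, forall k, (u.1 k <= K)%N & DE (dcl A) (tnth [tuple of lam :: a]) u].
Proof.
pose s j := sval (cid (pin_seq (p j))).
have sP j : pin (fun k => k \in s j) (p j) by exact: svalP (cid (pin_seq (p j))).
exists (\max_j vbound (s j))%N => lam a A FA pa [i1 ai1] p01 pv i.
have bnd j (u : dvar m 'I_2) k : u \in s j -> (u.1 k <= \max_j vbound (s j))%N.
  by move=> us; apply: leq_trans (vboundP k us) _; exact: (@leq_bigmax _ (fun j => vbound (s j)) j).
pose z := tnth [tuple of lam :: a].
have z0 : z ord0 = lam by [].
have zS j : z (lift ord0 j) = tnth a j by rewrite /z tnthS.
case: (unliftP ord0 i) => [j ->|->].
  pose w b : FY 'I_n.+2 := dY _ (pairv ord0 (lift ord0 j) b).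
  pose G : FY 'I_n.+2 := dev (dpC _ _) w (p j).
  have GE z1 : dev (dhom_of iota) z1 G = dev (dhom_of iota) (pairv (z1 ord0) (z1 (lift ord0 j))) (p j).
    rewrite /G (dhom_dev _ (g := dhom_of iota)); last by move=> c; exact: devC.
    by apply: dev_ext => b; rewrite devY /pairv; case: ifP.
  have [v pjv] := pv j.
  case: (@DE_equation _ z (fun i => if i == lift ord0 j then v else z i) A (lift ord0 j) G
    [seq (u.1, lift ord0 j) | u <- s j] FA) => [|||||u us Du].
  - by move=> u /mapP[u' _ ->].
  - rewrite /G; elim: (sP j) => [c|[e b] kb|x y _ IH1 _ IH2|x y _ IH1 _ IH2].
    + by rewrite devC; exact: pinC.
    + rewrite devX /= /w rdopY; apply: pinX => /=; rewrite /pairv; case: eqP => _ /=; [by left|right].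
      by apply/mapP; exists (e, b).
    + by rewrite rmorphD; exact: pinD.
    + by rewrite rmorphM; exact: pinM.
  - by move=> k kj; rewrite ifN // -val_eqE ltn_eqF.
  - by rewrite GE z0 zS.
  - by rewrite GE eqxx /= z0.
  case/mapP: us => u' us' Eu; exists u; split=> //; first by rewrite Eu.
  by move=> k; rewrite Eu /=; exact: bnd us'.
pose w b : FY 'I_n.+2 := pairv (dY _ ord0) 1 b.
pose G : FY 'I_n.+2 := dev (dpC _ _) w (p i1).
have GE z1 : dev (dhom_of iota) z1 G = dev (dhom_of iota) (pairv (z1 ord0) 1) (p i1).
  rewrite /G (dhom_dev _ (g := dhom_of iota)); last by move=> c; exact: devC.
  by apply: dev_ext => b; rewrite /w /pairv; case: ifP; rewrite ?devY ?rmorph1.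
case: (@DE_equation _ z (fun=> 0) A ord0 G [seq (u.1, ord0) | u <- s i1] FA) => [|||||u us Du].
- by move=> u /mapP[u' _ ->].
- rewrite /G; elim: (sP i1) => [c|[e b] kb|x y _ IH1 _ IH2|x y _ IH1 _ IH2].
  + by rewrite devC; exact: pinC.
  + rewrite devX /= /w /pairv; case: eqP => _; last first.
      by rewrite -(rmorph1 (dpC (dring_of F) 'I_n.+2)) -dhom_rdop; exact: pinC.
    by rewrite rdopY; apply: pinX; right; apply/mapP; exists (e, b).
  + by rewrite rmorphD; exact: pinD.
  + by rewrite rmorphM; exact: pinM.
- by [].
- by rewrite GE z0 -ai1.
- by rewrite GE.
case/mapP: us => u' us' Eu; exists u; split=> //; first by rewrite Eu.
by move=> k; rewrite Eu /=; exact: bnd us'.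
Qed.

End Bounded.

Lemma oadd0 b : ole (oadd ozero b) b.
Proof. by elim: b => T g IH [[]|j]; exists j; exact: IH. Qed.

(* The slices that fix one coordinate to be at most K; they have dimension less than m. *)
Lemma bounded_covers (m N K : nat) : exists S : seq (slice m N), olt (sord S) (omega_pow m) /\
  forall E : dvar m 'I_N -> Prop, (forall u v, E u -> vle u v -> E v) ->
    (forall i, exists u : dvar m 'I_N, [/\ u.2 = i, forall k, (u.1 k <= K)%N & E u]) -> covers S E.
Proof.
pose full : {ffun 'I_m -> option nat} := [ffun=> None].
pose S : seq (slice m N) := [seq refine (jk.1, full) jk.2 v | jk <- enum {: 'I_N * 'I_m}, v <- iota 0 K.+1].
exists S; split.
  have c0 : scount S m = 0%N.
    apply/eqP; rewrite -leqn0 leqNgt -has_count; apply/hasP => -[y /allpairsP[[jk v] [_ _ ->]] /eqP E].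
    have : (sdim (refine (jk.1, full) jk.2 v) < m)%N.
      by apply: leq_trans (sdim_refine _ _) (sdim_le _); rewrite ffunE.
    by rewrite E ltnn.
  rewrite /sord /= c0 /=; apply: ole_olt_trans (oadd0 _) _; exact: osum_lt.
move=> E upE bE u nEu; have [v [vu vK Ev]] := bE u.2.
have [k uk] : exists k, (u.1 k < v.1 k)%N.
  apply: contrapT => H; apply: nEu; apply: upE Ev _; split=> // k.
  by rewrite leqNgt; apply/negP => uk; apply: H; exists k.
exists (refine (u.2, full) k (u.1 k)).
  apply/allpairsP; exists ((u.2, k), u.1 k); split=> //; first by rewrite mem_enum.
  by rewrite mem_iota /= add0n ltnS (leq_trans (ltnW uk)).
by split=> // i x; rewrite !ffunE; case: eqP => [->[]//|].
Qed.

(** * A quartic differential equation *)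

Section ConstantPoints.
Variables (m : nat) (F : dfield m).

Lemma dev_constants (J : choiceType) (b : J -> bool) (p : dpol (dring_of F) J) :
  exists q : {poly F}, forall (L : dfield m) (h : dembed F L) (e : L), (forall i, der i e = 0) ->
    dev (dhom_of h) (fun j => if b j then e else 1) p = (map_poly h q).[e].
Proof.
pose w (u : dvar m J) : {poly F} := if u.1 == e0 then (if b u.2 then 'X else 1) else 0.
exists (pev (polyC : F -> {poly F}) w p) => L h e ce.
have H : dev (dhom_of h) (fun j => if b j then e else 1) =1
    horner_eval e \o map_poly h \o pev (polyC : F -> {poly F}) w.
  apply: pol_ext => [c|u]; rewrite /= /horner_eval.
    by rewrite devC mpevC map_polyC hornerC.
  rewrite devX mpevX /w; case: eqP => [->|ne].
    by rewrite rdop0; case: (b _); rewrite ?map_polyX ?hornerX // rmorph1 hornerC.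
  rewrite rdop_const ?rmorph0 ?horner0 // => i.
  by case: (b _); rewrite ?rder1 //; exact: ce.
exact: H.
Qed.

Local Notation FP := (pol F bool).

(* Below, pX true = c and pX false = w with c' = E w and w' = -2 E c^3, so that
   E = w^2 + c^4 and e = 1 / E are constants and c' = w / e. *)
Lemma quartic_transcendental (L : fieldType) (phi : {rmorphism FP -> L}) (q : {poly F}) :
  (forall x, phi x = 0 -> x = 0) -> q <> 0 ->
  (map_poly (fun c => phi (pC c)) q).[(phi (pX false ^+ 2 + pX true ^+ 4))^-1] <> 0.
Proof.
move=> phi0 q0; set E := pX false ^+ 2 + pX true ^+ 4.

move=> H; pose d := (size q).-1.
have sq : size q = d.+1 by rewrite prednK // lt0n size_poly_eq0; apply/eqP.
have E0 : phi E != 0.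
  apply/eqP => /phi0 /(congr1 (pev (idfun : F -> F) (fun b : bool => if b then 0 else 1))).
  rewrite rmorph0 /E rmorphD !rmorphXn !mpevX expr1n expr0n addr0; apply/eqP; exact: oner_neq0.
pose r : FP := \sum_(i < d.+1) pC q`_i * E ^+ (d - i).
have r0 : r = 0.
  apply: phi0; rewrite /r rmorph_sum.
  move/(congr1 (fun x => x * phi E ^+ d)): H; rewrite mul0r => H; rewrite -[RHS]H.
  have -> : map_poly (fun c => phi (pC c)) q = \poly_(i < d.+1) phi (pC q`_i).
    by rewrite /map_poly sq.
  rewrite horner_poly big_distrl /=; apply: eq_bigr => i _; rewrite rmorphM rmorphXn -mulrA; congr (_ * _).
  have -> : phi E ^+ d = phi E ^+ (d - i) * phi E ^+ i by rewrite -exprD subnK // (ltnSE (ltn_ord i)).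
  by rewrite exprVn mulrCA mulVf ?mulr1 // expf_neq0.
move/(congr1 (pev (idfun : F -> F) (fun=> 0))): r0; rewrite rmorph0 /r rmorph_sum big_ord_recr big1 /=.
  rewrite subnn mulr1 mpevC add0r /= => /eqP; rewrite -[d]/((size q).-1) -lead_coefE lead_coef_eq0.
  by move/eqP.
move=> i _; rewrite rmorphM rmorphXn /E rmorphD !rmorphXn !mpevX !expr0n addr0 expr0n subn_eq0.
by rewrite leqNgt ltn_ord mulr0.
Qed.

Section QuarticPoint.
Variable i0 : 'I_m.

Let E : FP := pX false ^+ 2 + pX true ^+ 4.
Let g (i : 'I_m) (k : bool) : FP :=
  if i == i0 then (if k then E * pX false else - (2%:R * E * pX true ^+ 3)) else 0.

Lemma quartic_commute i j k :
  pder (R := dring_of F) g i (g j k) = pder (R := dring_of F) g j (g i k).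
Proof.
pose D l : FP -> FP := pder (R := dring_of F) g l.
have D0 l : D l 0 = 0.
  have := @pderD _ (dring_of F) _ g l 0 0; rewrite addr0 => H.
  by move: H; rewrite -[LHS]addr0 => /addrI.
have gn l k' : l != i0 -> g l k' = 0 by move=> /negPf ne; rewrite /g ne.
have Dg l k' : l != i0 -> D l (g i0 k') = 0.
  move=> ne.
  have cM x y : D l x = 0 -> D l y = 0 -> D l (x * y) = 0.
    by move=> Dx Dy; rewrite /D pderM -!/(D l _) Dx Dy mul0r mulr0 addr0.
  have cD x y : D l x = 0 -> D l y = 0 -> D l (x + y) = 0.
    by move=> Dx Dy; rewrite /D pderD -!/(D l _) Dx Dy addr0.
  have cC z : D l (pC z%:~R) = 0.
    by rewrite /D pderC (rder_int (dring_of F) l z) rmorph0.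
  have cX b : D l (pX b) = 0 by rewrite /D pderX gn.
  have c3 : D l (pX true * (pX true * pX true)) = 0 by exact: cM _ _ (cX _) (cM _ _ (cX _) (cX _)).
  have cE : D l E = 0.
    rewrite /E !exprS !expr0 !mulr1; apply: cD; first exact: cM _ _ (cX _) (cX _).
    exact: cM _ _ (cX _) c3.
  rewrite /g eqxx; case: k'; first exact: cM _ _ cE (cX _).
  have -> : - (2%:R * E * pX true ^+ 3) = pC (- 2%:Z)%:~R * (E * (pX true * (pX true * pX true))) :> FP.
    by rewrite rmorph_int !exprS expr0 mulr1 mulrNz mulNr -!mulrA.
  exact: cM _ _ (cC _) (cM _ _ cE c3).
case: (eqVneq i i0) => [->|ni]; case: (eqVneq j i0) => [->|nj] //.
- by rewrite (gn j) // -!/(D _ _) D0 Dg.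
- by rewrite (gn i) // -!/(D _ _) D0 Dg.
- by rewrite !gn // -!/(D _ _) !D0.
Qed.

Lemma quartic_point (q : {poly F}) : q <> 0 ->
  exists (L : dfield m) (h : dembed F L) (c e : L),
    [/\ forall i, der i e = 0, e ^+ 3 * der i0 c ^+ 2 + e * c ^+ 4 = 1,
      e ^+ 2 * der i0 (der i0 c) = - (2%:R * c ^+ 3) & (map_poly h q).[e] <> 0].
Proof.
move=> q0; pose R := pol_dring quartic_commute.
have [||||||L [phi [ker _]]] := @prime_dfrac m R (fun x => x = 0).
- by [].
- move=> n; have -> : n.+1%:R = pC n.+1%:R :> FP by rewrite rmorph_nat.
  move=> /(congr1 (pev (idfun : F -> F) (fun=> 0))); rewrite mpevC rmorph0 => /eqP.
  by have/pcharf0P -> := dchar0 F.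
- by move=> x y -> ->; rewrite addr0.
- by move=> x y ->; rewrite mulr0.
- exact: pol_domain.
- by move=> i x ->; rewrite rder0.
have phi0 x : phi x = 0 -> x = 0 by move/ker.
pose h : dembed F L := @DEmbed m F L (phi \o mpC malg_theory F bool)
  (fun i x => etrans (congr1 phi (esym (pderC (R := dring_of F) g i x))) (dhom_der phi i (pC x : R))).
have dX i k : der i (phi (pX k)) = phi (g i k).
  by rewrite -[RHS](congr1 phi (pderX (R := dring_of F) g i k)) (dhom_der phi i (pX k : R)).
pose c := phi (pX true); pose w := phi (pX false); pose E1 : L := phi E.
have E1E : E1 = w ^+ 2 + c ^+ 4 by rewrite /E1 /E rmorphD !rmorphXn.
have dc : der i0 c = E1 * w by rewrite dX /g eqxx rmorphM.
have dw : der i0 w = - (2%:R * E1 * c ^+ 3).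
  by rewrite dX /g eqxx rmorphN !rmorphM rmorph_nat mulrA.
have d0 i k : i != i0 -> der i (phi (pX k)) = 0 by rewrite dX /g => /negPf ->; rewrite rmorph0.
have dE i : der i E1 = 0.
  rewrite E1E !exprS !expr0 !mulr1 derD !derM.
  case: (eqVneq i i0) => [->|/d0 Di]; last by rewrite /w /c !Di; ring.
  by rewrite dc dw; ring.
have E0 : E1 != 0.
  apply/eqP => /phi0 /(congr1 (pev (idfun : F -> F) (fun b : bool => if b then 0 else 1))).
  rewrite rmorph0 /E rmorphD !rmorphXn !mpevX expr1n expr0n addr0; apply/eqP; exact: oner_neq0.
have dV i : der i E1^-1 = 0.
  have := congr1 (der i) (mulfV E0); rewrite derM dE mul0r add0r => H.
  have {H} /eqP : E1 * der i E1^-1 = 0 by rewrite H; exact: (rder1 (dring_of L) i).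
  by rewrite mulf_eq0 (negPf E0) => /eqP.
exists L, h, c, E1^-1; split=> //.
- rewrite dc; have -> : c ^+ 4 = E1 - w ^+ 2 by rewrite E1E addrAC subrr add0r.
  by field.
- by rewrite dc derM dE dw; field.
- exact: quartic_transcendental.
Qed.

End QuarticPoint.
End ConstantPoints.

Section QuarticModel.
Variables (m : nat) (F : dfield m).
Hypothesis hF : dclosed_field F.
Variable i0 : 'I_m.
Local Notation F2 := (dpol (dring_of F) 'I_2).

Lemma dev_pairv_comp (S : dring m) (J : choiceType) (f : dhom (dring_of F) S) (v : J -> S)
    (a b : dpol (dring_of F) J) (p : F2) :
  dev f v (dev (dpC (dring_of F) J) (pairv a b) p) = dev f (pairv (dev f v a) (dev f v b)) p.
Proof.
rewrite (dhom_dev _ (g := f)); last by move=> c; exact: devC.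
by apply: dev_ext => k; rewrite /pairv; case: ifP.
Qed.

Lemma dev_pairv_constant (p : F2) : exists q : {poly F},
  (forall (L : dfield m) (h : dembed F L) (e : L), (forall i, der i e = 0) ->
    dev (dhom_of h) (pairv 1 e) p = (map_poly h q).[e]) /\
  (forall (L : dfield m) (h : dembed F L), h q.[0] = dev (dhom_of h) (pairv 1 0) p).
Proof.
have [q H] := dev_constants (fun b : 'I_2 => b != ord0) p.
have H' (L : dfield m) (h : dembed F L) (e : L) : (forall i, der i e = 0) ->
    dev (dhom_of h) (pairv 1 e) p = (map_poly h q).[e].
  by move=> /H <-; apply: dev_ext => b; rewrite /pairv; case: eqP.
exists q; split=> // L h; rewrite H'; first by rewrite -(rmorph0 h) horner_map.
by move=> i; apply: (rder0 (dring_of L)).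
Qed.

Lemma quartic_point_closed (U : dfield m) (iota : dembed F U) (p : F2) :
  dev (dhom_of iota) (pairv 1 0) p <> 0 ->
  exists c e : F, [/\ e ^+ 3 * der i0 c ^+ 2 + e * c ^+ 4 = 1,
    e ^+ 2 * der i0 (der i0 c) = - (2%:R * c ^+ 3) &
    dev (dhom_of iota) (pairv 1 (iota e)) p <> 0].
Proof.
move=> p0; have [q [Hq Hq0]] := dev_pairv_constant p.
have q0 : q <> 0 by move=> q0; apply: p0; rewrite -Hq0 q0 horner0 rmorph0.
have [L [h [c [e [ec H1 H2 H3]]]]] := quartic_point i0 q0.
pose C : F2 := dY _ ord0; pose E : F2 := dY _ (lift ord0 ord0).
pose P1 : F2 := E ^+ 3 * rder i0 C ^+ 2 + E * C ^+ 4 - 1.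
pose P2 : F2 := E ^+ 2 * rder i0 (rder i0 C) + 2%:R * C ^+ 3.
pose P3 : F2 := dev (dpC _ _) (pairv 1 E) p.
have D (K : dfield m) (f : dhom (dring_of F) (dring_of K)) (v : 'I_2 -> dring_of K) :
    let c := v ord0 in let e := v (lift ord0 ord0) in
    [/\ dev f v P1 = e ^+ 3 * rder i0 c ^+ 2 + e * c ^+ 4 - 1,
      dev f v P2 = e ^+ 2 * rder i0 (rder i0 c) + 2%:R * c ^+ 3 &
      dev f v P3 = dev f (pairv 1 e) p].
  split.
  - by rewrite /P1 !(rmorphB, rmorphD, rmorphM, rmorphXn, rmorph1, dhom_der) /= /C /E !devY.
  - by rewrite /P2 !(rmorph_nat, rmorphXn, rmorphM, dhom_der, rmorphD) /= /C /E !devY.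
  - by rewrite /P3 dev_pairv_comp rmorph1 devY.
have [|a [a0 a1]] := hF (L := L) (h := h) (n := 2) (eqs := [:: to_malg P1; to_malg P2]) (neqs := [:: to_malg P3]).
  exists (pairv c e); have [D1 D2 D3] := D L (dhom_of h) (pairv c e).
  split=> P; rewrite !inE.
    case/orP=> /eqP ->; rewrite (deval_to (dhom_of h)); first by rewrite D1; apply/eqP; rewrite subr_eq0; apply/eqP.
    by rewrite D2; apply/eqP; rewrite addr_eq0; apply/eqP.
  by move=> /eqP ->; rewrite (deval_to (dhom_of h)) D3 Hq.
have [D1 D2 D3] := D F (id_hom _) a.
exists (a ord0), (a (lift ord0 ord0)); split.
- apply/eqP; rewrite -subr_eq0 -[X in X == 0]D1 -(deval_to (id_hom (dring_of F))).
  by rewrite a0 // !inE eqxx.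
- apply/eqP; rewrite -addr_eq0 -[X in X == 0]D2 -(deval_to (id_hom (dring_of F))).
  by rewrite a0 // !inE eqxx orbT.
have := a1 (to_malg P3); rewrite inE eqxx => /(_ isT); rewrite (deval_to (id_hom (dring_of F))) D3.
set e1 := a _ => H H'; apply: H; apply: (fmorph_inj iota); rewrite rmorph0 -[RHS]H'.
rewrite -[LHS]/(dhom_of iota _) (dhom_dev _ (g := dhom_of iota)) //.
by apply: (@dev_ext m (dring_of F) (dring_of U) 'I_2) => k; rewrite /pairv; case: (k == _) => //=; rewrite rmorph1.
Qed.

End QuarticModel.

(** * Consequences of completeness *)

Section Complete.
Variables (m : nat) (F U : dfield m) (iota : dembed F U) (n : nat) (X : proj U n -> Prop).
Hypothesis hcomplete : dcomplete iota X.
Local Notation F2 := (dpol (dring_of F) 'I_2).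
Local Notation FP := (dpol (dring_of F) ('I_n.+1 + 'I_2)%type).
Local Notation at_pair x y := (dev (dhom_of iota) (pair_val (coord x) (coord y))).

Definition bihomogeneous (P : FP) : Prop := exists d e : nat,
  forall (L : dfield m) (h : dembed F L) (s t : L) (y : 'I_n.+1 -> L) (z : 'I_2 -> L),
    dev (dhom_of h) (pair_val (fun i => s * y i) (fun i => t * z i)) P =
    s ^+ d * t ^+ e * dev (dhom_of h) (pair_val y z) P.

Lemma complete_separates (T : Type) (P : T -> FP) (y0 : proj U 1) :
  (forall k, bihomogeneous (P k)) ->
  (forall x, X x -> exists k, at_pair x y0 (P k) <> 0) ->
  exists p : F2,
    [/\ exists d, forall (L : dfield m) (h : dembed F L) (t : L) (y : 'I_2 -> L),
          dev (dhom_of h) (fun i => t * y i) p = t ^+ d * dev (dhom_of h) y p,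
      dev (dhom_of iota) (coord y0) p <> 0 &
      forall x y, X x -> (forall k, at_pair x y (P k) = 0) -> dev (dhom_of iota) (coord y) p = 0].
Proof.
move=> bP nP.
have qp : quasi_projective (k := 1) iota (fun=> True).
  exists (fun=> True), (fun=> False); split=> [||y]; last by split=> // _; split.
    by exists (fun=> False); split.
  exists (fun p => p = to_malg (1 : F2)); split=> [p ->|y].
    by exists 0%N => L h t y; rewrite !(deval_to (dhom_of h)) !rmorph1 expr0 mulr1.
  split=> // /(_ _ erefl); rewrite (deval_to (dhom_of iota)) rmorph1 => /eqP.
  by rewrite oner_eq0.
pose Z (x : proj U n) (y : proj U 1) := forall k, at_pair x y (P k) = 0.
have Zc : dclosed2 iota Z.
  exists (fun p => exists k, p = to_malg (P k)); split=> [p [k ->]|x y].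
    have [d [e H]] := bP k; exists d, e => L h s t y z.
    rewrite !(deval_to (dhom_of h)); exact: H.
  split=> [H p [k ->]|H k]; first by rewrite (deval_to (dhom_of iota)).
  by rewrite -(deval_to (dhom_of iota)); apply: H; exists k.
have [C [[S [hS CS]] CE]] := hcomplete qp Zc.
have nC : ~ C y0.
  move=> Cy; have [_ /(_ (conj I Cy))[x [Xx _ Zx]]] := CE y0.
  by have [k] := nP x Xx; rewrite Zx.
have [p [Sp p0]] : exists p, S p /\ deval iota (coord y0) p <> 0.
  apply: contrapT => H; apply: nC; apply/CS => p Sp; apply: contrapT => H'.
  by apply: H; exists p.
exists (of_malg malg_theory p); split.
- have [d H] := hS p Sp; exists d => L h t y.
  rewrite -!(deval_dev (dhom_of h)); exact: H.
- by rewrite -(deval_dev (dhom_of iota)).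
move=> x y Xx Zxy; rewrite -(deval_dev (dhom_of iota)).
have [/(_ _)/proj2 Cy _] := CE y; last by apply: (proj1 (CS y)) Sp; apply: Cy; exists x.
Qed.

Definition point (a b : U) (ab : normalized [tuple a; b]) : proj U 1 :=
  exist (fun c : 2.-tuple U => normalized c) [tuple a; b] ab.

Lemma point_coord a b ab : coord (@point a b ab) =1 pairv a b.
Proof. by move=> i; rewrite /coord /pairv; case: i => [[|[|i]] lti]. Qed.

Lemma normalized_1e e : normalized [tuple (1 : U); e].
Proof. by apply/existsP; exists ord0; rewrite eqxx; apply/forallP => j; rewrite ltn0. Qed.

Lemma normalized_01 : normalized [tuple (0 : U); 1].
Proof.
apply/existsP; exists (lift ord0 ord0); rewrite eqxx; apply/forallP => j; apply/implyP.
by case: j => [[|j] ltj].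
Qed.

Lemma coord_eq1 (x : proj U n) : exists i, coord x i = 1.
Proof. by case: x => x nx; case/existsP: (nx) => i /andP[/eqP xi _]; exists i. Qed.

Definition linp (l : 'I_n.+1 -> F) : FP :=
  \sum_j dpC (dring_of F) _ (l j) * dY _ (inl j : 'I_n.+1 + 'I_2)%type.

Lemma dev_linp (S : dring m) (f : dhom (dring_of F) S) (y : 'I_n.+1 -> S) (z : 'I_2 -> S) l :
  dev f (pair_val y z) (linp l) = \sum_j f (l j) * y j.
Proof.
by rewrite rmorph_sum; apply: eq_bigr => j _; rewrite rmorphM [dev _ _ (dpC _ _ _)]devC devY.
Qed.

Lemma dev_linpZ (S : dring m) (f : dhom (dring_of F) S) s y t (z : 'I_2 -> S) l :
  dev f (pair_val (fun i => s * y i) (fun i => t * z i)) (linp l) = s * dev f (pair_val y z) (linp l).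
Proof. by rewrite !dev_linp mulr_sumr; apply: eq_bigr => j _; rewrite mulrCA. Qed.

Lemma dev_inr (S : dring m) (f : dhom (dring_of F) S) (y : 'I_n.+1 -> S) (z : 'I_2 -> S) k :
  dev f (pair_val y z) (dY _ (inr k : 'I_n.+1 + 'I_2)%type) = z k.
Proof. exact: devY. Qed.

End Complete.

Section QuarticForms.
Variables (m : nat) (S : dring m) (i : 'I_m).
Implicit Types (y u v s t : S).

Definition wronskian u v := rder i u * v - u * rder i v.
(* For u = c v these are, up to powers of v, the homogenizations in (y0 : y1) of
   e^3 c'^2 + e c^4 = 1 and e^2 c'' + 2 c^3 = 0, where e = y1 / y0. For a
   constant e the second follows from the first; it removes the point v = 0 over
   e = 0. *)
Definition quartic1 y0 y1 u v :=
  y1 ^+ 3 * wronskian u v ^+ 2 + y0 ^+ 2 * y1 * u ^+ 4 - y0 ^+ 3 * v ^+ 4.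
Definition quartic2 y0 y1 u v :=
  y1 ^+ 2 * (rder i (wronskian u v) * v - 2%:R * wronskian u v * rder i v) +
  2%:R * y0 ^+ 2 * u ^+ 3.

Lemma wronskianZ s u v : wronskian (s * u) (s * v) = s * s * wronskian u v.
Proof. by rewrite /wronskian !rderM; ring. Qed.

Lemma quartic1Z s t y0 y1 u v :
  quartic1 (t * y0) (t * y1) (s * u) (s * v) = s ^+ 4 * t ^+ 3 * quartic1 y0 y1 u v.
Proof. by rewrite /quartic1 wronskianZ; move: (wronskian u v) => W; ring. Qed.

Lemma quartic2Z s t y0 y1 u v :
  quartic2 (t * y0) (t * y1) (s * u) (s * v) = s ^+ 3 * t ^+ 2 * quartic2 y0 y1 u v.
Proof.
rewrite /quartic2 wronskianZ !rderM; move: (wronskian u v) (rder i) => W d; ring.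
Qed.

End QuarticForms.

Lemma dhom_quartic1 (m : nat) (S S' : dring m) (f : dhom S S') i y0 y1 u v :
  f (quartic1 i y0 y1 u v) = quartic1 i (f y0) (f y1) (f u) (f v).
Proof.
by rewrite /quartic1 /wronskian !(rmorphXn, rmorphM, rmorphB, dhom_der, rmorphD).
Qed.

Lemma dhom_quartic2 (m : nat) (S S' : dring m) (f : dhom S S') i y0 y1 u v :
  f (quartic2 i y0 y1 u v) = quartic2 i (f y0) (f y1) (f u) (f v).
Proof.
by rewrite /quartic2 /wronskian !(rmorph_nat, rmorphXn, rmorphM, rmorphB, dhom_der, rmorphD).
Qed.

Lemma quartic1_line (m : nat) (S : dring m) (i : 'I_m) (c e v : S) :
  quartic1 i 1 e (c * v) v = v ^+ 4 * (e ^+ 3 * rder i c ^+ 2 + e * c ^+ 4 - 1).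
Proof. by rewrite /quartic1 /wronskian !rderM; move: (rder i) => d; ring. Qed.

Lemma quartic2_line (m : nat) (S : dring m) (i : 'I_m) (c e v : S) :
  quartic2 i 1 e (c * v) v = v ^+ 3 * (e ^+ 2 * rder i (rder i c) + 2%:R * c ^+ 3).
Proof.
have W : wronskian i (c * v) v = v * v * rder i c by rewrite /wronskian !rderM; move: (rder i) => d; ring.
by rewrite /quartic2 W !rderM; move: (rder i) => d; ring.
Qed.

Section Forms.
Variables (m : nat) (F U : dfield m) (iota : dembed F U) (n : nat) (X : proj U n -> Prop).
Hypothesis hF : dclosed_field F.
Hypothesis hcomplete : dcomplete iota X.
Variable i0 : 'I_m.
Local Notation F2 := (dpol (dring_of F) 'I_2).
Local Notation FP := (dpol (dring_of F) ('I_n.+1 + 'I_2)%type).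
Local Notation at_pair x y := (dev (dhom_of iota) (pair_val (coord x) (coord y))).
Local Notation lev l x := (lform iota l (val x)).

Lemma at_linp (x : proj U n) (y : proj U 1) (l : 'I_n.+1 -> F) : at_pair x y (linp l) = lev l x.
Proof. by rewrite dev_linp. Qed.

Lemma dev_point (a b : U) (ab : normalized [tuple a; b]) (p : F2) :
  dev (dhom_of iota) (coord (point ab)) p = dev (dhom_of iota) (pairv a b) p.
Proof. by apply: (@dev_ext m (dring_of F) (dring_of U) 'I_2) => k; exact: point_coord. Qed.

Definition no_common_zero k (L : 'I_k.+1 -> 'I_n.+1 -> F) : Prop :=
  forall x, X x -> exists i, lev (L i) x <> 0.

Lemma hyperplane_avoiding : exists l : 'I_n.+1 -> F, forall x, X x -> lev l x <> 0.
Proof.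
pose Q k := `[< exists L : 'I_k.+1 -> 'I_n.+1 -> F, no_common_zero L >].
have exQ : exists k, Q k.
  exists n; apply/asboolP; exists (fun i j => (i == j)%:R) => x Xx.
  have [i xi] := coord_eq1 x; exists i; rewrite /lform (bigD1 i) //= eqxx rmorph1 mul1r.
  rewrite -/(coord x i) xi big1 ?addr0; first by apply/eqP; exact: oner_neq0.
  by move=> j /negPf ji; rewrite eq_sym ji rmorph0 mul0r.
case: (ex_minnP exQ) => -[|k] /asboolP[L ncL] kmin.
  by exists (L ord0) => x /ncL[i]; rewrite (ord1 i).
exfalso.
pose two : 'I_k.+2 := lift ord0 ord0.
have meet (c : F) : exists2 x, X x & [/\ lev (L two) x <> 0, lev (L ord0) x = iota c * lev (L two) x &
    forall j : 'I_k, lev (L (lift ord0 (lift ord0 j))) x = 0].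
  pose w (i : 'I_k.+2) : F := if i == ord0 then c else (i == two)%:R.
  have [x [Xx Hx]] : exists x, X x /\ forall i : 'I_k.+1, lev (L (lift two i)) x = iota (w (lift two i)) * lev (L two) x.
    apply: contrapT => H.
    suff : (k.+1 <= k)%N by rewrite ltnn.
    apply: kmin; apply/asboolP.
    exists (fun i j => L (lift two i) j - w (lift two i) * L two j) => x Xx.
    apply: contrapT => H'; apply: H; exists x; split=> // i.
    apply: contrapT => Hi; apply: H'; exists i => H'; apply: Hi.
    apply/eqP; rewrite -subr_eq0 -[X in _ == X]H' /lform mulr_sumr -sumrB; apply/eqP.
    by apply: eq_bigr => j _; rewrite rmorphB rmorphM mulrBl mulrA.
  have Hx' i : i != two -> lev (L i) x = iota (w i) * lev (L two) x.
    by case: (unliftP two i) => [j ->|->]; rewrite ?eqxx.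
  exists x => //; split; last first.
  - move=> j; rewrite Hx' //.
      by have -> : w (lift ord0 (lift ord0 j)) = 0 by []; rewrite rmorph0 mul0r.
  - by rewrite Hx'.
  move=> L20; have [i] := ncL x Xx; apply.
  by case: (eqVneq i two) => [->//|/Hx' ->]; rewrite L20 mulr0.
pose Y0 : FP := dY _ (inr ord0 : 'I_n.+1 + 'I_2)%type.
pose Y1 : FP := dY _ (inr (lift ord0 ord0) : 'I_n.+1 + 'I_2)%type.
pose P (b : bool + 'I_k) : FP := match b with
  | inl true => quartic1 i0 Y0 Y1 (linp (L ord0)) (linp (L two))
  | inl false => quartic2 i0 Y0 Y1 (linp (L ord0)) (linp (L two))
  | inr j => linp (L (lift ord0 (lift ord0 j))) end.
have bP b : bihomogeneous (P b).
  case: b => [[]|j].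
  - exists 4%N, 3%N => M h s t y z.
    by rewrite !dhom_quartic1 !dev_linpZ /Y0 /Y1 !dev_inr quartic1Z.
  - exists 3%N, 2%N => M h s t y z.
    by rewrite !dhom_quartic2 !dev_linpZ /Y0 /Y1 !dev_inr quartic2Z.
  - by exists 1%N, 0%N => M h s t y z; rewrite dev_linpZ expr0 expr1 mulr1.
have PE x y : [/\ at_pair x y (P (inl true)) =
      quartic1 (S := dring_of U) i0 (coord y ord0) (coord y (lift ord0 ord0)) (lev (L ord0) x) (lev (L two) x),
    at_pair x y (P (inl false)) =
      quartic2 (S := dring_of U) i0 (coord y ord0) (coord y (lift ord0 ord0)) (lev (L ord0) x) (lev (L two) x) &
    forall j, at_pair x y (P (inr j)) = lev (L (lift ord0 (lift ord0 j))) x].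
  split; first by rewrite dhom_quartic1 !at_linp /Y0 /Y1 !dev_inr.
    by rewrite dhom_quartic2 !at_linp /Y0 /Y1 !dev_inr.
  by move=> j; rewrite at_linp.
have [||p [_ p0 pZ]] := @complete_separates _ _ _ _ _ _ hcomplete _ P (point (normalized_1e (0 : U))).
- exact: bP.
- move=> x Xx; apply: contrapT => H.
  have {}H b : at_pair x (point (normalized_1e (0 : U))) (P b) = 0.
    by apply: contrapT => Hb; apply: H; exists b.
  have [E1 E2 E3] := PE x (point (normalized_1e (0 : U))).
  move: E1; rewrite H !point_coord /quartic1 => E1.
  have v0 : lev (L two) x = 0.
    apply/eqP; rewrite -[_ == _](expf_eq0 _ 4%N) -oppr_eq0; apply/eqP; rewrite [RHS]E1.
    by rewrite /pairv /=; ring.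
  move: E2; rewrite H !point_coord /quartic2 => E2.
  have u0 : lev (L ord0) x = 0.
    have : 2%:R * lev (L ord0) x ^+ 3 == 0 by apply/eqP; rewrite [RHS]E2 /pairv /=; ring.
    by rewrite mulf_eq0 expf_eq0 /=; have/pcharf0P -> := dchar0 U; move=> /eqP.
  have [i] := ncL x Xx; apply.
  case: (unliftP ord0 i) => [j ->|->//]; case: (unliftP ord0 j) => [l ->|->//].
  by rewrite -E3 H.
have {}p0 : dev (dhom_of iota) (pairv 1 0) p <> 0.
  by move: p0; rewrite dev_point.
have [c [e [H1 H2 H3]]] := quartic_point_closed hF i0 p0.
apply: H3; have [x Xx [v0 uv rest]] := meet c.
rewrite -(dev_point (normalized_1e (iota e))).
apply: (pZ x) => // b; have [E1 E2 E3] := PE x (point (normalized_1e (iota e))).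
case: b => [[]|j].
- rewrite E1 !point_coord uv quartic1_line.
  have -> : rder i0 (iota c : dring_of U) = iota (der i0 c) by exact: esym (demb_der iota _ _).
  by rewrite -!rmorphXn -!rmorphM -rmorphD H1 rmorph1 subrr mulr0.
- rewrite E2 !point_coord uv quartic2_line.
  have -> : rder i0 (rder i0 (iota c : dring_of U)) = iota (der i0 (der i0 c)) by have E i z : iota (der i z) = der i (iota z) := demb_der iota i z; rewrite !E.
  by rewrite -!rmorphXn -!rmorphM H2 rmorphN rmorphM rmorph_nat addNr mulr0.
- by rewrite E3.
Qed.
End Forms.

Lemma natr_injective (K : fieldType) : [pchar K] =i pred0 -> injective (fun N : nat => N%:R : K).
Proof.
move/pcharf0P => c0 a b /eqP; wlog le : a b / (a <= b)%N => [H|].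
  by case/orP: (leq_total a b) => /H // H' /[1! eq_sym] /H'.
by rewrite eq_sym -subr_eq0 -natrB // c0 subn_eq0 => ba; apply/eqP; rewrite eqn_leq le.
Qed.

Lemma nat_nonroot (K : fieldType) (q : {poly K}) : [pchar K] =i pred0 -> q <> 0 ->
  exists N : nat, q.[N%:R] <> 0.
Proof.
move=> c0 q0; apply: contrapT => H.
pose rs : seq K := [seq N%:R | N <- seq.iota 0 (size q)].
suff : (size rs < size q)%N by rewrite size_map size_iota ltnn.
apply: max_poly_roots; first exact/eqP.
  by apply/allP => _ /mapP[N _ ->]; apply/rootP; apply: contrapT => qN; apply: H; exists N.
by rewrite map_inj_uniq ?iota_uniq //; exact: natr_injective.
Qed.

Section Equations.
Variables (m : nat) (F U : dfield m) (iota : dembed F U) (n : nat) (X : proj U n -> Prop).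
Hypothesis hF : dclosed_field F.
Hypothesis hcomplete : dcomplete iota X.
Variable i0 : 'I_m.
Local Notation F2 := (dpol (dring_of F) 'I_2).
Local Notation FP := (dpol (dring_of F) ('I_n.+1 + 'I_2)%type).
Local Notation at_pair x y := (dev (dhom_of iota) (pair_val (coord x) (coord y))).
Local Notation lev l x := (lform iota l (val x)).

Lemma complete_equations : exists (l : 'I_n.+1 -> F) (p : 'I_n.+1 -> F2),
  (forall j, dev (dhom_of iota) (pairv 0 1) (p j) <> 0) /\ forall x, X x ->
  (forall j, dev (dhom_of iota) (pairv (lev l x) (coord x j)) (p j) = 0) /\
  (forall j, exists v, dev (dhom_of iota) (pairv (lev l x) v) (p j) <> 0).
Proof.
have [l lX] := hyperplane_avoiding hF hcomplete i0; exists l.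
suff H j : exists p : F2, dev (dhom_of iota) (pairv 0 1) p <> 0 /\ forall x, X x ->
    dev (dhom_of iota) (pairv (lev l x) (coord x j)) p = 0 /\
    exists v, dev (dhom_of iota) (pairv (lev l x) v) p <> 0.
  have [p pH] := choice H; exists p; split=> [j|x Xx]; first by have [] := pH j.
  by split=> j; have [_ /(_ x Xx)[]] := pH j.
pose Y0 : FP := dY _ (inr ord0 : 'I_n.+1 + 'I_2)%type.
pose Y1 : FP := dY _ (inr (lift ord0 ord0) : 'I_n.+1 + 'I_2)%type.
pose XJ : FP := dY _ (inl j : 'I_n.+1 + 'I_2)%type.
pose P (_ : unit) : FP := Y0 * XJ - Y1 * linp l.
have PE (S : dring m) (f : dhom (dring_of F) S) (y : 'I_n.+1 -> S) z b :
    dev f (pair_val y z) (P b) = z ord0 * y j - z (lift ord0 ord0) * dev f (pair_val y z) (linp l).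
  by rewrite rmorphB !rmorphM /Y0 /Y1 /XJ !devY.
have PU x y b : at_pair x y (P b) = coord y ord0 * coord x j - coord y (lift ord0 ord0) * lev l x.
  by rewrite PE at_linp.
have [||p [[d pd] p0 pZ]] := @complete_separates _ _ _ _ _ _ hcomplete _ P (point (normalized_01 U)).
- move=> b; exists 1%N, 1%N => L h s t y z.
  rewrite !PE dev_linpZ !expr1; move: (dev _ _ _) => u; ring.
- move=> x Xx; exists tt; rewrite PU !point_coord /pairv /= mul0r sub0r mul1r.
  by move/eqP; rewrite oppr_eq0 => /eqP; exact: lX.
have {}p0 : dev (dhom_of iota) (pairv 0 1) p <> 0 by move: p0; rewrite dev_point.
have pdU t a b : dev (dhom_of iota) (pairv (t * a) (t * b)) p = t ^+ d * dev (dhom_of iota) (pairv a b) p.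
  rewrite -pd; apply: (@dev_ext m (dring_of F) (dring_of U) 'I_2) => k.
  by rewrite /pairv; case: ifP.
exists p; split=> // x Xx; have l0 : lev l x != 0 by apply/eqP; exact: lX.
split.
  have := pZ x (point (normalized_1e (coord x j / lev l x))) Xx; rewrite dev_point => H.
  have -> : pairv (lev l x) (coord x j) = pairv (lev l x * 1) (lev l x * (coord x j / lev l x)).
    by rewrite mulr1 mulrCA mulfV // mulr1.
  rewrite pdU H ?mulr0 // => b.
  by rewrite PU !point_coord /pairv /= mul1r divfK // subrr.
have [q Hq] := dev_constants (fun b : 'I_2 => b == ord0) p.
have {}Hq e : (forall i, der i e = 0) -> dev (dhom_of iota) (pairv e 1) p = (map_poly iota q).[e] by move=> /Hq <-.
have q0 : q <> 0.
  move=> q0; apply: p0; rewrite Hq ?q0 ?rmorph0 ?horner0 // => i; exact: (rder0 (dring_of U)).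
have [|N] := @nat_nonroot _ (q * 'X) (dchar0 F).
  by move/eqP; rewrite mulf_eq0 polyX_eq0 orbF => /eqP.
rewrite hornerM hornerX => /eqP; rewrite mulf_eq0 negb_or => /andP[qN N0].
have NU : N%:R != 0 :> U by rewrite -(rmorph_nat iota) fmorph_eq0.
exists (lev l x / N%:R).
have -> : pairv (lev l x) (lev l x / N%:R) = pairv (lev l x / N%:R * N%:R) (lev l x / N%:R * 1).
  by rewrite mulr1 divfK.
rewrite pdU Hq; last by move=> i; exact: (rder_nat (dring_of U)).
rewrite -(rmorph_nat iota) horner_map -rmorphV ?unitfE //; apply/eqP.
by rewrite mulf_neq0 ?fmorph_eq0 // expf_neq0 // mulf_neq0 // fmorph_eq0 invr_eq0.
Qed.

End Equations.

Lemma finite_small (m : nat) (F U : dfield m) (kappa : Type) (s : seq U) :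
  small kappa (fun _ : F => True) -> small kappa (fun x => x \in s).
Proof.
move=> nF [g [gi gs]]; apply: nF; exists (fun k => (index (g k) s)%:R); split=> // a b.
move/(natr_injective (dchar0 F)) => E; apply: gi.
by rewrite -(nth_index 0 (gs a)) E nth_index.
Qed.

(* [U] is kappa-saturated and [F] has fewer than kappa elements. *)
Theorem theorem3p7 (m : nat) (hm : (0 < m)%N) (kappa : Type) (F U : dfield m)
  (hF : dclosed_field F) (hU : dclosed_field U) (iota : dembed F U)
  (hsat : saturated kappa U) (hsmall : small kappa (fun _ : F => True))
  (n : nat) (X : proj U n -> Prop) (hclosed : dclosed iota X)
  (hcomplete : dcomplete iota X) :
  exists alpha : Ord, lascar_rank_set kappa iota X alpha /\ olt alpha (omega_pow m).
Proof.
have [l [p [p0 pX]]] := complete_equations hF hcomplete (Ordinal hm).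
have [K HK] := DE_bounded iota p.
have [S [lt Scov]] := bounded_covers m n.+2 K.
pose A (u : U) := exists c, u = iota c.
pose bound b := forall x : proj U n, X x -> lascar_le kappa b A (val x).
have bS : bound (sord S).
  move=> x Xx ge; have FA c : A (iota c) by exists c.
  have hfin s := @finite_small m F U kappa s hsmall.
  apply: (@olt_irr (sord S)).
  apply: (lascar_ge_sord hU hsat hfin FA (l := l)) ge.
  apply: Scov; first by move=> u v; apply: DE_vle.
  move=> i; have [H1 H2] := pX x Xx.
  apply: HK => //; first exact: coord_eq1 x.
have [alpha [ba amin]] := ord_min (ex_intro bound _ bS).
exists alpha; split; first by split.
exact: ole_olt_trans (amin _ bS) lt.
Qed.
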